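(* If $\psi,\psi'\in\mathcal{E}^\Gamma$ have disjoint support, then $W_\Gamma(\psi+\psi')\cong W_\Gamma(\psi)\otimes W_\Gamma(\psi')$ as $(\mathfrak{g}\otimes A)^\Gamma$-modules.
   Context: Setting. Let $k$ be an algebraically closed field of characteristic zero, $A$ a finitely generated unital associative commutative $k$-algebra, $X=\mathrm{Spec}\,A$, and $X_{\mathrm{rat}}$ the set of rational points of $X$ (equal to $\mathrm{maxSpec}\,A$). Let $\mathfrak{g}$ be a finite-dimensional semisimple Lie algebra over $k$, and let $\Gamma$ be a finite abelian group acting on $A$ by $k$-algebra automorphisms (equivalently on $X$, with $(\gamma\cdot f)(x)=f(\gamma^{-1}\cdot x)$) and on $\mathfrak{g}$ by Lie algebra automorphisms. Assume $\Gamma$ acts freely on $X$, i.e. freely on $X_{\mathrm{rat}}$. The Lie algebra $\mathfrak{g}\otimes A$ (tensor over $k$) has bracket $[a\otimes f,b\otimes g]=[a,b]\otimes fg$; for $\alpha=\sum a_i\otimes f_i$ put $\alpha(x)=\sum f_i(x)a_i\in\mathfrak{g}$. $\Gamma$ acts diagonally on $\mathfrak{g}\otimes A$, and $(\mathfrak{g}\otimes A)^\Gamma$ is the fixed-point Lie subalgebra. Weights. Fix a triangular decomposition $\mathfrak{g}=\mathfrak{n}^-\oplus\mathfrak{h}\oplus\mathfrak{n}^+$ with compatible Chevalley generators $e_i,h_i,f_i$ ($i\in I$). $P^+$ is the set of dominant integral weights. $\Gamma$ acts on $P^+$: if $\rho$ is an irreducible representation of $\mathfrak{g}$ of highest weight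 $\lambda$, then $\gamma\cdot\lambda$ is the highest weight of $\rho\circ\gamma^{-1}$. $\mathcal{E}$ is the set of finitely supported functions $\psi:X_{\mathrm{rat}}\to P^+$, with $\mathrm{Supp}\,\psi=\{x:\psi(x)\neq0\}$, and $\mathcal{E}^\Gamma\subseteq\mathcal{E}$ is the subset of $\Gamma$-equivariant functions; functions are added pointwise. For $\psi\in\mathcal{E}^\Gamma$, $(\mathrm{Supp}\,\psi)_\Gamma$ is the set of subsets of $\mathrm{Supp}\,\psi$ containing exactly one point of each $\Gamma$-orbit in $\mathrm{Supp}\,\psi$; for $\mathbf{x}\in(\mathrm{Supp}\,\psi)_\Gamma$, $\psi_{\mathbf{x}}\in\mathcal{E}$ equals $\psi$ on $\mathbf{x}$ and $0$ elsewhere. Local Weyl modules. For $\psi\in\mathcal{E}$, the untwisted local Weyl module $W(\psi)$ is the $(\mathfrak{g}\otimes A)$-module generated by a nonzero vector $w_\psi$ with defining relations $(\mathfrak{n}^+\otimes A)\cdot w_\psi=0$; $(f_i\otimes1)^{\lambda(h_i)+1}\cdot w_\psi=0$ for $i\in I$, where $\lambda=\mathrm{wt}\,\psi:=\sum_{x\in\mathrm{Supp}\,\psi}\psi(x)$; and $\alpha\cdot w_\psi=\big(\sum_{x\in\mathrm{Supp}\,\psi}\psi(x)(\alpha(x))\big)w_\psi$ for $\alpha\in\mathfrak{h}\otimes A$. For $\psi\in\mathcal{E}^\Gamma$, the (twisted) local Weyl module $W_\Gamma(\psi)$ is the restriction to $(\mathfrak{g}\otimes A)^\Gamma$ of $W(\psi_{\mathbf{x}})$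 for some $\mathbf{x}\in(\mathrm{Supp}\,\psi)_\Gamma$ (independent of $\mathbf{x}$ up to isomorphism). *)

(* Defs.v *)
From HB Require Import structures.
From mathcomp Require Import all_boot all_order all_fingroup all_algebra.
From mathcomp Require Import generic_quotient.
From mathcomp Require Import boolp classical_sets functions cardinality fsbigop.

Set Implicit Arguments.
Unset Strict Implicit.
Unset Printing Implicit Defensive.

Import GRing.Theory.
Local Open Scope ring_scope.
Local Open Scope quotient_scope.

Definition bilin (k : fieldType) (U V W : lmodType k) (B : U -> V -> W) : Prop :=
  (forall v, linear (B^~ v)) /\ (forall u, linear (B u)).

(* Formal expressions built from generators in [X], the vector space operations
   over [k], and unary operators indexed by [L]. *)
Inductive pexpr (k X L : Type) : Type :=
| PGen of X
| PZero
| PAdd of pexpr k X L & pexpr k X L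
| PScale of k & pexpr k X L
| POp of L & pexpr k X L.

Arguments PGen {k X L}.
Arguments PZero {k X L}.
Arguments PAdd {k X L}.
Arguments PScale {k X L}.
Arguments POp {k X L}.

HB.instance Definition _ (k X L : Type) := gen_eqMixin (pexpr k X L).
HB.instance Definition _ (k X L : Type) := gen_choiceMixin (pexpr k X L).

(* The least congruence that contains [R], satisfies the axioms of a
   [k]-vector space and makes every operator [k]-linear. *)
Inductive pcong (k : fieldType) (X L : Type)
    (R : pexpr k X L -> pexpr k X L -> Prop) :
    pexpr k X L -> pexpr k X L -> Prop :=
| pc_rel e e' : R e e' -> pcong R e e'
| pc_refl e : pcong R e e
| pc_sym e e' : pcong R e e' -> pcong R e' e
| pc_trans e e' e'' : pcong R e e' -> pcong R e' e'' -> pcong R e e''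
| pc_add e1 e1' e2 e2' :
    pcong R e1 e1' -> pcong R e2 e2' -> pcong R (PAdd e1 e2) (PAdd e1' e2')
| pc_scale a e e' : pcong R e e' -> pcong R (PScale a e) (PScale a e')
| pc_op l e e' : pcong R e e' -> pcong R (POp l e) (POp l e')
| pc_addA e1 e2 e3 :
    pcong R (PAdd e1 (PAdd e2 e3)) (PAdd (PAdd e1 e2) e3)
| pc_addC e1 e2 : pcong R (PAdd e1 e2) (PAdd e2 e1)
| pc_add0 e : pcong R (PAdd PZero e) e
| pc_addN e : pcong R (PAdd (PScale (-1) e) e) PZero
| pc_scaleA a b e : pcong R (PScale a (PScale b e)) (PScale (a * b) e)
| pc_scale1 e : pcong R (PScale 1 e) e
| pc_scaleDr a e1 e2 :
    pcong R (PScale a (PAdd e1 e2)) (PAdd (PScale a e1) (PScale a e2))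
| pc_scaleDl a b e :
    pcong R (PScale (a + b) e) (PAdd (PScale a e) (PScale b e))
| pc_opD l e1 e2 : pcong R (POp l (PAdd e1 e2)) (PAdd (POp l e1) (POp l e2))
| pc_opZ l a e : pcong R (POp l (PScale a e)) (PScale a (POp l e)).

Section Presented.
Variables (k : fieldType) (X L : Type) (R : pexpr k X L -> pexpr k X L -> Prop).

Definition pcongb (e e' : pexpr k X L) : bool := `[< pcong R e e' >].

Lemma pcongb_refl : reflexive pcongb.
Proof. by move=> e; apply/asboolP/pc_refl. Qed.
Lemma pcongb_sym : symmetric pcongb.
Proof. by move=> e e'; apply/asboolP/asboolP => /pc_sym. Qed.
Lemma pcongb_trans : transitive pcongb.
Proof.
by move=> e' e e'' /asboolP h /asboolP h'; apply/asboolP/(pc_trans h h').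
Qed.

Definition pcong_equiv := EquivRel pcongb pcongb_refl pcongb_sym pcongb_trans.

Definition presented : Type := {eq_quot pcong_equiv}.
HB.instance Definition _ := Choice.on presented.

Definition pclass (e : pexpr k X L) : presented := \pi_({eq_quot pcong_equiv}) e.
Definition prepr (x : presented) : pexpr k X L :=
  repr (x : {eq_quot pcong_equiv}).

Lemma preprK x : pclass (prepr x) = x.
Proof. exact: reprK. Qed.

Lemma pclassP e e' : pclass e = pclass e' <-> pcong R e e'.
Proof.
split=> [/eqmodP /asboolP //|h].
by apply/eqmodP/asboolP.
Qed.

Lemma prepr_class e : pcong R (prepr (pclass e)) e.
Proof. by apply/pclassP; rewrite preprK. Qed.

Definition pr_add (x y : presented) := pclass (PAdd (prepr x) (prepr y)).
Definition pr_scale (a : k) (x : presented) := pclass (PScale a (prepr x)).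
Definition pop (l : L) (x : presented) := pclass (POp l (prepr x)).
Definition pgen (i : X) : presented := pclass (PGen i).

Lemma pr_addE e e' : pr_add (pclass e) (pclass e') = pclass (PAdd e e').
Proof. by apply/pclassP/pc_add; apply: prepr_class. Qed.
Lemma pr_scaleE a e : pr_scale a (pclass e) = pclass (PScale a e).
Proof. by apply/pclassP/pc_scale; apply: prepr_class. Qed.
Lemma popE l e : pop l (pclass e) = pclass (POp l e).
Proof. by apply/pclassP/pc_op; apply: prepr_class. Qed.

Lemma pr_addA : associative pr_add.
Proof.
move=> x y z; rewrite -[x]preprK -[y]preprK -[z]preprK !pr_addE.
exact/pclassP/pc_addA.
Qed.
Lemma pr_addC : commutative pr_add.
Proof.
by move=> x y; rewrite -[x]preprK -[y]preprK !pr_addE; apply/pclassP/pc_addC.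
Qed.
Lemma pr_add0 : left_id (pclass PZero) pr_add.
Proof. by move=> x; rewrite -[x]preprK pr_addE; apply/pclassP/pc_add0. Qed.
Lemma pr_addN : left_inverse (pclass PZero) (pr_scale (-1)) pr_add.
Proof.
by move=> x; rewrite -[x]preprK pr_scaleE pr_addE; apply/pclassP/pc_addN.
Qed.

HB.instance Definition _ :=
  GRing.isZmodule.Build presented pr_addA pr_addC pr_add0 pr_addN.

Lemma pr_scaleA a b x : pr_scale a (pr_scale b x) = pr_scale (a * b) x.
Proof. by rewrite -[x]preprK !pr_scaleE; apply/pclassP/pc_scaleA. Qed.
Lemma pr_scale1 : left_id 1 pr_scale.
Proof. by move=> x; rewrite -[x]preprK pr_scaleE; apply/pclassP/pc_scale1. Qed.
Lemma pr_scaleDr : right_distributive pr_scale +%R.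
Proof.
move=> a x y; rewrite -[x]preprK -[y]preprK /GRing.add/=.
by rewrite !(pr_scaleE, pr_addE); apply/pclassP/pc_scaleDr.
Qed.
Lemma pr_scaleDl x : {morph pr_scale^~ x : a b / a + b}.
Proof.
move=> a b; rewrite -[x]preprK /GRing.add/=.
by rewrite !(pr_scaleE, pr_addE); apply/pclassP/pc_scaleDl.
Qed.

HB.instance Definition _ := GRing.Zmodule_isLmodule.Build k presented
  pr_scaleA pr_scale1 pr_scaleDr pr_scaleDl.

Lemma pclass0 : pclass PZero = 0. Proof. by []. Qed.
Lemma pclassD e e' : pclass (PAdd e e') = pclass e + pclass e'.
Proof. by rewrite -pr_addE. Qed.
Lemma pclassZ a e : pclass (PScale a e) = a *: pclass e.
Proof. by rewrite -pr_scaleE. Qed.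
Lemma pclass_op l e : pclass (POp l e) = pop l (pclass e).
Proof. by rewrite popE. Qed.

Lemma pop_linear l : linear (pop l).
Proof.
move=> a x y; rewrite -[x]preprK -[y]preprK.
rewrite -pclassZ -pclassD -!pclass_op -pclassZ -pclassD; apply/pclassP.
apply: pc_trans (pc_opD _ _ _ _) _; apply: pc_add; last exact: pc_refl.
exact: pc_opZ.
Qed.

Lemma presented_ind (P : presented -> Prop) :
    (forall i, P (pgen i)) -> P 0 -> (forall x y, P x -> P y -> P (x + y)) ->
    (forall a x, P x -> P (a *: x)) -> (forall l x, P x -> P (pop l x)) ->
  forall x, P x.
Proof.
move=> Pg P0 PD PZ PO x; rewrite -[x]preprK.
elim: (prepr x) => [i||e1 h1 e2 h2|a e h|l e h].
- exact: Pg.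
- exact: P0.
- by rewrite pclassD; apply: PD.
- by rewrite pclassZ; apply: PZ.
- by rewrite pclass_op; apply: PO.
Qed.

Section Lift.
Variables (N : lmodType k) (gen : X -> N) (op : L -> N -> N).

Fixpoint pfold (e : pexpr k X L) : N :=
  match e with
  | PGen i => gen i
  | PZero => 0
  | PAdd e1 e2 => pfold e1 + pfold e2
  | PScale a e1 => a *: pfold e1
  | POp l e1 => op l (pfold e1)
  end.

Definition plift (x : presented) : N := pfold (prepr x).

Hypothesis op_linear : forall l, linear (op l).
Hypothesis pfold_rel : forall e e', R e e' -> pfold e = pfold e'.

Lemma pfold_cong e e' : pcong R e e' -> pfold e = pfold e'.
Proof.
elim=> {e e'} /=.
- exact: pfold_rel.
- by [].
- by [].
- by move=> e e' e'' _ -> _ ->.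
- by move=> e1 e1' e2 e2' _ -> _ ->.
- by move=> a e e' _ ->.
- by move=> l e e' _ ->.
- by move=> e1 e2 e3; rewrite addrA.
- by move=> e1 e2; rewrite addrC.
- by move=> e; rewrite add0r.
- by move=> e; rewrite scaleN1r addNr.
- by move=> a b e; rewrite scalerA.
- by move=> e; rewrite scale1r.
- by move=> a e1 e2; rewrite scalerDr.
- by move=> a b e; rewrite scalerDl.
- by move=> l e1 e2; have := op_linear l 1 (pfold e1) (pfold e2); rewrite !scale1r.
- move=> l a e; have op0 : op l 0 = 0.
    have := op_linear l 1 0 0; rewrite !scale1r addr0 => /eqP.
    by rewrite -subr_eq0 opprD addrA subrr sub0r oppr_eq0 => /eqP.
  by have := op_linear l a (pfold e) 0; rewrite op0 !addr0.
Qed.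

Lemma plift_class e : plift (pclass e) = pfold e.
Proof. exact/pfold_cong/prepr_class. Qed.
Lemma plift_gen i : plift (pgen i) = gen i.
Proof. exact: plift_class. Qed.
Lemma plift_op l x : plift (pop l x) = op l (plift x).
Proof. by rewrite -[x]preprK -pclass_op !plift_class. Qed.
Lemma plift_linear : linear plift.
Proof.
move=> a x y; rewrite -[x]preprK -[y]preprK.
by rewrite -pclassZ -pclassD !plift_class.
Qed.
End Lift.
End Presented.

Inductive tensor_rel (k : fieldType) (U V : lmodType k) :
    pexpr k (U * V) void -> pexpr k (U * V) void -> Prop :=
| tensor_rell a u u' v : tensor_rel
    (PGen (a *: u + u', v)) (PAdd (PScale a (PGen (u, v))) (PGen (u', v)))
| tensor_relr a u v v' : tensor_rel
    (PGen (u, a *: v + v')) (PAdd (PScale a (PGen (u, v))) (PGen (u, v'))).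

Section Tensor.
Variables (k : fieldType) (U V : lmodType k).

Definition tensor : Type := presented (@tensor_rel k U V).
HB.instance Definition _ := GRing.Lmodule.on tensor.

Definition tens (u : U) (v : V) : tensor := pgen (@tensor_rel k U V) (u, v).

(* The linear map induced by [B]; meaningful when [B] is bilinear. *)
Definition tlift (N : lmodType k) (B : U -> V -> N) : tensor -> N :=
  plift (R := @tensor_rel k U V) (fun p => B p.1 p.2) (fun _ x => x).

Lemma tens_bilin : bilin tens.
Proof.
split=> [v a u u'|u a v v'].
  have /pclassP := pc_rel (tensor_rell a u u' v).
  by rewrite pclassD pclassZ.
have /pclassP := pc_rel (tensor_relr a u v v').
by rewrite pclassD pclassZ.
Qed.

Lemma tensor_ind (P : tensor -> Prop) :
    (forall u v, P (tens u v)) -> P 0 -> (forall x y, P x -> P y -> P (x + y)) ->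
    (forall a x, P x -> P (a *: x)) ->
  forall x, P x.
Proof. by move=> Pt P0 PD PZ; apply: presented_ind => // -[u v]; apply: Pt. Qed.

Section Lift.
Variables (N : lmodType k) (B : U -> V -> N).
Hypothesis B_bilin : bilin B.

Lemma tensor_rel_fold e e' : tensor_rel e e' ->
  pfold (fun p => B p.1 p.2) (fun _ x => x) e =
  pfold (fun p => B p.1 p.2) (fun _ x => x) e'.
Proof. by case=> [a u u' v|a u v v'] /=; [apply: B_bilin.1 | apply: B_bilin.2]. Qed.

Lemma tlift_tens u v : tlift B (tens u v) = B u v.
Proof.
by rewrite /tlift plift_gen //; apply: tensor_rel_fold.
Qed.

Lemma tlift_linear : linear (tlift B).
Proof. by apply: plift_linear => //; apply: tensor_rel_fold. Qed.
End Lift.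

Lemma tensor_lin_ext (N : lmodType k) (F G : tensor -> N) :
    linear F -> linear G -> (forall u v, F (tens u v) = G (tens u v)) ->
  forall x, F x = G x.
Proof.
have lin0 (H : tensor -> N) : linear H -> H 0 = 0.
  move=> lH; have := lH 1 0 0; rewrite !scale1r addr0 => /eqP.
  by rewrite -subr_eq0 opprD addrA subrr sub0r oppr_eq0 => /eqP.
move=> lF lG FG; elim/tensor_ind => [//||x y hx hy|a x hx].
- by rewrite !lin0.
- by have := lF 1 x y; have := lG 1 x y; rewrite !scale1r hx hy => -> ->.
- by have := lF a x 0; have := lG a x 0; rewrite !addr0 !lin0 // !addr0 hx => -> ->.
Qed.
End Tensor.

HB.mixin Record isLieAlgebra (k : fieldType) L of GRing.Lmodule k L := {
  lie : L -> L -> L;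
  lie_bilin : bilin lie;
  liexx : forall x, lie x x = 0;
  lie_jacobi : forall x y z,
    lie x (lie y z) + lie y (lie z x) + lie z (lie x y) = 0
}.

#[short(type="lieAlgType")]
HB.structure Definition LieAlgebra (k : fieldType) :=
  {L of isLieAlgebra k L & GRing.Lmodule k L}.

#[short(type="finLieAlgType")]
HB.structure Definition FinLieAlgebra (k : fieldType) :=
  {L of isLieAlgebra k L & Vector k L}.

Record lieMod (k : fieldType) (L : lieAlgType k) := LieMod {
  lm_sort :> lmodType k;
  lm_act : L -> lm_sort -> lm_sort;
  lm_bilin : bilin lm_act;
  lm_lie : forall x y v,
    lm_act (lie x y) v = lm_act x (lm_act y v) - lm_act y (lm_act x v)
}.

Definition lm_iso (k : fieldType) (L : lieAlgType k) (M N : lieMod L) : Prop :=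
  exists F : M -> N, [/\ linear F, bijective F &
    forall (x : L) (v : M), F (lm_act x v) = lm_act x (F v)].

Definition is_submodule (k : fieldType) (L : lieAlgType k) (M : lieMod L)
    (S : set M) : Prop :=
  [/\ S 0, forall (a : k) v v', S v -> S v' -> S (a *: v + v') &
      forall (x : L) v, S v -> S (lm_act x v)].

Definition irreducible (k : fieldType) (L : lieAlgType k) (M : lieMod L) : Prop :=
  (exists v : M, v <> 0) /\
  forall S : set M, is_submodule S -> S = [set 0]%classic \/ S = setT.

Section Pullback.
Variables (k : fieldType) (L L' : lieAlgType k) (phi : L' -> L).
Hypothesis phi_linear : linear phi.
Hypothesis phi_lie : {morph phi : x y / lie x y}.
Variable M : lieMod L.

Definition pull_act (x : L') (v : M) : M := lm_act (phi x) v.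

Lemma pull_bilin : bilin pull_act.
Proof.
split=> [v a x y|x]; last exact: (lm_bilin M).2.
by rewrite /pull_act phi_linear; apply: (lm_bilin M).1.
Qed.

Lemma pull_lie x y v : pull_act (lie x y) v =
  pull_act x (pull_act y v) - pull_act y (pull_act x v).
Proof. by rewrite /pull_act phi_lie lm_lie. Qed.

Definition lm_pull : lieMod L' := LieMod pull_bilin pull_lie.
End Pullback.

Lemma cancel_cross (V : zmodType) (P Q S T a b : V) :
  P - Q + (S - T) = P + a + (b + S) - (Q + b + (a + T)).
Proof.
rewrite (addrC b S) (addrC a T) (addrACA P a) (addrACA Q) (addrC b a).
by rewrite [in RHS]opprD [RHS]addrACA subrr addr0 opprD addrACA.
Qed.

Section TensorModule.
Variables (k : fieldType) (L : lieAlgType k) (M N : lieMod L).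

Definition tm_pair (x : L) (m : M) (n : N) : tensor M N :=
  tens (lm_act x m) n + tens m (lm_act x n).

Lemma tm_pair_bilin x : bilin (tm_pair x).
Proof.
have [tl tr] := @tens_bilin k M N.
split=> [n a m m'|m a n n']; rewrite /tm_pair /=.
  by rewrite ((lm_bilin M).2 x) !tl scalerDr addrACA.
by rewrite ((lm_bilin N).2 x) !tr scalerDr addrACA.
Qed.

Definition tm_act (x : L) : tensor M N -> tensor M N := tlift (tm_pair x).

Lemma tm_act_tens x m n :
  tm_act x (tens m n) = tens (lm_act x m) n + tens m (lm_act x n).
Proof. exact/tlift_tens/tm_pair_bilin. Qed.

Lemma tm_act_linear x : linear (tm_act x).
Proof. exact/tlift_linear/tm_pair_bilin. Qed.

Lemma tm_act_bilin : bilin tm_act.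
Proof.
have [tl tr] := @tens_bilin k M N.
split=> [t a x y|]; last exact: tm_act_linear.
apply: (tensor_lin_ext (F := tm_act (a *: x + y))
  (G := fun t => a *: tm_act x t + tm_act y t)).
- exact: tm_act_linear.
- move=> b u v; rewrite !tm_act_linear !scalerDr addrACA; congr (_ + _).
  by congr (_ + _); rewrite !scalerA mulrC.
- move=> m n; rewrite !tm_act_tens ((lm_bilin M).1 m) ((lm_bilin N).1 n).
  by rewrite tl tr scalerDr addrACA.
Qed.

Lemma tm_act_lie x y t :
  tm_act (lie x y) t = tm_act x (tm_act y t) - tm_act y (tm_act x t).
Proof.
have actD z u v : tm_act z (u + v) = tm_act z u + tm_act z v.
  by have := tm_act_linear z 1 u v; rewrite !scale1r.
have tensBl m m' n : tens (m - m') n = tens m n - tens m' n :> tensor M N.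
  by have := (@tens_bilin k M N).1 n (-1) m' m; rewrite /= !scaleN1r => h;
  rewrite addrC h addrC.
have tensBr m n n' : tens m (n - n') = tens m n - tens m n' :> tensor M N.
  by have := (@tens_bilin k M N).2 m (-1) n' n; rewrite !scaleN1r => h;
  rewrite addrC h addrC.
move: t; apply: (tensor_lin_ext (F := tm_act (lie x y))
  (G := fun t => tm_act x (tm_act y t) - tm_act y (tm_act x t))).
- exact: tm_act_linear.
- by move=> b u v; rewrite !tm_act_linear opprD addrACA scalerBr.
- move=> m n; rewrite !tm_act_tens !actD !tm_act_tens !lm_lie tensBl tensBr.
  exact: cancel_cross.
Qed.

Definition lm_tensor : lieMod L := LieMod tm_act_bilin tm_act_lie.
End TensorModule.

(* The [L]-module with generators [X] and defining relations [R]: an operator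
   [POp x] stands for the action of [x]. *)
Inductive lie_rel (k : fieldType) (X : Type) (L : lieAlgType k)
    (R : pexpr k X L -> pexpr k X L -> Prop) :
    pexpr k X L -> pexpr k X L -> Prop :=
| lr_rel e e' : R e e' -> lie_rel R e e'
| lr_lin a x y e : lie_rel R
    (POp (a *: x + y) e) (PAdd (PScale a (POp x e)) (POp y e))
| lr_lie x y e : lie_rel R
    (POp (lie x y) e) (PAdd (POp x (POp y e)) (PScale (-1) (POp y (POp x e)))).

Section PresentedLieModule.
Variables (k : fieldType) (X : Type) (L : lieAlgType k).
Variable R : pexpr k X L -> pexpr k X L -> Prop.

Lemma plm_bilin : bilin (@pop k X L (lie_rel R)).
Proof.
split=> [v a x y|x]; last exact: pop_linear.
rewrite -[v]preprK; have /pclassP := pc_rel (lr_lin R a x y (prepr v)).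
by rewrite pclassD pclassZ !pclass_op.
Qed.

Lemma plm_lie x y (v : presented (lie_rel R)) :
  pop (lie x y) v = pop x (pop y v) - pop y (pop x v).
Proof.
rewrite -[v]preprK; have /pclassP := pc_rel (lr_lie R x y (prepr v)).
by rewrite pclassD pclassZ scaleN1r !pclass_op.
Qed.

Definition lm_presented : lieMod L := LieMod plm_bilin plm_lie.
End PresentedLieModule.

Section MapAlgebra.
Variables (k : fieldType) (g : lieAlgType k) (A : comAlgType k).

Definition mapAlg : Type := tensor g A.
HB.instance Definition _ := GRing.Lmodule.on mapAlg.

Definition map_pair (a : g) (f : A) (b : g) (h : A) : mapAlg :=
  tens (lie a b) (f * h).

Definition map_lie (s t : mapAlg) : mapAlg :=
  tlift (fun a f => tlift (map_pair a f) t) s.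

Let tl := (@tens_bilin k g A).1.
Let tr := (@tens_bilin k g A).2.

Lemma map_pair_bilin a f : bilin (map_pair a f).
Proof.
split=> [h c b b'|b c h h']; rewrite /map_pair.
  by rewrite (lie_bilin.2 a) tl.
by rewrite mulrDr -scalerAr tr.
Qed.

Lemma map_lie_bilin_aux t :
  bilin (fun a f => tlift (map_pair a f) t : mapAlg).
Proof.
split=> [f c a a'|a c f f']; move: t.
- apply: (tensor_lin_ext (F := tlift (map_pair (c *: a + a') f))
    (G := fun t => c *: tlift (map_pair a f) t + tlift (map_pair a' f) t)).
  + exact/tlift_linear/map_pair_bilin.
  + move=> d u v; rewrite !(tlift_linear (map_pair_bilin _ _)).
    by rewrite !scalerDr addrACA !scalerA (mulrC c).
  + move=> b h; rewrite !(tlift_tens (map_pair_bilin _ _)) /map_pair.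
    by rewrite (lie_bilin.1 b) tl.
- apply: (tensor_lin_ext (F := tlift (map_pair a (c *: f + f')))
    (G := fun t => c *: tlift (map_pair a f) t + tlift (map_pair a f') t)).
  + exact/tlift_linear/map_pair_bilin.
  + move=> d u v; rewrite !(tlift_linear (map_pair_bilin _ _)).
    by rewrite !scalerDr addrACA !scalerA (mulrC c).
  + move=> b h; rewrite !(tlift_tens (map_pair_bilin _ _)) /map_pair.
    by rewrite mulrDl -scalerAl tr.
Qed.

Lemma map_lie_tens a f b h :
  map_lie (tens a f) (tens b h) = tens (lie a b) (f * h).
Proof.
rewrite /map_lie (tlift_tens (map_lie_bilin_aux _)).
by rewrite (tlift_tens (map_pair_bilin _ _)).
Qed.

Lemma map_lie_bilin : bilin map_lie.
Proof.
split=> [t|s c t t']; first exact/tlift_linear/map_lie_bilin_aux.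
move: s; apply: (tensor_lin_ext (F := fun s => map_lie s (c *: t + t'))
  (G := fun s => c *: map_lie s t + map_lie s t')).
- exact: (tlift_linear (map_lie_bilin_aux _)).
- move=> d u v; rewrite /map_lie !(tlift_linear (map_lie_bilin_aux _)).
  by rewrite !scalerDr addrACA !scalerA (mulrC c).
- move=> a f; rewrite /map_lie !(tlift_tens (map_lie_bilin_aux _)).
  exact: (tlift_linear (map_pair_bilin _ _)).
Qed.

Let mlDl s s' t : map_lie (s + s') t = map_lie s t + map_lie s' t.
Proof. by have := map_lie_bilin.1 t 1 s s'; rewrite !scale1r. Qed.
Let mlDr s t t' : map_lie s (t + t') = map_lie s t + map_lie s t'.
Proof. by have := map_lie_bilin.2 s 1 t t'; rewrite !scale1r. Qed.
Let ml0l t : map_lie 0 t = 0.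
Proof. by apply: (addIr (map_lie 0 t)); rewrite -mlDl !add0r. Qed.
Let ml0r t : map_lie t 0 = 0.
Proof. by apply: (addIr (map_lie t 0)); rewrite -mlDr !add0r. Qed.
Let mlZl c s t : map_lie (c *: s) t = c *: map_lie s t.
Proof. by have := map_lie_bilin.1 t c s 0; rewrite ml0l !addr0. Qed.
Let mlZr c s t : map_lie s (c *: t) = c *: map_lie s t.
Proof. by have := map_lie_bilin.2 s c t 0; rewrite ml0r !addr0. Qed.

Let lieC (a b : g) : lie a b + lie b a = 0.
Proof.
have lDl (x y z : g) : lie (x + y) z = lie x z + lie y z.
  by have := lie_bilin.1 z 1 x y; rewrite !scale1r.
have lDr (x y z : g) : lie z (x + y) = lie z x + lie z y.
  by have := lie_bilin.2 z 1 x y; rewrite !scale1r.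
by have := liexx (a + b); rewrite lDl !lDr !liexx add0r addr0.
Qed.

Let tens0 f : tens 0 f = 0 :> tensor g A.
Proof.
apply: (addIr (tens 0 f)).
by have := tl f 1 0 0; rewrite !scale1r !add0r.
Qed.

Let tensDl a b f : tens (a + b) f = tens a f + tens b f :> tensor g A.
Proof. by have := tl f 1 a b; rewrite !scale1r. Qed.

Lemma map_lieC s t : map_lie s t + map_lie t s = 0.
Proof.
elim/tensor_ind: s => [a f||s s' hs hs'|c s hs].
- elim/tensor_ind: t => [b h||t t' ht ht'|c t ht].
  + by rewrite !map_lie_tens (mulrC h) -tensDl lieC tens0.
  + by rewrite ml0l ml0r addr0.
  + by rewrite mlDl mlDr addrACA ht ht' addr0.
  + by rewrite mlZl mlZr -scalerDr ht scaler0.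
- by rewrite ml0l ml0r addr0.
- by rewrite mlDl mlDr addrACA hs hs' addr0.
- by rewrite mlZl mlZr -scalerDr hs scaler0.
Qed.

Lemma map_liexx s : map_lie s s = 0.
Proof.
elim/tensor_ind: s => [a f||s s' hs hs'|c s hs].
- by rewrite map_lie_tens liexx tens0.
- exact: ml0l.
- by rewrite mlDl !mlDr hs hs' add0r addr0 map_lieC.
- by rewrite mlZl mlZr hs !scaler0.
Qed.

Lemma map_jacobi s t u :
  map_lie s (map_lie t u) + map_lie t (map_lie u s) + map_lie u (map_lie s t) = 0.
Proof.
have addr6 (x x' y y' z z' : mapAlg) :
    x + x' + (y + y') + (z + z') = x + y + z + (x' + y' + z').
  by rewrite (addrACA x) (addrACA (x + y)).
elim/tensor_ind: s => [a f||s s' hs hs'|c s hs].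
- elim/tensor_ind: t => [b h||t t' ht ht'|c t ht].
  + elim/tensor_ind: u => [d l||u u' hu hu'|c u hu].
    * rewrite !map_lie_tens.
      have -> : h * (l * f) = f * (h * l) by rewrite (mulrC l) mulrCA.
      have -> : l * (f * h) = f * (h * l) by rewrite mulrCA (mulrC l).
      by rewrite -!tensDl lie_jacobi tens0.
    * by rewrite !(ml0l, ml0r) !addr0.
    * by rewrite !(mlDl, mlDr) addr6 hu hu' addr0.
    * by rewrite !(mlZl, mlZr) -!scalerDr hu scaler0.
  + by rewrite !(ml0l, ml0r) !addr0.
  + by rewrite !(mlDl, mlDr) addr6 ht ht' addr0.
  + by rewrite !(mlZl, mlZr) -!scalerDr ht scaler0.
- by rewrite !(ml0l, ml0r) !addr0.
- by rewrite !(mlDl, mlDr) addr6 hs hs' addr0.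
- by rewrite !(mlZl, mlZr) -!scalerDr hs scaler0.
Qed.

HB.instance Definition _ := isLieAlgebra.Build k mapAlg
  map_lie_bilin map_liexx map_jacobi.

Definition mtens (a : g) (f : A) : mapAlg := tens a f.
End MapAlgebra.

Section Points.
Variables (k : fieldType) (A : comAlgType k).

Definition Xrat : Type := {lrmorphism A -> k^o}.
HB.instance Definition _ := gen_eqMixin Xrat.
HB.instance Definition _ := gen_choiceMixin Xrat.

Definition pt_eval (x : Xrat) (f : A) : k := (x : {lrmorphism A -> k^o}) f.

Definition fin_gen_alg : Prop :=
  exists s : seq A, forall S : set A,
    S 1 -> (forall (a : k) f h, S f -> S h -> S (a *: f + h)) ->
    (forall f h, S f -> S h -> S (f * h)) -> (forall f, f \in s -> S f) ->
    forall f, S f.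

(* [alpha(x)] for [alpha] in [g (x) A] *)
Definition map_eval (g : lieAlgType k) (x : Xrat) : mapAlg g A -> g :=
  tlift (fun (a : g) (f : A) => pt_eval x f *: a).
End Points.

Record lieAction (k : fieldType) (Gam : finGroupType) (L : lieAlgType k) :=
  LieAction {
  la_fun :> Gam -> L -> L;
  la_linear : forall c, linear (la_fun c);
  la_lie : forall c, {morph la_fun c : x y / lie x y};
  la_1 : forall x, la_fun 1%g x = x;
  la_M : forall c d x, la_fun (c * d)%g x = la_fun c (la_fun d x)
}.

Record algAction (k : fieldType) (Gam : finGroupType) (A : comAlgType k) :=
  AlgAction {
  aa_fun :> Gam -> {lrmorphism A -> A};
  aa_1 : forall f, aa_fun 1%g f = f;
  aa_M : forall c d f, aa_fun (c * d)%g f = aa_fun c (aa_fun d f)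
}.

(* [(c . f)(x) = f (c^-1 . x)], so [c . x] is the point [f |-> x (c^-1 . f)]. *)
Definition pt_act (k : fieldType) (Gam : finGroupType) (A : comAlgType k)
    (aA : algAction Gam A) (c : Gam) (x : Xrat A) : Xrat A :=
  ((x : {lrmorphism A -> k^o}) \o aA c^-1%g : {lrmorphism A -> k^o}).

Definition acts_freely (k : fieldType) (Gam : finGroupType) (A : comAlgType k)
    (aA : algAction Gam A) : Prop :=
  forall c (x : Xrat A), pt_act aA c x = x -> c = 1%g.

Section DiagonalAction.
Variables (k : fieldType) (Gam : finGroupType).
Variables (g : lieAlgType k) (A : comAlgType k).
Variables (ag : lieAction Gam g) (aA : algAction Gam A).

Definition diag_pair (c : Gam) (a : g) (f : A) : mapAlg g A :=
  mtens (ag c a) (aA c f).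

Definition diag_fun (c : Gam) : mapAlg g A -> mapAlg g A := tlift (diag_pair c).

Lemma diag_pair_bilin c : bilin (diag_pair c).
Proof.
split=> [f b a a'|a b f f']; rewrite /diag_pair.
  by rewrite la_linear; apply: (@tens_bilin k g A).1.
by rewrite linearP; apply: (@tens_bilin k g A).2.
Qed.

Lemma diag_tens c a f : diag_fun c (mtens a f) = mtens (ag c a) (aA c f).
Proof. exact: (tlift_tens (diag_pair_bilin c)). Qed.

Lemma diag_linear c : linear (diag_fun c).
Proof. exact: (tlift_linear (diag_pair_bilin c)). Qed.

Lemma diag_lie c : {morph diag_fun c : x y / lie x y}.
Proof.
move=> x y; move: x; apply: (tensor_lin_ext (U := g) (V := A) (N := mapAlg g A)
  (F := fun x => diag_fun c (lie (x : mapAlg g A) y))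
  (G := fun x => lie (diag_fun c x) (diag_fun c y))).
- by move=> b u v; rewrite (lie_bilin.1 y) diag_linear.
- by move=> b u v; rewrite diag_linear; apply: lie_bilin.1.
move=> a f; move: y; apply: (tensor_lin_ext (U := g) (V := A) (N := mapAlg g A)
  (F := fun y => diag_fun c (lie (mtens a f) (y : mapAlg g A)))
  (G := fun y => lie (diag_fun c (mtens a f)) (diag_fun c y))).
- by move=> b u v; rewrite (lie_bilin.2 (mtens a f)) diag_linear.
- by move=> b u v; rewrite diag_linear; apply: lie_bilin.2.
move=> b h; rewrite -/(mtens b h) !diag_tens.
rewrite [in RHS]/lie /= [in LHS]/lie /= !map_lie_tens -/(mtens _ _) diag_tens.
by rewrite la_lie rmorphM.
Qed.

Lemma diag_1 x : diag_fun 1%g x = x.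
Proof.
move: x; apply: (tensor_lin_ext (U := g) (V := A) (N := mapAlg g A)
  (F := diag_fun 1%g) (G := id)) => //; first exact: diag_linear.
by move=> a f; rewrite -/(mtens a f) diag_tens la_1 aa_1.
Qed.

Lemma diag_M c d x : diag_fun (c * d)%g x = diag_fun c (diag_fun d x).
Proof.
move: x; apply: (tensor_lin_ext (U := g) (V := A) (N := mapAlg g A)
  (F := diag_fun (c * d)%g) (G := fun x => diag_fun c (diag_fun d x))).
- exact: diag_linear.
- by move=> b u v; rewrite !diag_linear.
- by move=> a f; rewrite -/(mtens a f) !diag_tens la_M aa_M.
Qed.

Definition diag_action : lieAction Gam (mapAlg g A) :=
  LieAction diag_linear diag_lie diag_1 diag_M.
End DiagonalAction.

Section FixedPoints.
Variables (k : fieldType) (Gam : finGroupType) (L : lieAlgType k).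
Variable r : lieAction Gam L.

Definition fixed_by : {pred L} := [pred x | [forall c, r c x == x]].

Lemma fixed_byP x : reflect (forall c, r c x = x) (x \in fixed_by).
Proof. exact: 'forall_eqP. Qed.

Lemma fixed_by_closed : subsemimod_closed fixed_by.
Proof.
have r0 c : r c 0 = 0.
  by apply: (addIr (r c 0)); have := la_linear r c 1 0 0; rewrite !scale1r !add0r.
split; first split.
- by apply/fixed_byP.
- move=> x y /fixed_byP hx /fixed_byP hy; apply/fixed_byP => c.
  by have := la_linear r c 1 x y; rewrite !scale1r hx hy.
- move=> a x /fixed_byP hx; apply/fixed_byP => c.
  by have := la_linear r c a x 0; rewrite r0 !addr0 hx.
Qed.

Definition fixedAlg : Type := {x : L | x \in fixed_by}.
HB.instance Definition _ := SubChoice.on fixedAlg.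
HB.instance Definition _ :=
  GRing.SubChoice_isSubLmodule.Build k L fixed_by fixedAlg fixed_by_closed.

Definition fixed_val (x : fixedAlg) : L := sval x.

Lemma fixed_val_inj : injective fixed_val.
Proof. exact: val_inj. Qed.

Lemma fixed_valP x c : r c (fixed_val x) = fixed_val x.
Proof. exact: (fixed_byP _ (svalP x)). Qed.

Lemma fixed_val_linear : linear fixed_val.
Proof. by move=> a x y; apply: (linearP (val : fixedAlg -> L)). Qed.

Lemma fixed_val0 : fixed_val 0 = 0.
Proof. exact: (linear0 (val : fixedAlg -> L)). Qed.

Lemma fixed_valD x y : fixed_val (x + y) = fixed_val x + fixed_val y.
Proof. by have := fixed_val_linear 1 x y; rewrite !scale1r. Qed.

Lemma fixed_lie_subproof x y : lie (fixed_val x) (fixed_val y) \in fixed_by.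
Proof. by apply/fixed_byP => c; rewrite la_lie !fixed_valP. Qed.

Definition fixed_lie (x y : fixedAlg) : fixedAlg :=
  exist _ (lie (fixed_val x) (fixed_val y)) (fixed_lie_subproof x y).

Lemma fixed_val_lie x y :
  fixed_val (fixed_lie x y) = lie (fixed_val x) (fixed_val y).
Proof. by []. Qed.

Lemma fixed_lie_bilin : bilin fixed_lie.
Proof.
split=> [y a x x'|x a y y']; apply: fixed_val_inj;
  rewrite fixed_val_linear !fixed_val_lie fixed_val_linear.
  exact: (lie_bilin.1 (fixed_val y)).
exact: (lie_bilin.2 (fixed_val x)).
Qed.

Lemma fixed_liexx x : fixed_lie x x = 0.
Proof. by apply: fixed_val_inj; rewrite fixed_val_lie liexx fixed_val0. Qed.

Lemma fixed_jacobi x y z : fixed_lie x (fixed_lie y z) +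
  fixed_lie y (fixed_lie z x) + fixed_lie z (fixed_lie x y) = 0.
Proof.
apply: fixed_val_inj.
by rewrite !fixed_valD fixed_val0 !fixed_val_lie lie_jacobi.
Qed.

HB.instance Definition _ := isLieAlgebra.Build k fixedAlg
  fixed_lie_bilin fixed_liexx fixed_jacobi.

Definition lm_restrict (M : lieMod L) : lieMod fixedAlg :=
  lm_pull fixed_val_linear fixed_val_lie M.
End FixedPoints.

Section FiniteDimensional.
Variables (k : fieldType) (g : finLieAlgType k).

Definition lieprod (U V : {vspace g}) : {vspace g} :=
  <<[seq lie u v | u <- vbasis U, v <- vbasis V]>>%VS.

Definition derived_series (U : {vspace g}) (n : nat) : {vspace g} :=
  iter n (fun V => lieprod V V) U.
Definition lower_central_series (U : {vspace g}) (n : nat) : {vspace g} :=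
  iter n (lieprod U) U.

Definition is_subalg (U : {vspace g}) : Prop :=
  forall x y, x \in U -> y \in U -> lie x y \in U.
Definition is_ideal (U : {vspace g}) : Prop :=
  forall x y, y \in U -> lie x y \in U.
Definition is_solvable (U : {vspace g}) : Prop :=
  exists n, derived_series U n = 0%VS.
Definition is_nilpotent (U : {vspace g}) : Prop :=
  exists n, lower_central_series U n = 0%VS.

Definition semisimple : Prop :=
  forall U, is_ideal U -> is_solvable U -> U = 0%VS.

Definition is_cartan (U : {vspace g}) : Prop :=
  [/\ is_subalg U, is_nilpotent U &
      forall x, (forall y, y \in U -> lie x y \in U) -> x \in U].

Definition generated_by (I : Type) (e : I -> g) (U : {vspace g}) : Prop :=
  [/\ is_subalg U, forall i, e i \in U &
      forall V, is_subalg V -> (forall i, e i \in V) -> (U <= V)%VS].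

(* [td_ei], [td_hi], [td_fi] are the Chevalley generators; [td_alpha i], the i-th simple root, is determined by the other fields. *)
Record triangular_decomposition := TriangularDecomposition {
  td_rank : nat;
  td_nm : {vspace g};
  td_h : {vspace g};
  td_np : {vspace g};
  td_ei : 'I_td_rank -> g;
  td_hi : 'I_td_rank -> g;
  td_fi : 'I_td_rank -> g;
  td_alpha : 'I_td_rank -> 'Hom(subvs_of td_h, k^o);
  td_direct : directv (td_nm + td_h + td_np);
  td_full : (td_nm + td_h + td_np)%VS = fullv;
  td_cartan : is_cartan td_h;
  td_np_gen : generated_by td_ei td_np;
  td_nm_gen : generated_by td_fi td_nm;
  td_hi_basis : basis_of td_h [seq td_hi i | i : 'I_td_rank];
  td_ef : forall i j, lie (td_ei i) (td_fi j) = if i == j then td_hi i else 0;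
  td_he : forall (x : subvs_of td_h) i,
    lie (vsval x) (td_ei i) = (td_alpha i x : k) *: td_ei i;
  td_hf : forall (x : subvs_of td_h) i,
    lie (vsval x) (td_fi i) = - (td_alpha i x : k) *: td_fi i;
  td_alpha_hi : forall i, td_alpha i (vsproj td_h (td_hi i)) = 2%:R
}.
End FiniteDimensional.

Arguments td_ei {k g} t i.
Arguments td_hi {k g} t i.
Arguments td_fi {k g} t i.
Arguments td_alpha {k g} t i.

Section Weights.
Variables (k : fieldType) (g : finLieAlgType k) (td : triangular_decomposition g).

Definition weight : Type := 'Hom(subvs_of (td_h td), k^o).
HB.instance Definition _ := GRing.Lmodule.on weight.

(* The value of a weight at an element of [g] that lies in [h]. *)
Definition wt_at (lam : weight) (x : g) : k :=
  (lam : 'Hom(subvs_of (td_h td), k^o)) (vsproj (td_h td) x).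

Definition dominant_integral (lam : weight) : Prop :=
  forall i, exists n : nat, wt_at lam (td_hi td i) = n%:R.

Definition has_highest_weight (V : lieMod g) (lam : weight) : Prop :=
  exists v : V, [/\ v <> 0,
    forall x, x \in td_np td -> lm_act x v = 0 &
    forall x, x \in td_h td -> lm_act x v = wt_at lam x *: v].

Variables (Gam : finGroupType) (ag : lieAction Gam g).

(* The representation [rho o c^-1]. *)
Definition lm_twist (c : Gam) (V : lieMod g) : lieMod g :=
  lm_pull (la_linear ag c^-1%g) (la_lie ag c^-1%g) V.

(* The graph of the action of [Gam] on dominant integral weights: [mu = c . lam].
   Irreducible modules are determined by their highest weights, so [mu] does not
   depend on [V]. *)
Definition wt_act (c : Gam) (lam mu : weight) : Prop :=
  exists V : lieMod g, [/\ irreducible V, has_highest_weight V lam &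
                           has_highest_weight (lm_twist c V) mu].
End Weights.

Section LocalWeyl.
Variables (k : fieldType) (A : comAlgType k) (g : finLieAlgType k).
Variable td : triangular_decomposition g.

Local Open Scope classical_set_scope.

Definition Supp (psi : Xrat A -> weight td) : set (Xrat A) :=
  [set x | psi x != 0].

Definition in_E (psi : Xrat A -> weight td) : Prop :=
  finite_set (Supp psi) /\ forall x, dominant_integral (psi x).

Definition wt (psi : Xrat A -> weight td) : weight td :=
  \sum_(x \in Supp psi) psi x.

Definition restr_to (S : set (Xrat A)) (psi : Xrat A -> weight td) :
    Xrat A -> weight td :=
  fun x => if x \in S then psi x else 0.

(* [U (x) A] as a subspace of [g (x) A]. *)
Definition sub_map (U : {vspace g}) : set (mapAlg g A) :=
  [set alpha | exists s : seq (g * A), all (fun p => p.1 \in U) s /\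
                 alpha = \sum_(p <- s) mtens p.1 p.2].

Let w : pexpr k unit (mapAlg g A) := PGen tt.

Inductive weyl_rel (psi : Xrat A -> weight td) :
    pexpr k unit (mapAlg g A) -> pexpr k unit (mapAlg g A) -> Prop :=
| weyl_np alpha : sub_map (td_np td) alpha -> weyl_rel psi (POp alpha w) PZero
| weyl_f i n : wt_at (wt psi) (td_hi td i) = n%:R ->
    weyl_rel psi (iter n.+1 (POp (mtens (td_fi td i) 1)) w) PZero
| weyl_h alpha : sub_map (td_h td) alpha ->
    weyl_rel psi (POp alpha w)
      (PScale (\sum_(x \in Supp psi) wt_at (psi x) (map_eval x alpha)) w).

Definition local_weyl (psi : Xrat A -> weight td) : lieMod (mapAlg g A) :=
  lm_presented (weyl_rel psi).

Variables (Gam : finGroupType) (ag : lieAction Gam g) (aA : algAction Gam A).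

Definition in_E_equiv (psi : Xrat A -> weight td) : Prop :=
  in_E psi /\ forall c x, wt_act ag c (psi x) (psi (pt_act aA c x)).

(* [S] meets each orbit of [Gam] in [Supp psi] exactly once. *)
Definition supp_transversal (psi : Xrat A -> weight td) (S : set (Xrat A)) :
    Prop :=
  S `<=` Supp psi /\
  forall x, Supp psi x -> exists! y, S y /\ exists c, y = pt_act aA c x.

(* The restriction of [W(psi_S)] to the fixed points of [Gam] in [g (x) A]. *)
Definition twisted_weyl (psi : Xrat A -> weight td) (S : set (Xrat A)) :
    lieMod (fixedAlg (diag_action ag aA)) :=
  lm_restrict (diag_action ag aA) (local_weyl (restr_to S psi)).
End LocalWeyl.

(* Main.v *)
(** Untwisted case. If [a] in [A] vanishes on the support of [phi], then
    [g (x) a^N A] kills [W(phi)] for large [N].  So for a suitable [c] in [A],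
    equal to 1 to high order on the support of [phi] and to 0 to high order on
    that of [phi'], [W(phi + phi')] carries two commuting actions of [g (x) A],
    in which [x (x) a] acts by [x (x) ca] and by [x (x) (1 - c)a].
    The cyclic vector is a Weyl vector for [phi] under the first and for [phi']
    under the second, which provides the inverse of the canonical map
    [W(phi + phi') -> W(phi) (x) W(phi')].

    Independence of the transversal. By the tensor decomposition it is enough
    to compare [W(lam at x)], twisted by [c], with [W(c lam at c x)].  Let [V] be
    the irreducible quotient [V(lam)] of [W = W(lam at x)].  The eigenspace [E]
    of the Casimir operator of [g] on [W] for its value at [lam] maps
    isomorphically onto [V]; the vector of [E] above the highest weight vector
    of the twist of [V] is a Weyl vector for the twisted module, because a weight
    strictly above [c lam] would give a Casimir eigenvalue strictly larger than
    the value at [lam], the largest one on [W].  This yields surjections in both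
    directions, whose composite is a scalar since the top weight space is a
    line. *)

Require Import Defs.
From HB Require Import structures.
From mathcomp Require Import all_boot all_order all_fingroup all_algebra.
From mathcomp Require Import boolp classical_sets functions cardinality fsbigop.
From mathcomp Require Import finmap ring.

Set Implicit Arguments.
Unset Strict Implicit.
Unset Printing Implicit Defensive.

Import GRing.Theory.
Local Open Scope ring_scope.
Local Open Scope classical_set_scope.

(** * Bilinear operations and subspaces *)

(** The group acts on [g] by arbitrary automorphisms, which need not preserve [td_h] or [td_np].
    Twisting a local Weyl module therefore does not carry its cyclic vector to a Weyl vector, and
    the weight [c . lam] is known only through an irreducible module. This is why another vector of
    the same module has to be located. The Casimir operator can do this because it is built from the
    Killing form alone and so is invariant under every automorphism. Semisimplicity is given as the
    vanishing of solvable ideals. The Killing form is shown to be nondegenerate through the grading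
    of [g] by an element of [h] on which every simple root is 1. Weyl modules may a priori be
    infinite-dimensional, so the arguments rest on local nilpotency and on weights below the highest
    one. As [k] has no order, inequalities between Casimir eigenvalues say that a difference is a
    positive rational. A transversal for [psi \+ psi'] need not be the union of the two given ones,
    so even the tensor formula requires independence of the transversal. *)

Section LinearMaps.
Variables (k : fieldType).

Section Lin.
Variables (U V : lmodType k) (F : U -> V).
Hypothesis lF : linear F.
Lemma linD u v : F (u + v) = F u + F v.
Proof. by have := lF 1 u v; rewrite !scale1r. Qed.
Lemma lin0 : F 0 = 0.
Proof. by apply: (addIr (F 0)); rewrite -linD !add0r. Qed.
Lemma linZ a u : F (a *: u) = a *: F u.
Proof. by have := lF a u 0; rewrite lin0 !addr0. Qed.
Lemma linN u : F (- u) = - F u.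
Proof. by rewrite -scaleN1r linZ scaleN1r. Qed.
Lemma linB u v : F (u - v) = F u - F v.
Proof. by rewrite linD linN. Qed.
Lemma lin_sum (J : Type) (r : seq J) (P : pred J) (f : J -> U) :
  F (\sum_(j <- r | P j) f j) = \sum_(j <- r | P j) F (f j).
Proof. by elim/big_rec2: _ => [|j y1 y2 _ <-]; rewrite ?lin0 ?linD. Qed.
End Lin.

Lemma comp_linear (U V W : lmodType k) (F : U -> V) (G : V -> W) :
  linear F -> linear G -> linear (G \o F).
Proof. by move=> lF lG a u v /=; rewrite lF lG. Qed.

Section Bilin.
Variables (U V W : lmodType k) (B : U -> V -> W).
Hypothesis bB : bilin B.
Lemma bilDl u u' v : B (u + u') v = B u v + B u' v.
Proof. exact: (linD (bB.1 v)). Qed.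
Lemma bilDr u v v' : B u (v + v') = B u v + B u v'.
Proof. exact: (linD (bB.2 u)). Qed.
Lemma bil0l v : B 0 v = 0. Proof. exact: (lin0 (bB.1 v)). Qed.
Lemma bil0r u : B u 0 = 0. Proof. exact: (lin0 (bB.2 u)). Qed.
Lemma bilZl a u v : B (a *: u) v = a *: B u v.
Proof. exact: (linZ (bB.1 v)). Qed.
Lemma bilZr a u v : B u (a *: v) = a *: B u v.
Proof. exact: (linZ (bB.2 u)). Qed.
Lemma bilNl u v : B (- u) v = - B u v. Proof. exact: (linN (bB.1 v)). Qed.
Lemma bilNr u v : B u (- v) = - B u v. Proof. exact: (linN (bB.2 u)). Qed.
Lemma bil_suml (J : Type) (r : seq J) (P : pred J) (f : J -> U) v :
  B (\sum_(j <- r | P j) f j) v = \sum_(j <- r | P j) B (f j) v.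
Proof. exact: (lin_sum (bB.1 v)). Qed.
Lemma bil_sumr (J : Type) (r : seq J) (P : pred J) (f : J -> V) u :
  B u (\sum_(j <- r | P j) f j) = \sum_(j <- r | P j) B u (f j).
Proof. exact: (lin_sum (bB.2 u)). Qed.
End Bilin.
End LinearMaps.

Section LieBasics.
Variables (k : fieldType) (L : lieAlgType k).
Implicit Types x y z : L.
Let bl := @lie_bilin k L.

Lemma lieDl x y z : lie (x + y) z = lie x z + lie y z. Proof. exact: bilDl bl _ _ _. Qed.
Lemma lieDr x y z : lie x (y + z) = lie x y + lie x z. Proof. exact: bilDr bl _ _ _. Qed.
Lemma lie0l x : lie 0 x = 0. Proof. exact: bil0l bl _. Qed.
Lemma lie0r x : lie x 0 = 0. Proof. exact: bil0r bl _. Qed.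
Lemma lieZl a x y : lie (a *: x) y = a *: lie x y. Proof. exact: bilZl bl _ _ _. Qed.
Lemma lieZr a x y : lie x (a *: y) = a *: lie x y. Proof. exact: bilZr bl _ _ _. Qed.
Lemma lieNl x y : lie (- x) y = - lie x y. Proof. exact: bilNl bl _ _. Qed.
Lemma lieNr x y : lie x (- y) = - lie x y. Proof. exact: bilNr bl _ _. Qed.
Lemma lie_suml (J : Type) (r : seq J) (P : pred J) (f : J -> L) y :
  lie (\sum_(j <- r | P j) f j) y = \sum_(j <- r | P j) lie (f j) y.
Proof. by rewrite (bil_suml bl). Qed.
Lemma lie_sumr (J : Type) (r : seq J) (P : pred J) (f : J -> L) y :
  lie y (\sum_(j <- r | P j) f j) = \sum_(j <- r | P j) lie y (f j).
Proof. by rewrite (bil_sumr bl). Qed.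

Lemma lieC x y : lie x y = - lie y x.
Proof.
apply/eqP; rewrite -addr_eq0; apply/eqP.
by have := liexx (x + y); rewrite lieDl !lieDr !liexx add0r addr0.
Qed.

Lemma lie_leib x y z : lie x (lie y z) = lie (lie x y) z + lie y (lie x z).
Proof.
have := lie_jacobi x y z => /eqP; rewrite -addrA addr_eq0 => /eqP ->.
by rewrite (lieC z x) lieNr (lieC z (lie x y)) opprD !opprK addrC.
Qed.

Lemma lie_act2 x y z : lie (lie x y) z = lie x (lie y z) - lie y (lie x z).
Proof. by rewrite lie_leib addrK. Qed.

Definition lm_adj : lieMod L := LieMod (@lie_bilin k L) lie_act2.
End LieBasics.

Section ActBasics.
Variables (k : fieldType) (L : lieAlgType k) (M : lieMod L).
Implicit Types (x y : L) (u v : M).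
Let bm := lm_bilin M.

Lemma actDl x y u : lm_act (x + y) u = lm_act x u + lm_act y u.
Proof. exact: bilDl bm _ _ _. Qed.
Lemma actDr x u v : lm_act x (u + v) = lm_act x u + lm_act x v.
Proof. exact: bilDr bm _ _ _. Qed.
Lemma act0l u : lm_act (0 : L) u = 0. Proof. exact: bil0l bm _. Qed.
Lemma act0r x : lm_act x (0 : M) = 0. Proof. exact: bil0r bm _. Qed.
Lemma actZl a x u : lm_act (a *: x) u = a *: lm_act x u.
Proof. exact: bilZl bm _ _ _. Qed.
Lemma actZr a x u : lm_act x (a *: u) = a *: lm_act x u.
Proof. exact: bilZr bm _ _ _. Qed.
Lemma actNl x u : lm_act (- x) u = - lm_act x u. Proof. exact: bilNl bm _ _. Qed.
Lemma act_suml (J : Type) (r : seq J) (P : pred J) (f : J -> L) u :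
  lm_act (\sum_(j <- r | P j) f j) u = \sum_(j <- r | P j) lm_act (f j) u.
Proof. by rewrite (bil_suml bm). Qed.
Lemma act_sumr (J : Type) (r : seq J) (P : pred J) (f : J -> M) x :
  lm_act x (\sum_(j <- r | P j) f j) = \sum_(j <- r | P j) lm_act x (f j).
Proof. by rewrite (bil_sumr bm). Qed.
Lemma act_swap x y u :
  lm_act x (lm_act y u) = lm_act (lie x y) u + lm_act y (lm_act x u).
Proof. by rewrite lm_lie addrNK. Qed.
End ActBasics.

Definition subsp (k : fieldType) (U : lmodType k) (S : U -> Prop) : Prop :=
  S 0 /\ forall (a : k) u v, S u -> S v -> S (a *: u + v).

Section Subsp.
Variables (k : fieldType) (U : lmodType k) (S : U -> Prop).
Hypothesis sS : subsp S.
Lemma subspD u v : S u -> S v -> S (u + v).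
Proof. by move=> hu hv; have := sS.2 1 u v hu hv; rewrite scale1r. Qed.
Lemma subspZ a u : S u -> S (a *: u).
Proof. by move=> hu; have := sS.2 a u 0 hu sS.1; rewrite addr0. Qed.
Lemma subspN u : S u -> S (- u).
Proof. by move=> hu; rewrite -scaleN1r; apply: subspZ. Qed.
Lemma subspB u v : S u -> S v -> S (u - v).
Proof. by move=> hu hv; apply: subspD => //; apply: subspN. Qed.
Lemma subsp_sum (J : Type) (r : seq J) (P : pred J) (f : J -> U) :
  (forall j, P j -> S (f j)) -> S (\sum_(j <- r | P j) f j).
Proof. by move=> h; elim/big_ind: _ => //; [exact: sS.1|exact: subspD]. Qed.
Lemma subsp_sum_in (J : eqType) (r : seq J) (f : J -> U) :
  (forall j, j \in r -> S (f j)) -> S (\sum_(j <- r) f j).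
Proof. by move=> h; rewrite big_seq; apply: subsp_sum. Qed.
End Subsp.

(** Extend a free family in [S] as long as some vector of [S] lies outside its span; a free family
    larger than the dimension is impossible, so the process stops. *)
Lemma free_in_subsp (k : fieldType) (V : vectType k) (S : V -> Prop) :
  exists X : seq V, [/\ free X, (forall x, x \in X -> S x) &
    forall x, S x -> x \in <<X>>%VS].
Proof.
have H : forall n, (exists X : seq V, [/\ free X, (forall x, x \in X -> S x) &
    forall x, S x -> x \in <<X>>%VS]) \/
   (exists X : seq V, [/\ free X, (forall x, x \in X -> S x) & size X = n]).
  elim=> [|n [h|[X [fX sX szX]]]].
  - by right; exists [::]; split=> //; rewrite nil_free.
  - by left.
  case: (pselect (forall x, S x -> x \in <<X>>%VS)) => [h|].
    by left; exists X.
  move/existsNP=> [x /not_implyP [Sx /negP xX]]; right; exists (x :: X); split.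
  - by rewrite free_cons xX.
  - by move=> y; rewrite inE => /orP [/eqP ->|/sX].
  - by rewrite /= szX.
case: (H (\dim (fullv : {vspace V})).+1) => [//|[X [fX _ szX]]].
move: fX; rewrite /free => /eqP dX.
by have := dimvS (subvf <<X>>%VS); rewrite dX szX ltnn.
Qed.

Lemma subsp_span (k : fieldType) (V : vectType k) (S : V -> Prop) (X : seq V) :
  subsp S -> (forall x, x \in X -> S x) -> forall x, x \in <<X>>%VS -> S x.
Proof.
move=> sS sX x xX; rewrite (@coord_span _ _ _ (in_tuple X) x xX).
apply: subsp_sum => // i _; apply: subspZ => //; apply: sX.
exact: mem_nth.
Qed.

Lemma subsp_vspace (k : fieldType) (V : vectType k) (S : V -> Prop) :
  subsp S -> exists U : {vspace V}, forall x, x \in U <-> S x.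
Proof.
move=> sS; have [X [fX sX XS]] := free_in_subsp S.
by exists <<X>>%VS => x; split; [apply: subsp_span|apply: XS].
Qed.

(** * Representations of sl2 and triangular decompositions *)

Lemma natr_neq0 (K : fieldType) (K0 : [pchar K] =i pred0) n :
  (n%:R == 0 :> K) = (n == 0)%N.
Proof. by have /pcharf0P -> := K0. Qed.

Lemma natr_inj0 (K : fieldType) (K0 : [pchar K] =i pred0) m n :
  m%:R = n%:R :> K -> m = n.
Proof.
wlog le_mn : m n / (m <= n)%N.
  by case/orP: (leq_total m n) => h H e; [|symmetry]; apply: H.
move/eqP; rewrite eq_sym -subr_eq0 -natrB // natr_neq0 // subn_eq0 => h.
by apply/eqP; rewrite eqn_leq le_mn.
Qed.

Section SL2.
Variables (k : fieldType) (char0 : [pchar k] =i pred0).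
Variables (L : lieAlgType k) (M : lieMod L) (E F H : L) (v : M) (c : k).
Hypotheses (EF : lie E F = H) (HF : lie H F = - 2%:R *: F).
Hypotheses (Ev : lm_act E v = 0) (Hv : lm_act H v = c *: v).

Lemma sl2_H j : lm_act H (iter j (lm_act F) v) =
  (c - (2 * j)%:R) *: iter j (lm_act F) v.
Proof.
elim: j => [|j IH]; first by rewrite muln0 subr0.
rewrite iterS act_swap HF IH actZl actZr -scalerDl; congr (_ *: _).
by ring.
Qed.

Lemma sl2_E j : lm_act E (iter j.+1 (lm_act F) v) =
  (j.+1%:R * (c - j%:R)) *: iter j (lm_act F) v.
Proof.
elim: j => [|j IH].
  by rewrite /= act_swap Ev act0r addr0 EF Hv mul1r subr0.
rewrite iterS act_swap EF IH actZr sl2_H -iterS -scalerDl; congr (_ *: _).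
by ring.
Qed.

(** At the last nonzero vector [F^N v], applying [E] to [F^(N+1) v = 0] gives (N+1)(c - N) = 0, so c
    = N in characteristic zero. *)
Lemma sl2_dominant N : v <> 0 -> iter N (lm_act F) v = 0 ->
  exists n, c = n%:R /\ iter n.+1 (lm_act F) v = 0.
Proof.
move=> v0; elim: N => [//|N IH] FN.
case: (eqVneq (iter N (lm_act F) v) 0) => [/IH //|FN0].
exists N; split=> //; have := sl2_E N; rewrite FN act0r => /esym/eqP.
rewrite scaler_eq0 (negPf FN0) orbF mulf_eq0 natr_neq0 //= subr_eq0.
by move/eqP.
Qed.
End SL2.

(** * Local nilpotency of a family of operators *)

Section WordNilpotent.
Variables (k : fieldType) (L : lieAlgType k) (J : Type) (F : J -> L).

(** Words are used rather than powers of the single [F j]: a nonzero vector then has a last nonzero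
    descendant, killed by all [F j] at once ([locnil_last]). *)
Fixpoint wordnil (M : lieMod L) (n : nat) (m : M) : Prop :=
  if n is n'.+1 then forall j, wordnil n' (lm_act (F j) m) else m = 0.

Lemma wordnil0 (M : lieMod L) n : wordnil n (0 : M).
Proof. by elim: n => [//|n IH] j; rewrite act0r. Qed.

Lemma wordnilD (M : lieMod L) n a (m m' : M) :
  wordnil n m -> wordnil n m' -> wordnil n (a *: m + m').
Proof.
elim: n m m' => [|n IH] m m' /=; first by move=> -> ->; rewrite scaler0 addr0.
by move=> hm hm' j; rewrite actDr actZr; apply: IH.
Qed.

Lemma wordnilW (M : lieMod L) n p (m : M) : wordnil n m -> wordnil (n + p) m.
Proof.
elim: n m => [|n IH] m /= => [->|h j]; first exact: wordnil0.
exact: IH.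
Qed.

(** By the Leibniz rule a word of length [a + b] distributes its letters over [x] and [m], and
    either [x] receives at least [a] of them or [m] at least [b]. *)
Lemma wordnil_act (M : lieMod L) a b x (m : M) :
  wordnil (M := lm_adj L) a x -> wordnil b m -> wordnil (a + b) (lm_act x m).
Proof.
have [n] := ubnP (a + b); elim: n a b x m => [//|n IH] [|a] [|b] x m.
- by move=> _ -> ->; rewrite act0r.
- by move=> _ -> _; rewrite act0l; apply: wordnil0.
- by move=> _ _ ->; rewrite act0r; apply: wordnil0.
rewrite addSn ltnS => lt hx hm j; rewrite act_swap -[X in X + _]scale1r.
apply: wordnilD; first by apply: IH (hx j) hm.
by rewrite plusE -addSnnS; apply: IH (hm j); rewrite ?addSnnS.
Qed.

Definition locnil (M : lieMod L) (m : M) : Prop := exists n, wordnil n m.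

Lemma locnil_subsp (M : lieMod L) : subsp (@locnil M).
Proof.
split; first by exists 0.
move=> a u v [n hn] [p hp]; exists (n + p)%N; apply: wordnilD.
  exact: wordnilW.
by rewrite addnC; apply: wordnilW.
Qed.

Lemma locnil_act (M : lieMod L) x (m : M) :
  locnil (M := lm_adj L) x -> locnil m -> locnil (lm_act x m).
Proof. by move=> [a ha] [b hb]; exists (a + b)%N; apply: wordnil_act. Qed.

Lemma locnil_last (M : lieMod L) (S : M -> Prop) (m : M) :
  locnil m -> S m -> m <> 0 -> (forall j u, S u -> S (lm_act (F j) u)) ->
  exists u, [/\ S u, u <> 0 & forall j, lm_act (F j) u = 0].
Proof.
move=> [n]; elim: n m => [//|n IH] m /= hm Sm m0 SF.
have [h|/existsNP [j h]] := pselect (forall j, lm_act (F j) m = 0).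
  by exists m.
by apply: (IH (lm_act (F j) m)) => //; apply: SF.
Qed.
End WordNilpotent.

Lemma wordnil_iter (k : fieldType) (L : lieAlgType k) (M : lieMod L) (F : L)
    n (m : M) :
  wordnil (fun _ : unit => F) n m <-> iter n (lm_act F) m = 0.
Proof.
elim: n m => [//|n IH] m; rewrite iterSr -IH /=.
by split=> [/(_ tt)|h []].
Qed.

(** * Generators, simple roots and the grading element *)

Section TriangularAlgebra.
Variables (k : fieldType) (char0 : [pchar k] =i pred0).
Variables (g : finLieAlgType k) (g_ss : semisimple g).
Variable td : triangular_decomposition g.

Local Notation e := (td_ei td).
Local Notation f := (td_fi td).
Local Notation hh := (td_hi td).
Local Notation h := (td_h td).
Local Notation I := 'I_(td_rank td).

(** [generated_by] quantifies over [{vspace g}]; as [g] is finite-dimensional, every linear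
    predicate comes from such a subspace, so minimality becomes an induction principle. *)
Lemma subalg_ind (S : g -> Prop) (J : Type) (x : J -> g) (U : {vspace g}) :
  generated_by x U -> subsp S ->
  (forall a b, S a -> S b -> S (lie a b)) -> (forall j, S (x j)) ->
  forall a, a \in U -> S a.
Proof.
move=> [_ _ minU] sS lS xS a aU; have [V VS] := subsp_vspace sS.
apply/VS; apply: (subvP (minU V _ _)) aU => [b c /VS hb /VS hc|j].
  by apply/VS/lS.
exact/VS.
Qed.

Lemma hh_in i : hh i \in h.
Proof.
have := td_hi_basis td => /basis_mem; apply.
by apply/mapP; exists i; rewrite ?mem_enum.
Qed.

Lemma h_ind (S : g -> Prop) : subsp S -> (forall i, S (hh i)) ->
  forall y, y \in h -> S y.
Proof.
move=> sS hS y; rewrite -(span_basis (td_hi_basis td)).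
by apply: subsp_span => // x /mapP [i _ ->].
Qed.

Lemma tri_split x : exists a b c,
  [/\ x = a + b + c, a \in td_nm td, b \in h & c \in td_np td].
Proof.
have : x \in (td_nm td + h + td_np td)%VS by rewrite td_full memvf.
case/memv_addP => y /memv_addP [a an [b bh ->]] [c cp ->].
by exists a, b, c.
Qed.

Lemma g_ind (S : g -> Prop) : subsp S ->
  (forall a b, S a -> S b -> S (lie a b)) -> (forall i, S (e i)) ->
  (forall i, S (f i)) -> forall x, S x.
Proof.
move=> sS lS eS fS x; have [a [b [c [-> an bh cp]]]] := tri_split x.
do 2?[apply: (subspD sS)].
- exact: (subalg_ind (td_nm_gen td) sS lS fS).
- apply: (h_ind sS _ bh) => i; have := td_ef i i; rewrite eqxx => <-.
  exact: lS.
- exact: (subalg_ind (td_np_gen td) sS lS eS).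
Qed.

Lemma wt_at_linear (lam : weight td) : linear (wt_at lam : g -> k^o).
Proof. by move=> a x y; rewrite /wt_at !linearP. Qed.
Lemma wt_atDr (lam : weight td) x y : wt_at lam (x + y) = wt_at lam x + wt_at lam y.
Proof. exact: (linD (wt_at_linear lam)). Qed.
Lemma wt_atZr (lam : weight td) a x : wt_at lam (a *: x) = a * wt_at lam x.
Proof. exact: (linZ (wt_at_linear lam)). Qed.
Lemma wt_at0r (lam : weight td) : wt_at lam 0 = 0.
Proof. exact: (lin0 (wt_at_linear lam)). Qed.
Lemma wt_at_sumr (lam : weight td) J (r : seq J) (P : pred J) (F : J -> g) :
  wt_at lam (\sum_(j <- r | P j) F j) = \sum_(j <- r | P j) wt_at lam (F j).
Proof. exact: (lin_sum (wt_at_linear lam)). Qed.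
Lemma wt_atDl (l m : weight td) x : wt_at (l + m) x = wt_at l x + wt_at m x.
Proof. by rewrite /wt_at add_lfunE. Qed.
Lemma wt_at0l x : wt_at (0 : weight td) x = 0.
Proof. by rewrite /wt_at zero_lfunE. Qed.
Lemma wt_atNl (m : weight td) x : wt_at (- m) x = - wt_at m x.
Proof. by rewrite /wt_at opp_lfunE. Qed.
Lemma wt_atBl (l m : weight td) x : wt_at (l - m) x = wt_at l x - wt_at m x.
Proof. by rewrite wt_atDl wt_atNl. Qed.
Lemma wt_at_suml J (r : seq J) (P : pred J) (F : J -> weight td) x :
  wt_at (\sum_(j <- r | P j) F j) x = \sum_(j <- r | P j) wt_at (F j) x.
Proof.
by elim/big_rec2: _ => [|j y1 y2 _ <-]; rewrite ?wt_at0l ?wt_atDl.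
Qed.
Lemma wt_atMn (l : weight td) n x : wt_at (l *+ n) x = n%:R * wt_at l x.
Proof.
elim: n => [|n IH]; first by rewrite mulr0n wt_at0l mul0r.
by rewrite mulrS wt_atDl IH -add1n natrD mulrDl mul1r.
Qed.

Definition al (i : I) : weight td := td_alpha td i.

Lemma wt_ext (l m : weight td) : (forall i, wt_at l (hh i) = wt_at m (hh i)) -> l = m.
Proof.
move=> E; apply/lfunP => x.
have H : forall y, y \in h -> wt_at l y = wt_at m y.
  apply: (h_ind (S := fun y => wt_at l y = wt_at m y)) => //; split=> [|a u v hu hv]; first by rewrite !wt_at0r.
  by rewrite !wt_atDr !wt_atZr hu hv.
by have := H (vsval x) (subvsP x); rewrite /wt_at vsvalK.
Qed.

Lemma lie_he y i : y \in h -> lie y (e i) = wt_at (al i) y *: e i.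
Proof. by move=> yh; have := td_he (vsproj h y) i; rewrite vsprojK. Qed.
Lemma lie_hf y i : y \in h -> lie y (f i) = - wt_at (al i) y *: f i.
Proof. by move=> yh; have := td_hf (vsproj h y) i; rewrite vsprojK. Qed.
Lemma al_hh i : wt_at (al i) (hh i) = 2%:R.
Proof. exact: td_alpha_hi. Qed.
Lemma lie_hhe i : lie (hh i) (e i) = 2%:R *: e i.
Proof. by rewrite lie_he ?hh_in // al_hh. Qed.
Lemma lie_hhf i : lie (hh i) (f i) = - 2%:R *: f i.
Proof. by rewrite lie_hf ?hh_in // al_hh. Qed.
Lemma lie_ef i : lie (e i) (f i) = hh i.
Proof. by rewrite td_ef eqxx. Qed.

Lemma hh_neq0 i : hh i <> 0.
Proof.
have /andP [_ /free_not0 h0] := td_hi_basis td.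
suff /h0 /eqP : hh i \in [seq hh j | j : I] by [].
by apply/mapP; exists i; rewrite ?mem_enum.
Qed.
Lemma e_neq0 i : e i <> 0.
Proof. by move=> e0; apply: (@hh_neq0 i); rewrite -lie_ef e0 lie0l. Qed.

Lemma h_abelian x y : x \in h -> y \in h -> lie x y = 0.
Proof.
move=> xh; apply: (h_ind (S := fun y => lie x y = 0)).
  by split=> [|a u v hu hv]; rewrite ?lie0r // lieDr lieZr hu hv scaler0 addr0.
move=> i; rewrite -lie_ef lie_leib (lie_he i xh) (lie_hf i xh) lieZl lieZr.
by rewrite scaleNr addrN.
Qed.

(** A central element spans an abelian, hence solvable, ideal. *)
Lemma center0 (y : g) : (forall x, lie y x = 0) -> y = 0.
Proof.
move=> cy; have yU : y \in <[y]>%VS by rewrite memv_line.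
suff U0 : <[y]>%VS = 0%VS by move: yU; rewrite U0 memv0 => /eqP.
apply: g_ss => [x z /vlineP [a ->]|].
  by rewrite lieZr lieC cy oppr0 scaler0 mem0v.
exists 1%N; apply/eqP; rewrite -subv0 /= /lieprod; apply/span_subvP => z.
case/allpairsP => -[u v] [/= /vbasis_mem /vlineP [a ->] _ ->].
by rewrite lieZl cy scaler0 mem0v.
Qed.

Lemma al_inj (y : g) : y \in h -> (forall i, wt_at (al i) y = 0) -> y = 0.
Proof.
move=> yh al0; apply: center0; apply: (g_ind (S := fun x => lie y x = 0)).
- by split=> [|a u v hu hv]; rewrite ?lie0r // lieDr lieZr hu hv scaler0 addr0.
- by move=> a b ha hb; rewrite lie_leib ha hb lie0l lie0r addr0.
- by move=> i; rewrite lie_he // al0 scale0r.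
- by move=> i; rewrite lie_hf // al0 oppr0 scale0r.
Qed.

(** This element is half the sum of the positive coroots. The matrix of the [al j (hh i)] is
    invertible because an element of [h] killed by all simple roots is central ([al_inj]). The
    adjoint action of this element grades [g] by height. *)
Lemma rho_exists : exists2 y, y \in h & forall i, wt_at (al i) y = 1.
Proof.
pose A := \matrix_(i, j) wt_at (al j) (hh i) : 'M[k]_(td_rank td).
have fA : row_free A.
  apply/row_freeP; apply/row_freeP/inj_row_free => u uA.
  pose y := \sum_i u 0 i *: hh i.
  have yh : y \in h.
    by rewrite /y memv_suml // => i _; rewrite memvZ ?hh_in.
  have y0 : y = 0.
    apply: al_inj => // j; have := congr1 (fun B : 'rV_(td_rank td) => B 0 j) uA; rewrite !mxE => <-.
    by rewrite wt_at_sumr; apply: eq_bigr => i _; rewrite wt_atZr !mxE.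
  have /andP [_ fr] := td_hi_basis td.
  pose X := [tuple hh i | i < td_rank td].
  have fX : free X.
    by move: fr; congr free; rewrite /X /= enumT.
  apply/rowP => i; rewrite mxE; have /freeP := fX; apply.
  rewrite -[RHS]y0 /y; apply: eq_bigr => j _; congr (_ *: _).
  by rewrite -tnth_nth tnth_mktuple.
have uA : A \in unitmx by rewrite -row_free_unit.
pose u := const_mx 1 *m invmx A : 'rV_(td_rank td).
exists (\sum_i u 0 i *: hh i).
  by rewrite memv_suml // => i _; rewrite memvZ ?hh_in.
move=> j; have : (u *m A) 0 j = 1 by rewrite mulmxKV // mxE.
rewrite mxE => <-; rewrite wt_at_sumr; apply: eq_bigr => i _.
by rewrite wt_atZr !mxE.
Qed.
End TriangularAlgebra.

(** * Weights and the Killing form *)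

Section Trace.
Variables (k : closedFieldType) (V : vectType k).

Lemma lin_hom (U W : vectType k) (F : U -> W) :
  linear F -> exists phi : 'Hom(U, W), forall x, phi x = F x.
Proof.
move=> lF.
pose G : {linear U -> W} := HB.pack F (GRing.isLinear.Build k U W *:%R F lF).
by exists (linfun G) => x; rewrite lfunE.
Qed.

Lemma eigen_finite (F : V -> V) : linear F ->
  exists s : seq k, forall a x, F x = a *: x -> x <> 0 -> a \in s.
Proof.
move=> /lin_hom [phi phiE]; pose X := vbasis (fullv : {vspace V}).
have bX : basis_of fullv X by exact: vbasisP.
pose A := passmx.mxof X X phi.
have [s sE] := closed_field_poly_normal (char_poly A).
exists s => a x Fx x0; have : root (char_poly A) a.
  rewrite -eigenvalue_root_char; apply/eigenvalueP; exists (passmx.rVof X x).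
    by rewrite -passmx.rVof_app // phiE Fx (linZ (@passmx.rVof_linear _ _ X)).
  by rewrite passmx.rVof_eq0 //; apply/eqP.
rewrite sE rootE hornerZ (monicP (char_poly_monic A)) mul1r horner_prod.
rewrite prodf_seq_eq0 => /hasP [b bs]; rewrite hornerXsubC subr_eq0 => /eqP ->.
exact: bs.
Qed.

Definition trace n (X : n.-tuple V) (F : V -> V) : k :=
  \sum_i coord X i (F X`_i).

Lemma trace_comm n p (X : n.-tuple V) (Y : p.-tuple V) (F G : V -> V) :
  basis_of fullv X -> basis_of fullv Y -> linear F -> linear G ->
  trace X (F \o G) = trace Y (G \o F).
Proof.
move=> bX bY lF lG; rewrite /trace /=.
under eq_bigr do rewrite (coord_basis bY (memvf (G _))) (lin_sum lF) linear_sum.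
rewrite exchange_big /=; apply: eq_bigr => j _.
rewrite [in RHS](coord_basis bX (memvf (F _))) (lin_sum lG) linear_sum.
apply: eq_bigr => i _; rewrite (linZ lF) (linZ lG) !linearZ /=.
exact: mulrC.
Qed.

Lemma trace_basis n p (X : n.-tuple V) (Y : p.-tuple V) (F : V -> V) :
  basis_of fullv X -> basis_of fullv Y -> linear F -> trace X F = trace Y F.
Proof. by move=> bX bY lF; apply: (trace_comm (G := id) bX bY lF). Qed.

Lemma traceD n (X : n.-tuple V) (F G : V -> V) a :
  trace X (fun x => a *: F x + G x) = a * trace X F + trace X G.
Proof.
rewrite /trace mulr_sumr -big_split; apply: eq_bigr => i _ /=.
by rewrite linearP.
Qed.
End Trace.

Section Weights.
Variables (k : closedFieldType) (char0 : [pchar k] =i pred0).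
Variables (g : finLieAlgType k) (g_ss : semisimple g).
Variable td : triangular_decomposition g.

Local Notation e := (td_ei td).
Local Notation f := (td_fi td).
Local Notation hh := (td_hi td).
Local Notation h := (td_h td).
Local Notation I := 'I_(td_rank td).
Local Notation al := (al (td := td)).

(** Bracketing with [F j] shifts the eigenvalues of [ad r] by [d]. These are finite in number while
    the [c + n d] are distinct, so some [c + n d] is no eigenvalue and all words of length [n] kill
    the eigenvectors for [c]. The generators are eigenvectors, and local nilpotency passes to
    brackets. *)
Lemma adj_locnil (r : g) (J : Type) (F : J -> g) (d : k) :
  (forall i, exists c, lie r (e i) = c *: e i) ->
  (forall i, exists c, lie r (f i) = c *: f i) ->
  d != 0 -> (forall j, lie r (F j) = d *: F j) ->
  forall x, locnil F (M := lm_adj g) x.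
Proof.
move=> re rf d0 rF.
have [s sP] := eigen_finite (lie_bilin.2 r).
have wn : forall n c (x : lm_adj g), lie r x = c *: x -> c + n%:R * d \notin s ->
    wordnil F n x.
  elim=> [|n IH] c x rx; first rewrite mul0r addr0 => cs.
    by apply: contrapT => x0; case/negP: cs; apply: sP rx x0.
  move=> cs j; apply: (IH (d + c)).
    by rewrite /= lie_leib rx rF lieZl lieZr scalerDl.
  by have -> : d + c + n%:R * d = c + n.+1%:R * d by ring.
have eig c x : lie r x = c *: x -> locnil F (M := lm_adj g) x.
  move=> rx; case: (boolP (all (fun n => c + n%:R * d \in s) (iota 0 (size s).+1))).
    move=> /allP hs; exfalso.
    have uq : uniq [seq c + n%:R * d | n <- iota 0 (size s).+1].
      rewrite map_inj_uniq ?iota_uniq // => m n /addrI /(mulIf d0).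
      exact: natr_inj0.
    have sub : {subset [seq c + n%:R * d | n <- iota 0 (size s).+1] <= s}.
      by move=> a /mapP [n nin ->]; apply: hs.
    by have := uniq_leq_size uq sub; rewrite size_map size_iota ltnn.
  by case/allPn => n _ cs; exists n; apply: (wn n c).
apply: (g_ind (td := td)).
- exact: locnil_subsp.
- by move=> a b; apply: locnil_act.
- by move=> i; have [c] := re i; apply: eig.
- by move=> i; have [c] := rf i; apply: eig.
Qed.

Lemma e_locnil x : locnil e (M := lm_adj g) x.
Proof.
have [r rh r1] := rho_exists g_ss td.
apply: (@adj_locnil r _ e 1); rewrite ?oner_neq0 // => i.
- by eexists; apply: lie_he.
- by eexists; apply: lie_hf.
- by rewrite lie_he // r1.
Qed.

Lemma f_locnil x : locnil f (M := lm_adj g) x.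
Proof.
have [r rh r1] := rho_exists g_ss td.
apply: (@adj_locnil r _ f (-1)); rewrite ?oppr_eq0 ?oner_neq0 // => i.
- by eexists; apply: lie_he.
- by eexists; apply: lie_hf.
- by rewrite lie_hf // r1.
Qed.

Lemma wordnil_sub (L : lieAlgType k) (M : lieMod L) (J J' : Type) (F : J -> L)
    (s : J' -> J) n (m : M) :
  wordnil F n m -> wordnil (F \o s) n m.
Proof. by elim: n m => [//|n IH] m /= hm j; apply: IH. Qed.

Lemma ei_nil i (x : g) : exists n, iter n (lie (e i)) x = 0.
Proof.
have [n hn] := e_locnil x; exists n; apply/(wordnil_iter (M := lm_adj g)).
exact: (wordnil_sub (fun _ => i) hn).
Qed.

(** For [i != j] the bracket of [f i] and [e j] is zero, so [e j] is a highest weight vector for the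
    triple [f i], [e i], [- hh i]; its weight [- al j (hh i)] is a natural number by
    [sl2_dominant]. *)
Lemma al_int i j : exists z : int, wt_at (al j) (hh i) = z%:~R.
Proof.
case: (eqVneq i j) => [<-|ij]; first by exists 2; rewrite al_hh.
have [n hn] := ei_nil i (e j).
have [||||||p [pE _]] := @sl2_dominant k char0 g (lm_adj g) (f i) (e i) (- hh i)
  (e j) (- wt_at (al j) (hh i)) _ _ _ _ n.
- by rewrite lieC lie_ef.
- by rewrite lieNl lie_hhe scaleNr.
- by rewrite /= lieC td_ef eq_sym (negPf ij) oppr0.
- by rewrite /= lieNl lie_he ?hh_in // scaleNr.
- exact: e_neq0.
- by [].
by exists (- p%:Z); rewrite mulrNz -pmulrn -pE opprK.
Qed.

(** * Weight vectors and sums of weight vectors *)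

Section WeightVectors.
Variable M : lieMod g.
Implicit Types (m u : M) (nu mu : weight td).

Definition is_wt nu m := forall y, y \in h -> lm_act y m = wt_at nu y *: m.

(** A weight decomposition is recorded as the mere existence of a finite sum. The part of direct
    sums is played by [wspan_find], which extracts a weight vector from a stable subspace. *)
Definition wspan (P : weight td -> Prop) m := exists s : seq (weight td * M),
  m = \sum_(p <- s) p.2 /\ forall p, p \in s -> P p.1 /\ is_wt p.1 p.2.

Lemma is_wt_subsp nu : subsp (is_wt nu).
Proof.
split=> [y _|a u v hu hv y yh]; first by rewrite act0r scaler0.
by rewrite actDr actZr hu // hv // scalerDr !scalerA mulrC.
Qed.

Lemma is_wt_wspan (P : weight td -> Prop) nu m : P nu -> is_wt nu m -> wspan P m.
Proof.
move=> Pn hm; exists [:: (nu, m)]; split; first by rewrite big_seq1.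
by move=> p; rewrite inE => /eqP ->.
Qed.

Lemma wspan_subsp P : subsp (wspan P).
Proof.
split; first by exists [::]; rewrite big_nil.
move=> a u v [s [-> hs]] [t [-> ht]].
exists ([seq (p.1, a *: p.2) | p <- s] ++ t); split.
  by rewrite big_cat big_map /= scaler_sumr.
move=> p; rewrite mem_cat => /orP [/mapP [q qs ->]|/ht //].
by have [Pq hq] := hs q qs; split=> //=; apply: (subspZ (is_wt_subsp _)).
Qed.

Lemma wspan_sub (P Q : weight td -> Prop) m :
  (forall nu, P nu -> Q nu) -> wspan P m -> wspan Q m.
Proof.
by move=> PQ [s [-> hs]]; exists s; split=> // p /hs [/PQ hp hw].
Qed.

(* Applying [y - nu_1(y)] to a sum of weight vectors shortens it by one term. *)
Lemma wspan_find (S : M -> Prop) (P : weight td -> Prop) m :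
  subsp S -> (forall y u, y \in h -> S u -> S (lm_act y u)) ->
  wspan P m -> S m -> m <> 0 ->
  exists nu u, [/\ P nu, is_wt nu u, S u & u <> 0].
Proof.
move=> sS hS [s [-> hs]]; elim: {s}(size s) {-2}s (leqnn (size s)) hs => [|n IH] s.
  by rewrite leqn0 size_eq0 => /eqP ->; rewrite big_nil.
case: s => [|p s]; first by rewrite big_nil.
rewrite /= ltnS => szs hs; rewrite big_cons.
set m' := _ + _ => Sm' m0.
have [wm|/existsNP [y /not_implyP [yh ny]]] := pselect (is_wt p.1 m').
  exists p.1, m'; split=> //; have [] := hs p => //.
  by rewrite inE eqxx.
pose s' := [seq (q.1, (wt_at q.1 y - wt_at p.1 y) *: q.2) | q <- s].
have E : lm_act y m' - wt_at p.1 y *: m' = \sum_(q <- s') q.2.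
  rewrite /m' actDr scalerDr (hs p _).2 ?inE ?eqxx // opprD addrACA subrr add0r.
  rewrite act_sumr scaler_sumr -sumrB big_map !big_seq; apply: eq_bigr => q qs /=.
  by rewrite (hs q _).2 ?inE ?qs ?orbT // scalerBl.
apply: (IH s'); first by rewrite size_map.
- move=> q /mapP [q' q's ->] /=; have [|Pq wq] := hs q'.
    by rewrite inE q's orbT.
  by split=> //; apply: (subspZ (is_wt_subsp _)).
- by rewrite -E; apply: (subspB sS); [apply: hS|apply: (subspZ sS)].
by rewrite -E => /subr0_eq.
Qed.

Lemma is_wt_uniq nu mu m : m <> 0 -> is_wt nu m -> is_wt mu m -> nu = mu.
Proof.
move=> m0 h1 h2; apply: wt_ext => i.
have := h1 _ (hh_in i); rewrite (h2 _ (hh_in i)) => /eqP.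
rewrite -subr_eq0 -scalerBl scaler_eq0 subr_eq0 => /orP [/eqP -> //|/eqP //].
Qed.

Lemma wspan_eigen (P : weight td -> Prop) y c m : y \in h -> wspan P m ->
  lm_act y m = c *: m -> (forall nu, P nu -> wt_at nu y <> c) -> m = 0.
Proof.
move=> yh wm ym Pc; apply: contrapT => m0.
have [||nu [u [Pn wu yu u0]]] :=
    @wspan_find (fun u => lm_act y u = c *: u) P m _ _ wm ym m0.
- split=> [|a u v hu hv]; first by rewrite act0r scaler0.
  by rewrite actDr actZr hu hv scalerDr !scalerA mulrC.
- move=> y' u y'h hu; rewrite act_swap (h_abelian yh y'h) act0l add0r hu.
  by rewrite actZr.
apply: (Pc nu Pn); apply/eqP; have := wu y yh; rewrite yu => /eqP.
by rewrite eq_sym -subr_eq0 -scalerBl scaler_eq0 subr_eq0 => /orP [//|/eqP //].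
Qed.

Lemma wspan_wt (P : weight td -> Prop) nu m : wspan P m -> is_wt nu m ->
  ~ P nu -> m = 0.
Proof.
move=> wm hm nP; apply: contrapT => m0.
have [||mu [u [Pn wu yu u0]]] := @wspan_find (is_wt nu) P m _ _ wm hm m0.
- exact: is_wt_subsp.
- move=> y u yh hu; rewrite hu //; exact: (subspZ (is_wt_subsp _)).
by apply: nP; rewrite (is_wt_uniq u0 yu wu).
Qed.
End WeightVectors.

Lemma is_wt_act (M : lieMod g) nu mu (x : g) (m : M) :
  is_wt (M := lm_adj g) nu x -> is_wt mu m -> is_wt (nu + mu) (lm_act x m).
Proof.
move=> wx wm y yh; have E : lie y x = wt_at nu y *: x := wx y yh.
by rewrite act_swap E (wm y) // actZl actZr -scalerDl wt_atDl.
Qed.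

Lemma wspan_act (M : lieMod g) (P Q R : weight td -> Prop) (x : g) (m : M) :
  (forall nu mu, P nu -> Q mu -> R (nu + mu)) ->
  wspan (M := lm_adj g) P x -> wspan Q m -> wspan R (lm_act x m).
Proof.
move=> PQR [s [-> hs]] [t [-> ht]]; rewrite (act_suml (M := M)).
have sR := @wspan_subsp M R.
apply: subsp_sum_in => // p /hs [Pp wp]; rewrite act_sumr.
apply: subsp_sum_in => // q /ht [Qq wq].
by apply: is_wt_wspan (is_wt_act wp wq); apply: PQR.
Qed.

Lemma is_wt_e i : is_wt (M := lm_adj g) (al i) (e i).
Proof. by move=> y yh /=; apply: lie_he. Qed.
Lemma is_wt_f i : is_wt (M := lm_adj g) (- al i) (f i).
Proof. by move=> y yh /=; rewrite wt_atNl; apply: lie_hf. Qed.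
Lemma is_wt_h (y : g) : y \in h -> is_wt (M := lm_adj g) 0 y.
Proof. by move=> yh z zh /=; rewrite wt_at0l scale0r; exact (h_abelian zh yh). Qed.

Lemma adj_wspan (P : weight td -> Prop) : 
  (forall nu mu, P nu -> P mu -> P (nu + mu)) -> (forall i, P (al i)) ->
  (forall i, P (- al i)) -> forall x, wspan (M := lm_adj g) P x.
Proof.
move=> PD Pe Pf; apply: (g_ind (td := td)).
- exact: wspan_subsp.
- by move=> a b wa wb; have := wspan_act (M := lm_adj g) PD wa wb.
- by move=> i; apply: is_wt_wspan (is_wt_e i).
- by move=> i; apply: is_wt_wspan (is_wt_f i).
Qed.

Lemma np_wspan (P : weight td -> Prop) x : x \in td_np td ->
  (forall nu mu, P nu -> P mu -> P (nu + mu)) -> (forall i, P (al i)) ->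
  wspan (M := lm_adj g) P x.
Proof.
move=> xn PD Pe.
apply: (subalg_ind (S := wspan (M := lm_adj g) P) (td_np_gen td)) xn.
- exact: wspan_subsp.
- by move=> a b wa wb; have := wspan_act (M := lm_adj g) PD wa wb.
- by move=> i; apply: is_wt_wspan (is_wt_e i).
Qed.

Lemma nm_wspan (P : weight td -> Prop) x : x \in td_nm td ->
  (forall nu mu, P nu -> P mu -> P (nu + mu)) -> (forall i, P (- al i)) ->
  wspan (M := lm_adj g) P x.
Proof.
move=> xn PD Pe.
apply: (subalg_ind (S := wspan (M := lm_adj g) P) (td_nm_gen td)) xn.
- exact: wspan_subsp.
- by move=> a b wa wb; have := wspan_act (M := lm_adj g) PD wa wb.
- by move=> i; apply: is_wt_wspan (is_wt_f i).
Qed.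

Lemma weight_basis (P : weight td -> Prop) :
  (forall x, wspan (M := lm_adj g) P x) ->
  exists X : (\dim (fullv : {vspace g})).-tuple g,
  basis_of fullv X /\ forall x, x \in X ->
    exists nu, P nu /\ is_wt (M := lm_adj g) nu x.
Proof.
move=> hP; have [X [fX XS SX]] := free_in_subsp
  (fun x : g => exists nu, P nu /\ is_wt (M := lm_adj g) nu x).
have bX : basis_of fullv X.
  rewrite /basis_of fX andbT eqEsubv subvf /=; apply/subvP => x _.
  have [s [-> hs]] := hP x; rewrite big_seq; apply: memv_suml => p ps.
  by apply: SX; exists p.1; apply: hs.
have szX : size X == \dim (fullv : {vspace g}) by move: fX; rewrite /free (span_basis bX) eq_sym.
by exists (Tuple szX).
Qed.

(** * Invariance and positivity properties of the Killing form *)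

Section Killing.
Local Notation B := (vbasis (fullv : {vspace g})).
Let bB : basis_of fullv B := vbasisP _.

Definition killing (x y : g) : k := trace B (lie x \o lie y).

Lemma ad2_linear (x y : g) : linear (lie x \o lie y).
Proof. by move=> a u v /=; rewrite !(lieDr, lieZr). Qed.

Lemma killingC x y : killing x y = killing y x.
Proof. exact: trace_comm bB bB (lie_bilin.2 x) (lie_bilin.2 y). Qed.

Lemma killing_linearl y : linear (killing^~ y : g -> k^o).
Proof.
move=> a x x'; rewrite /killing -traceD; congr trace; apply/funext => z /=.
by rewrite lieDl lieZl.
Qed.

Lemma killing_bilin : bilin (killing : g -> g -> k^o).
Proof.
split=> [y|x]; first exact: killing_linearl.
by move=> a y y'; rewrite !(killingC x); apply: killing_linearl.
Qed.

(** Once both brackets are expanded the two traces share one term; the remaining terms differ by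
    moving [ad y] cyclically. *)
Lemma killing_inv x y z : killing (lie x y) z = killing x (lie y z).
Proof.
have lB : trace B (fun u => (-1) *: lie y (lie x (lie z u)) + lie x (lie y (lie z u)))
    = trace B (fun u => (-1) *: lie x (lie z (lie y u)) + lie x (lie y (lie z u))).
  rewrite !traceD; congr (_ * _ + _).
  apply: (trace_comm (F := lie y) (G := lie x \o lie z) bB bB (lie_bilin.2 y)).
  exact: ad2_linear.
have eq1 : lie (lie x y) \o lie z =
    fun u => (-1) *: lie y (lie x (lie z u)) + lie x (lie y (lie z u)).
  by apply/funext => u /=; rewrite lie_act2 scaleN1r addrC.
have eq2 : lie x \o lie (lie y z) =
    fun u => (-1) *: lie x (lie z (lie y u)) + lie x (lie y (lie z u)).
  by apply/funext => u /=; rewrite lie_act2 lieDr lieNr scaleN1r addrC.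
by rewrite /killing eq1 lB -eq2.
Qed.

Lemma killing_aut (c d : g -> g) x y :
  linear c -> {morph c : u v / lie u v} -> linear d ->
  (forall u, c (d u) = u) -> (forall u, d (c u) = u) ->
  killing (c x) (c y) = killing x y.
Proof.
move=> lc mc ld cd dc; rewrite /killing.
have -> : lie (c x) \o lie (c y) = c \o (lie x \o lie y \o d).
  by apply/funext => u /=; rewrite !mc cd.
rewrite (trace_comm bB bB lc (comp_linear ld (ad2_linear x y))).
by congr trace; apply/funext => u /=; rewrite dc.
Qed.

(** On a basis of weight vectors [ad (hh i)] is diagonal with integer entries, so the value is a sum
    of squares. It is nonzero, for otherwise [hh i] would be central. *)
Lemma killing_hh i : exists n, killing (hh i) (hh i) = n.+1%:R.
Proof.
pose P nu := exists z : int, wt_at (nu : weight td) (hh i) = z%:~R.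
have [|X [bX wX]] := @weight_basis P.
  apply: adj_wspan => [nu mu [z zE] [z' z'E]|j|j].
  + by exists (z + z'); rewrite wt_atDl zE z'E rmorphD.
  + exact: al_int.
  + by have [z zE] := al_int i j; exists (- z); rewrite wt_atNl zE rmorphN.
have zX j : exists z : int, lie (hh i) X`_j = z%:~R *: X`_j.
  have [jlt|jge] := ltnP j (size X).
    by have [nu [[z zE] wj]] := wX _ (mem_nth 0 jlt); exists z; rewrite -zE; apply/wj/hh_in.
  by exists 0; rewrite nth_default // lie0r scaler0.
have [z zE] := choice zX.
have E : killing (hh i) (hh i) = (\sum_(j < \dim (fullv : {vspace g})) `|z j| ^ 2)%N%:R.
  rewrite /killing (trace_basis bB bX (ad2_linear _ _)) /trace natr_sum.
  apply: eq_bigr => j _; rewrite /= zE lieZr zE scalerA linearZ /=.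
  rewrite (coord_free _ _ (basis_free bX)) eqxx mulr1 -rmorphM /=.
  have zz : z j * z j = (`|z j|%N ^ 2)%N%:Z.
    by rewrite -mulnn -abszM gez0_abs // -expr2 Num.Theory.sqr_ge0.
  by rewrite zz -pmulrn.
rewrite E; case E2: (\sum_j _)%N => [|n]; last by exists n.
move/eqP: E2; rewrite sum_nat_eq0 => /forallP z0; exfalso.
apply: (@hh_neq0 _ _ td i); apply: center0 => // x.
rewrite (coord_basis bX (memvf x)) lie_sumr big1 // => j _.
have := z0 j; rewrite implyTb expn_eq0 absz_eq0 andbT => /eqP zj.
by rewrite lieZr zE zj scale0r scaler0.
Qed.
End Killing.
End Weights.

(** * Nondegeneracy of the Killing form *)

Section KillingForm.
Variables (k : closedFieldType) (char0 : [pchar k] =i pred0).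
Variables (g : finLieAlgType k) (g_ss : semisimple g).
Variable td : triangular_decomposition g.

Local Notation e := (td_ei td).
Local Notation f := (td_fi td).
Local Notation hh := (td_hi td).
Local Notation h := (td_h td).
Local Notation I := 'I_(td_rank td).
Local Notation al := (al (td := td)).
Local Notation kap := (@killing k g).
Local Notation wspan_ad := (wspan (M := lm_adj g)).
Local Notation is_wt_ad := (is_wt (td := td) (M := lm_adj g)).

Let kb := killing_bilin g.
Lemma kapDl (x y z : g) : kap (x + y) z = kap x z + kap y z.
Proof. exact: (bilDl kb). Qed.
Lemma kapDr (x y z : g) : kap x (y + z) = kap x y + kap x z.
Proof. exact: (bilDr kb). Qed.
Lemma kapZl a (x y : g) : kap (a *: x) y = a * kap x y.
Proof. exact: (bilZl kb). Qed.
Lemma kapZr a (x y : g) : kap x (a *: y) = a * kap x y.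
Proof. exact: (bilZr kb). Qed.
Lemma kap0l (x : g) : kap 0 x = 0. Proof. exact: (bil0l kb). Qed.
Lemma kapNl (x y : g) : kap (- x) y = - kap x y. Proof. exact: (bilNl kb). Qed.

(** In terms of the form on weights dual to the Killing form, this is 2 / (al i, al i). *)
Definition kc (i : I) : k := kap (e i) (f i).

Lemma kap_hh i y : y \in h -> kap (hh i) y = wt_at (al i) y * kc i.
Proof.
move=> yh; rewrite -lie_ef killing_inv (lieC (f i)) lie_hf // scaleNr opprK.
exact: kapZr.
Qed.

Lemma kc_pos i : exists n, 2%:R * kc i = n.+1%:R.
Proof.
have [n nE] := killing_hh char0 g_ss i; exists n.
by rewrite -nE kap_hh ?hh_in // al_hh.
Qed.

Lemma kc_neq0 i : kc i != 0.
Proof.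
have [n nE] := kc_pos i; apply/eqP => c0; move/eqP: nE.
by rewrite c0 mulr0 eq_sym natr_neq0.
Qed.

Section Degree.
Variable r : g.
Hypotheses (rh : r \in h) (r1 : forall i, wt_at (al i) r = 1).

(** For weight vectors of weights nu and mu, invariance under [ad r] gives (nu(r) + mu(r)) kap(x, y)
    = 0. *)
Lemma kap_orth (P Q : weight td -> Prop) (x y : g) :
  wspan_ad P x -> wspan_ad Q y ->
  (forall nu mu, P nu -> Q mu -> wt_at nu r + wt_at mu r != 0) -> kap x y = 0.
Proof.
move=> [s [-> hs]] [t [-> ht]] PQ; rewrite (bil_suml kb) big_seq big1 // => p ps.
rewrite (bil_sumr kb) big_seq big1 // => q qt.
have [Pp wp] := hs p ps; have [Qq wq] := ht q qt.
have Ep : lie r p.2 = wt_at p.1 r *: (p.2 : g) := wp r rh.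
have Eq : lie r q.2 = wt_at q.1 r *: (q.2 : g) := wq r rh.
have := killing_inv p.2 r q.2; rewrite lieC Ep Eq kapNl kapZl kapZr => /eqP.
rewrite -subr_eq0 -opprD oppr_eq0 -mulrDl mulf_eq0.
by rewrite (negPf (PQ _ _ Pp Qq)) /= => /eqP.
Qed.

Definition posw (nu : weight td) := exists n, wt_at nu r = n.+1%:R.
Definition negw (nu : weight td) := exists n, wt_at nu r = - n.+1%:R.
Definition zerow (nu : weight td) := wt_at nu r = 0.

Lemma np_pos x : x \in td_np td -> wspan_ad posw x.
Proof.
move=> xn; apply: np_wspan => // [nu mu [a aE] [b bE]|i]; last by exists 0; rewrite r1.
by exists (a + b.+1)%N; rewrite wt_atDl aE bE -natrD addSn.
Qed.
Lemma nm_neg x : x \in td_nm td -> wspan_ad negw x.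
Proof.
move=> xn; apply: nm_wspan => // [nu mu [a aE] [b bE]|i].
  by exists (a + b.+1)%N; rewrite wt_atDl aE bE -opprD -natrD addSn.
by exists 0; rewrite wt_atNl r1.
Qed.
Lemma h_zero x : x \in h -> wspan_ad zerow x.
Proof.
by move=> xh; apply: is_wt_wspan (is_wt_h xh); rewrite /zerow wt_at0l.
Qed.

Lemma kap_pp x y : x \in td_np td -> y \in td_np td -> kap x y = 0.
Proof.
move=> /np_pos hx /np_pos hy; apply: kap_orth hx hy _ => nu mu [a ->] [b ->].
by rewrite -natrD natr_neq0.
Qed.
Lemma kap_mm x y : x \in td_nm td -> y \in td_nm td -> kap x y = 0.
Proof.
move=> /nm_neg hx /nm_neg hy; apply: kap_orth hx hy _ => nu mu [a ->] [b ->].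
by rewrite -opprD oppr_eq0 -natrD natr_neq0.
Qed.
Lemma kap_ph x y : x \in td_np td -> y \in h -> kap x y = 0.
Proof.
move=> /np_pos hx /h_zero hy; apply: kap_orth hx hy _ => nu mu [a ->] ->.
by rewrite addr0 natr_neq0.
Qed.
Lemma kap_mh x y : x \in td_nm td -> y \in h -> kap x y = 0.
Proof.
move=> /nm_neg hx /h_zero hy; apply: kap_orth hx hy _ => nu mu [a ->] ->.
by rewrite addr0 oppr_eq0 natr_neq0.
Qed.

Lemma tri_direct a b c : a \in td_nm td -> b \in h -> c \in td_np td ->
  a + b + c = 0 -> [/\ a = 0, b = 0 & c = 0].
Proof.
move=> an bh cn E; have := td_direct td.
rewrite !directv_addE /= => /and3P [/and3P [_ _ /eqP i1] _ /eqP i2].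
have ab0 : a + b = 0.
  apply/eqP; rewrite -memv0 -i2 memv_cap memv_add //=.
  by move/eqP: E; rewrite addr_eq0 => /eqP ->; rewrite memvN.
have c0 : c = 0 by move: E; rewrite ab0 add0r.
have a0 : a = 0.
  apply/eqP; rewrite -memv0 -i1 memv_cap an /=.
  by move/eqP: ab0; rewrite addr_eq0 => /eqP ->; rewrite memvN.
by split=> //; move: ab0; rewrite a0 add0r.
Qed.

Lemma subalg_stable (J : Type) (x : J -> g) (U : {vspace g}) y :
  generated_by x U -> (forall j, exists c, lie y (x j) = c *: x j) ->
  forall a, a \in U -> lie y a \in U.
Proof.
move=> gU hx a aU; have [sub xin _] := gU.
suff [] : a \in U /\ lie y a \in U by [].
apply: (subalg_ind (S := fun a => a \in U /\ lie y a \in U) gU) aU.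
- split; first by rewrite lie0r mem0v.
  move=> c u v [uU yu] [vU yv]; rewrite lieDr lieZr.
  by split; rewrite memvD // memvZ.
- move=> b c [bU yb] [cU yc]; split; first exact: sub.
  by rewrite lie_leib memvD // sub.
- by move=> j; split=> //; have [c ->] := hx j; rewrite memvZ.
Qed.

Lemma lie_h_nm y x : y \in h -> x \in td_nm td -> lie y x \in td_nm td.
Proof.
move=> yh; apply: (subalg_stable (td_nm_gen td)) => i.
by eexists; apply: lie_hf.
Qed.
Lemma lie_h_np y x : y \in h -> x \in td_np td -> lie y x \in td_np td.
Proof.
move=> yh; apply: (subalg_stable (td_np_gen td)) => i.
by eexists; apply: lie_he.
Qed.

(** The eigenvalues of [ad r] are negative integers on [td_nm] and positive integers on [td_np], and
    both subspaces are stable, so the kernel lies in [h]. *)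
Lemma degree0_h x : lie r x = 0 -> x \in h.
Proof.
have [a [b [c [-> an bh cn]]]] := tri_split td x.
rewrite !lieDr (h_abelian rh bh) => E.
have [ra _ rc] := tri_direct (lie_h_nm rh an) (mem0v h) (lie_h_np rh cn) E.
have a0 : a = 0.
  apply: (@wspan_eigen k g td (lm_adj g) negw r 0 a rh (nm_neg an)).
    by rewrite scale0r.
  by move=> nu [n ->]; apply/eqP; rewrite oppr_eq0 natr_neq0.
have c0 : c = 0.
  apply: (@wspan_eigen k g td (lm_adj g) posw r 0 c rh (np_pos cn)).
    by rewrite scale0r.
  by move=> nu [n ->]; apply/eqP; rewrite natr_neq0.
by rewrite a0 c0 add0r addr0.
Qed.

(** In use [s] is 1 or -1, so that one argument serves for positive and for negative degrees. *)
Definition degge (s : k) (n : nat) (nu : weight td) :=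
  exists2 m, (n <= m)%N & wt_at nu r = s * m%:R.

Lemma degge_nil (s : k) : s != 0 ->
  exists N, forall x : g, wspan_ad (degge s N) x -> x = 0.
Proof.
move=> s0; have [l lP] := eigen_finite (lie_bilin.2 r).
have [N NP] : exists N, forall m, (N <= m)%N -> s * m%:R \notin l.
  elim: l {lP} => [|a l [N IH]]; first by exists 0.
  have [[m0 mE]|na] := pselect (exists m, s * m%:R = a).
    exists (maxn N m0.+1) => m; rewrite geq_max => /andP [Nm mm].
    rewrite inE negb_or IH // andbT -mE; apply/eqP => /(mulfI s0).
    by move/(natr_inj0 char0) => E; rewrite E ltnn in mm.
  exists N => m Nm; rewrite inE negb_or IH // andbT; apply/eqP => E.
  by apply: na; exists m.
exists N => x wx; apply: contrapT => x0.
have [||nu [u [[m Nm E] wu _ u0]]] := @wspan_find k g td (lm_adj g) (fun=> True) _ x _ _ wx Logic.I x0.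
- by [].
- by [].
by have /negP := NP m Nm; apply; rewrite -E; apply: lP u0; apply: wu.
Qed.

(** Degrees add under brackets, so the n-th term of the derived series lives in degrees at least
    [n + 1]. Beyond the last degree that occurs in [g] it is zero; the ideal is solvable. *)
Lemma ideal_pos0 (s : k) (U : {vspace g}) : s != 0 -> is_ideal U ->
  (forall x, x \in U -> wspan_ad (degge s 1) x) -> U = 0%VS.
Proof.
move=> s0 iU wU; apply: g_ss => //; have [N NP] := degge_nil s0.
exists N; apply/eqP; rewrite -subv0; apply/subvP => x xU; rewrite memv0.
apply/eqP/NP; move: xU; have : forall n y, y \in derived_series U n ->
    wspan_ad (degge s n.+1) y.
  elim=> [//|n IH] y /=; rewrite /lieprod.
  apply: subsp_span; first exact: wspan_subsp.
  move=> w /allpairsP [[u v] [/= /vbasis_mem/IH wu /vbasis_mem/IH wv ->]].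
  apply: (wspan_act (M := lm_adj g) _ wu wv) => nu mu [a na aE] [b nb bE].
  exists (a + b)%N; first by rewrite -[n.+2]addn1 leq_add // (leq_trans _ nb).
  by rewrite wt_atDl aE bE natrD mulrDr.
move=> H /H; apply: wspan_sub => nu [m Nm E]; exists m => //.
exact: leq_trans Nm.
Qed.

Definition krad (x : g) := forall y, kap x y = 0.

Lemma krad_subsp : subsp krad.
Proof.
split=> [y|a u v hu hv y]; first by rewrite kap0l.
by rewrite kapDl kapZl hu hv mulr0 addr0.
Qed.

Lemma krad_ideal x y : krad y -> krad (lie x y).
Proof. by move=> hy z; rewrite lieC kapNl killing_inv hy oppr0. Qed.

Lemma krad_h x : krad x -> x \in h -> x = 0.
Proof.
move=> kx xh; apply: (al_inj g_ss (td := td)) => // i.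
have := kx (hh i); rewrite killingC kap_hh // => /eqP.
by rewrite mulf_eq0 (negPf (kc_neq0 i)) orbF => /eqP.
Qed.

(** The homogeneous radical vectors with degrees of sign [s] span an ideal [J]: a bracket with a
    generator can leave these degrees only by reaching degree 0, where the vector lies in [h] and in
    the radical and so vanishes. Then [ideal_pos0] gives J = 0. *)
Lemma krad_signed (s : k) nu (u : g) n : s = 1 \/ s = -1 -> krad u ->
  is_wt_ad nu u -> wt_at nu r = s * n.+1%:R -> u = 0.
Proof.
move=> s1 ku wu nE.
pose J x := exists l : seq g, x = \sum_(v <- l) v /\ forall v, v \in l ->
  krad v /\ exists nu n, is_wt_ad nu v /\ wt_at nu r = s * n.+1%:R.
have sJ : subsp J.
  split; first by exists [::]; rewrite big_nil.
  move=> a x y [l [-> hl]] [l' [-> hl']].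
  exists ([seq a *: v | v <- l] ++ l'); split.
    by rewrite big_cat big_map /= scaler_sumr.
  move=> v; rewrite mem_cat => /orP [/mapP [w wl ->]|/hl' //].
  have [kw [mu [m [ww mE]]]] := hl w wl.
  split; first exact: (subspZ krad_subsp).
  by exists mu, m; split=> //; exact (subspZ (is_wt_subsp (lm_adj g) mu) a ww).
have J1 mu m v : krad v -> is_wt_ad mu v -> wt_at mu r = s * m.+1%:R -> J v.
  move=> kv wv mE; exists [:: v]; rewrite big_seq1; split=> // w.
  by rewrite inE => /eqP ->; split=> //; exists mu, m.
have Jstep (d : k) mu' (x : g) : is_wt_ad mu' x -> wt_at mu' r = d ->
    d = s \/ d = - s -> forall y, J y -> J (lie x y).
  move=> wx dE ds y [l [-> hl]]; rewrite lie_sumr.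
  apply: (subsp_sum_in sJ) => v /hl [kv [mu [m [wv mE]]]].
  have wxv : is_wt_ad (mu' + mu) (lie x v) by apply: (is_wt_act (M := lm_adj g)).
  have kxv : krad (lie x v) by apply: krad_ideal.
  have wE := wt_atDl mu' mu r; rewrite dE mE in wE.
  case: ds wE => ->.
    by move=> wE; apply: (J1 _ m.+1 _ kxv wxv); rewrite wE; ring.
  case: m {mE} => [|m] wE.
    have -> : lie x v = 0; last exact: sJ.1.
    apply: krad_h => //; apply: degree0_h.
    have -> : lie r (lie x v) = wt_at (mu' + mu) r *: lie x v := wxv r rh.
    by rewrite wE mulr1 addNr scale0r.
  by apply: (J1 _ m _ kxv wxv); rewrite wE; ring.
have Jg x y : J y -> J (lie x y).
  move: x y; apply: (g_ind (td := td) (S := fun x => forall y, J y -> J (lie x y))).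
  - split=> [y _|a x x' hx hx' y Jy]; first by rewrite lie0l; apply: sJ.1.
    by rewrite lieDl lieZl; apply: sJ.2; [apply: hx|apply: hx'].
  - move=> a b ha hb y Jy; rewrite lie_act2.
    by apply: (subspB sJ); [apply/ha/hb|apply/hb/ha].
  - move=> i; apply: (Jstep 1 (al i)) => //; first exact: is_wt_e.
    by case: s1 => ->; [left|right; rewrite opprK].
  - move=> i; apply: (Jstep (-1) (- al i)); first exact: is_wt_f.
      by rewrite wt_atNl r1.
    by case: s1 => ->; [right|left].
have [U UJ] := subsp_vspace sJ.
have U0 : U = 0%VS.
  apply: (@ideal_pos0 s).
  - by case: s1 => ->; rewrite ?oppr_eq0 oner_neq0.
  - by move=> x y /UJ Jy; apply/UJ/Jg.
  move=> x /UJ [l [-> hl]]; apply: (subsp_sum_in (wspan_subsp _ _)) => v.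
  move=> /hl [_ [mu [m [wv mE]]]].
  by apply: is_wt_wspan wv; exists m.+1.
have /UJ : J u by apply: J1 wu nE.
by rewrite U0 memv0 => /eqP.
Qed.

(** The radical is an ideal, so if nonzero it contains a nonzero weight vector, of integral degree.
    Degree 0 is excluded by [krad_h], the others by [krad_signed]. *)
Lemma krad0 x : krad x -> x = 0.
Proof.
move=> kx; apply: contrapT => x0.
pose P (nu : weight td) := exists z : int, wt_at nu r = z%:~R.
have wx : wspan_ad P x.
  apply: adj_wspan => [nu mu [a aE] [b bE]|i|i].
  - by exists (a + b); rewrite wt_atDl aE bE rmorphD.
  - by exists 1; rewrite r1.
  - by exists (-1); rewrite wt_atNl r1.
have [|nu [u [[z zE] wu ku u0]]] :=
  @wspan_find k g td (lm_adj g) krad P x krad_subsp _ wx kx x0.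
  by move=> y u _; apply: krad_ideal.
apply: u0; case: z zE => [[|n]|n] zE.
- apply: krad_h => //; apply: degree0_h.
  by have := wu r rh; rewrite zE scale0r.
- by apply: (krad_signed (s := 1)) wu _; [left|exact: ku|rewrite mul1r zE].
- by apply: (krad_signed (s := -1)) wu _; [right|exact: ku|rewrite mulN1r zE].
Qed.
End Degree.
End KillingForm.

(** * The Casimir operator on singular vectors *)

Section Casimir.
Variables (k : closedFieldType) (char0 : [pchar k] =i pred0).
Variables (g : finLieAlgType k) (g_ss : semisimple g).

Local Notation kap := (@killing k g).
Let kb := killing_bilin g.

(** The canonical element of [g (x) g] for the Killing form. The entries are not asked to form
    bases, so a list can be mapped or projected entrywise. *)
Definition dual_list (s : seq (g * g)) :=
  forall y, \sum_(p <- s) kap p.1 y *: p.2 = y.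

Lemma dual_list_exists (td : triangular_decomposition g) : exists s, dual_list s.
Proof.
have [r rh r1] := rho_exists g_ss td.
pose X := vbasis (fullv : {vspace g}).
have bX : basis_of fullv X by exact: vbasisP.
have lF : linear (fun y => \sum_(i < \dim (fullv : {vspace g})) kap X`_i y *: X`_i).
  move=> a u v; rewrite scaler_sumr -big_split; apply: eq_bigr => i _ /=.
  by rewrite kapDr kapZr scalerDl scalerA.
have [phi phiE] := lin_hom lF.
have k0 : lker phi == 0%VS.
  rewrite -subv0; apply/subvP => y; rewrite memv_ker phiE memv0 => /eqP S0.
  apply/eqP/(krad0 char0 g_ss rh r1) => x.
  have /freeP /(_ (fun i : 'I__ => kap X`_i y) S0) z0 := basis_free bX.
  rewrite killingC (coord_basis bX (memvf x)) (bil_suml kb) big1 // => i _.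
  by rewrite (bilZl kb) z0 scaler0.
exists [seq (X`_i, phi^-1%VF X`_i) | i : 'I_(\dim (fullv : {vspace g}))] => y.
rewrite big_map big_enum /= -[RHS](lker0_lfunK k0) phiE linear_sum.
by apply: eq_bigr => i _; rewrite linearZ.
Qed.

Section Lists.
Variables (s t : seq (g * g)).
Hypotheses (ds : dual_list s) (dt : dual_list t).

(** Expand the first entries in [t] and move the coefficients to the second slot; the sum over [s]
    then collapses. With s = t this is the symmetry of the canonical element, and two uses give its
    independence of the list. *)
Lemma dual_swap (N : lmodType k) (B : g -> g -> N) : bilin B ->
  \sum_(p <- s) B p.1 p.2 = \sum_(q <- t) B q.2 q.1.
Proof.
move=> bB.
have E p : B p.1 p.2 = \sum_(q <- t) B q.2 (kap p.1 q.1 *: p.2).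
  rewrite -{1}[p.1]dt (bil_suml bB); apply: eq_bigr => q _.
  by rewrite (bilZl bB) (bilZr bB) killingC.
under eq_bigr do rewrite E.
by rewrite exchange_big; apply: eq_bigr => q _ /=; rewrite -(bil_sumr bB) ds.
Qed.
End Lists.

Lemma dual_eq s t (N : lmodType k) (B : g -> g -> N) :
  dual_list s -> dual_list t -> bilin B ->
  \sum_(p <- s) B p.1 p.2 = \sum_(q <- t) B q.1 q.2.
Proof. by move=> ds dt bB; rewrite (dual_swap ds dt bB) -(dual_swap dt dt bB). Qed.

Lemma dual_flip s y : dual_list s -> \sum_(p <- s) kap p.2 y *: p.1 = y.
Proof.
move=> ds; rewrite -[RHS]ds.
rewrite (dual_swap (B := fun a b => kap b y *: a) ds ds) //; split=> [b|b] a u v.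
  by rewrite scalerDr !scalerA mulrC.
by rewrite kapDl kapZl scalerDl scalerA.
Qed.

(** Invariance of the Killing form carries [y] from one entry to the dual one with the opposite
    sign. This is what makes the Casimir operator commute with [g]. *)
Lemma dual_inv s (N : lmodType k) (B : g -> g -> N) y : dual_list s -> bilin B ->
  \sum_(p <- s) (B (lie y p.1) p.2 + B p.1 (lie y p.2)) = 0.
Proof.
move=> ds bB; rewrite big_split /=.
have E p : B (lie y p.1) p.2 = \sum_(q <- s) B q.2 (kap p.1 (lie q.1 y) *: p.2).
  rewrite -{1}[lie y p.1]ds (bil_suml bB); apply: eq_bigr => q _.
  by rewrite (bilZl bB) (bilZr bB) -killing_inv killingC.
under eq_bigr do rewrite E.
rewrite exchange_big /=.
under eq_bigr do rewrite -(bil_sumr bB) ds.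
have bB' : bilin (fun a b => B a (lie b y)).
  split=> [b|b] a u v; first exact: bB.1.
  by rewrite lieDl lieZl (bB.2 b).
rewrite -(dual_swap ds ds bB') -big_split big1 // => p _ /=.
by rewrite lieC (bilNr bB) addNr.
Qed.

Definition casimir (s : seq (g * g)) (M : lieMod g) (m : M) : M :=
  \sum_(p <- s) lm_act p.1 (lm_act p.2 m).

Lemma casimir_linear s M : linear (@casimir s M).
Proof.
move=> a u v; rewrite /casimir scaler_sumr -big_split; apply: eq_bigr => p _ /=.
by rewrite !(actDr, actZr).
Qed.

Lemma cas_bilin (M : lieMod g) (m : M) :
  bilin (fun x y : g => lm_act x (lm_act y m)).
Proof.
by split=> b a u v /=; rewrite actDl actZl // actDr actZr.
Qed.

Lemma casimir_eq s t (M : lieMod g) (m : M) : dual_list s -> dual_list t ->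
  casimir s m = casimir t m.
Proof. by move=> ds dt; apply: dual_eq ds dt (cas_bilin m). Qed.

Lemma casimir_act s (M : lieMod g) y (m : M) : dual_list s ->
  casimir s (lm_act y m) = lm_act y (casimir s m).
Proof.
move=> ds; apply/esym/eqP; rewrite -subr_eq0; apply/eqP.
rewrite -[RHS](dual_inv y ds (cas_bilin m)) /casimir act_sumr -sumrB.
apply: eq_bigr => p _ /=; rewrite act_swap -addrA; congr (_ + _).
by rewrite (act_swap y p.2) actDr addrK.
Qed.

Lemma dual_aut s (c d : g -> g) :
  linear c -> {morph c : u v / lie u v} -> linear d ->
  (forall u, c (d u) = u) -> (forall u, d (c u) = u) ->
  dual_list s -> dual_list [seq (c p.1, c p.2) | p <- s].
Proof.
move=> lc mc ld cd dc ds y; rewrite big_map /= -[RHS]cd -[d y]ds (lin_sum lc).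
apply: eq_bigr => p _; rewrite (linZ lc) -[in LHS](cd y).
by rewrite (killing_aut _ _ lc mc ld cd dc).
Qed.

(* The image in [k] of a positive rational: [k] itself carries no order. *)
Definition qpos (x : k) := exists a b, x * a.+1%:R = b.+1%:R.

Lemma qpos_neq0 x : qpos x -> x != 0.
Proof.
move=> [a [b E]]; apply/eqP => x0; move/eqP: E.
by rewrite x0 mul0r eq_sym natr_neq0.
Qed.
Lemma qposD x y : qpos x -> qpos y -> qpos (x + y).
Proof.
move=> [a [b E]] [a' [b' E']].
exists (a.+1 * a'.+1).-1, (b.+1 * a'.+1 + b'.+1 * a.+1).-1.
rewrite !prednK // natrD !natrM -E -E'; ring.
Qed.

(** * The Casimir eigenvalue (nu, nu + 2 rho) *)

Section SingularVectors.
Variable td : triangular_decomposition g.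
Local Notation e := (td_ei td).
Local Notation f := (td_fi td).
Local Notation hh := (td_hi td).
Local Notation h := (td_h td).
Local Notation I := 'I_(td_rank td).
Local Notation al := (al (td := td)).
Local Notation kc := (@kc k g td).

Variable r : g.
Hypotheses (rh : r \in h) (r1 : forall i, wt_at (al i) r = 1).

Record tri_proj (pm p0 pp : g -> g) : Prop := TriProj {
  tp_m : linear pm; tp_0 : linear p0; tp_p : linear pp;
  tp_sum : forall x, x = pm x + p0 x + pp x;
  tp_min : forall x, pm x \in td_nm td;
  tp_0in : forall x, p0 x \in h;
  tp_pin : forall x, pp x \in td_np td }.

Lemma tri_proj_exists : exists pm p0 pp, tri_proj pm p0 pp.
Proof.
have /choice [F FP] : forall x, exists p : g * g * g,
   [/\ x = p.1.1 + p.1.2 + p.2, p.1.1 \in td_nm td, p.1.2 \in h & p.2 \in td_np td].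
  by move=> x; have [a [b [c H]]] := tri_split td x; exists (a, b, c).
have dec a b c a' b' c' : a \in td_nm td -> b \in h -> c \in td_np td ->
    a' \in td_nm td -> b' \in h -> c' \in td_np td ->
    a + b + c = a' + b' + c' -> [/\ a = a', b = b' & c = c'].
  move=> ha hb hc ha' hb' hc' E.
  have [] := @tri_direct _ _ td (a - a') (b - b') (c - c'); rewrite ?memvB //.
    by rewrite (addrACA a) -opprD (addrACA (a + b)) -opprD E subrr.
  by move=> /subr0_eq -> /subr0_eq -> /subr0_eq ->.
have FL a u v : [/\ (F (a *: u + v)).1.1 = a *: (F u).1.1 + (F v).1.1,
    (F (a *: u + v)).1.2 = a *: (F u).1.2 + (F v).1.2 &
    (F (a *: u + v)).2 = a *: (F u).2 + (F v).2].
  have [E1 a1 b1 c1] := FP (a *: u + v); have [Eu au bu cu] := FP u.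
  have [Ev av bv cv] := FP v.
  apply: dec; rewrite // ?memvD ?memvZ // -E1 {1}Eu {1}Ev !scalerDr.
  by rewrite (addrACA (a *: (F u).1.1 + _)) (addrACA (a *: (F u).1.1)).
exists (fun x => (F x).1.1), (fun x => (F x).1.2), (fun x => (F x).2).
split; try by move=> a u v; have [] := FL a u v.
- by move=> x; have [] := FP x.
- by move=> x; have [] := FP x.
- by move=> x; have [] := FP x.
- by move=> x; have [] := FP x.
Qed.

Variables (pm p0 pp : g -> g).
Hypothesis tp : tri_proj pm p0 pp.
Variable s : seq (g * g).
Hypothesis ds : dual_list s.

Let lm := tp_m tp. Let l0 := tp_0 tp. Let lp := tp_p tp.
Let inm := tp_min tp. Let in0 := tp_0in tp. Let inp := tp_pin tp.

(** The Killing form pairs [td_np] only with [td_nm], so the two projections are adjoint. *)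
Lemma kap_pm x y : kap (pp x) y = kap x (pm y).
Proof.
rewrite {1}(tp_sum tp y) {2}(tp_sum tp x) !kapDl !kapDr.
rewrite (kap_pp char0 rh r1 (inp _) (inp _)) (kap_ph char0 rh r1 (inp _) (in0 _)).
rewrite (kap_mm char0 rh r1 (inm _) (inm _)) [kap (p0 x) _]killingC.
by rewrite (kap_mh char0 rh r1 (inm _) (in0 _)) !addr0 !add0r.
Qed.
Lemma kap_00 x y : kap (p0 x) y = kap x (p0 y).
Proof.
rewrite {1}(tp_sum tp y) {2}(tp_sum tp x) !kapDl !kapDr.
rewrite (kap_ph char0 rh r1 (inp _) (in0 _)) (kap_mh char0 rh r1 (inm _) (in0 _)).
rewrite [kap (p0 x) (pp y)]killingC [kap (p0 x) (pm y)]killingC.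
by rewrite (kap_ph char0 rh r1 (inp _) (in0 _)) (kap_mh char0 rh r1 (inm _) (in0 _)) !addr0 !add0r.
Qed.
Lemma kap_mp x y : kap (pm x) y = kap x (pp y).
Proof. by rewrite killingC -kap_pm killingC. Qed.

(** The component of the canonical element in n+ (x) n-; [s0] is the one in h (x) h. *)
Definition sp := [seq (pp p.1, pm p.2) | p <- s].
Definition s0 := [seq (p0 p.1, p0 p.2) | p <- s].

Lemma pm_idem y : pm (pm y) = pm y /\ p0 (pm y) = 0 /\ pp (pm y) = 0.
Proof.
have [] := @tri_direct _ _ td (pm (pm y) - pm y) (p0 (pm y)) (pp (pm y)) _ _ _ _ => //.
- by rewrite memvB.
- rewrite (addrAC (pm (pm y))) (addrAC (pm (pm y) + _)).
  apply/eqP; rewrite subr_eq0; apply/eqP.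
  by rewrite -(tp_sum tp).
by move=> /subr0_eq.
Qed.
Lemma pp_idem y : pp (pp y) = pp y /\ p0 (pp y) = 0 /\ pm (pp y) = 0.
Proof.
have [] := @tri_direct _ _ td (pm (pp y)) (p0 (pp y)) (pp (pp y) - pp y) _ _ _ _ => //.
- by rewrite memvB.
- rewrite addrA; apply/eqP; rewrite subr_eq0; apply/eqP.
  by rewrite -(tp_sum tp).
by move=> a b /subr0_eq.
Qed.
Lemma p0_id y : y \in h -> p0 y = y.
Proof.
move=> yh; have [] := @tri_direct _ _ td (pm y) (p0 y - y) (pp y) _ _ _ _ => //.
- by rewrite memvB.
- rewrite addrA (addrAC (pm y + _)); apply/eqP; rewrite subr_eq0; apply/eqP.
  by rewrite -(tp_sum tp).
by move=> _ /subr0_eq.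
Qed.

Lemma spE y : \sum_(q <- sp) kap q.1 y *: q.2 = pm y.
Proof.
rewrite big_map /=; under eq_bigr do rewrite kap_pm -(linZ lm).
by rewrite -(lin_sum lm) ds (pm_idem y).1.
Qed.
Lemma spE' y : \sum_(q <- sp) kap q.2 y *: q.1 = pp y.
Proof.
rewrite big_map /=; under eq_bigr do rewrite kap_mp -(linZ lp).
by rewrite -(lin_sum lp) dual_flip // (pp_idem y).1.
Qed.
Lemma s0E y : \sum_(q <- s0) kap q.1 y *: q.2 = p0 y.
Proof.
rewrite big_map /=; under eq_bigr do rewrite kap_00 -(linZ l0).
by rewrite -(lin_sum l0) ds p0_id.
Qed.
Lemma s0E' y : \sum_(q <- s0) kap q.2 y *: q.1 = p0 y.
Proof.
rewrite big_map /=; under eq_bigr do rewrite kap_00 -(linZ l0).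
by rewrite -(lin_sum l0) dual_flip // p0_id.
Qed.

(** In the flipped copy the factor from n+ acts first, so this part vanishes on singular vectors. *)
Definition tri_list := sp ++ s0 ++ [seq (q.2, q.1) | q <- sp].

Lemma tri_list_dual : dual_list tri_list.
Proof.
move=> y; rewrite !big_cat /= spE s0E big_map /= spE' addrA.
by rewrite -(tp_sum tp).
Qed.

(** The element of [h] that corresponds to 2 rho under the Killing form. It arises when, on a
    singular vector, the factors from n+ are moved to the right. *)
Definition zcas : g := \sum_(q <- sp) lie q.1 q.2.

Lemma sp_in q : q \in sp -> q.1 \in td_np td /\ q.2 \in td_nm td.
Proof. by case/mapP => p _ -> /=; rewrite ?inm ?in0 ?inp. Qed.
Lemma s0_in q : q \in s0 -> q.1 \in h /\ q.2 \in h.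
Proof. by case/mapP => p _ -> /=; rewrite ?inm ?in0 ?inp. Qed.

(** This is [dual_inv] restricted to n+ (x) n-: as [y] preserves n+, the dual action on n- is the
    bracket followed by the projection [pm]. *)
Lemma sp_lie_left y : (forall x, x \in td_np td -> lie y x \in td_np td) ->
  \sum_(q <- sp) lie (lie y q.1) q.2 = - \sum_(q <- sp) lie q.1 (pm (lie y q.2)).
Proof.
move=> ynp.
have E q : q \in sp -> lie (lie y q.1) q.2 =
    \sum_(u <- sp) lie u.1 (kap q.1 (lie u.2 y) *: q.2).
  move=> /sp_in [qp qm]; have := spE' (lie y q.1).
  have -> : pp (lie y q.1) = lie y q.1.
    have [] := @tri_direct _ _ td (pm (lie y q.1)) (p0 (lie y q.1))
       (pp (lie y q.1) - lie y q.1) _ _ _ _ => //.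
    - by rewrite memvB ?ynp.
    - by rewrite addrA -(tp_sum tp) subrr.
    - by move=> _ _ /subr0_eq.
  move=> <-; rewrite lie_suml; apply: eq_bigr => u _.
  by rewrite lieZl lieZr -killing_inv killingC.
rewrite (eq_big_seq _ E) exchange_big -sumrN /=; apply: eq_bigr => u _.
by rewrite -lie_sumr spE (lieC u.2 y) (linN lm) lieNr.
Qed.
Lemma tp_unique x a b c : x = a + b + c -> a \in td_nm td -> b \in h ->
  c \in td_np td -> [/\ pm x = a, p0 x = b & pp x = c].
Proof.
move=> E an bh cn.
have [] := @tri_direct _ _ td (pm x - a) (p0 x - b) (pp x - c); rewrite ?memvB //.
  rewrite (addrACA (pm x)) -opprD (addrACA (pm x + p0 x)) -opprD -(tp_sum tp) -E.
  exact: subrr.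
by move=> /subr0_eq -> /subr0_eq -> /subr0_eq ->.
Qed.

Lemma pm_id x : x \in td_nm td -> pm x = x.
Proof.
by move=> xm; have [] := @tp_unique x x 0 0 _ xm _ _; rewrite ?addr0 ?mem0v.
Qed.

Lemma zcas_h : zcas \in h.
Proof.
apply: (degree0_h char0 rh r1); rewrite lie_sumr.
under eq_bigr do rewrite lie_leib.
rewrite big_split /= sp_lie_left; last by move=> x; apply: lie_h_np.
rewrite addrC -sumrB big_seq big1 // => q /sp_in [_ qm].
by rewrite pm_id ?subrr // lie_h_nm.
Qed.

Lemma lie_e_nm i y : y \in td_nm td ->
  exists a b, [/\ lie (e i) y = a + b, a \in td_nm td & b \in h].
Proof.
move=> ym; have [sub fin _] := td_nm_gen td.
have [] : y \in td_nm td /\ exists a b, [/\ lie (e i) y = a + b, a \in td_nm td & b \in h];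
  last by [].
apply: (subalg_ind (S := fun y => y \in td_nm td /\ exists a b,
  [/\ lie (e i) y = a + b, a \in td_nm td & b \in h]) (td_nm_gen td)) ym.
- split.
    by split; rewrite ?mem0v //; exists 0, 0; rewrite lie0r addr0 !mem0v.
  move=> c u v [um [a [b [E am bh]]]] [vm [a' [b' [E' am' bh']]]].
  split; first by rewrite memvD // memvZ.
  exists (c *: a + a'), (c *: b + b'); rewrite lieDr lieZr E E' scalerDr addrACA.
  by rewrite !memvD // memvZ.
- move=> u v [um [a [b [E am bh]]]] [vm [a' [b' [E' am' bh']]]].
  split; first exact: sub.
  exists (lie (e i) (lie u v)), 0; rewrite addr0 mem0v; split=> //.
  rewrite lie_leib E E' lieDl lieDr (lieC u b').
  have bv := lie_h_nm bh vm; have bu := lie_h_nm bh' um.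
  apply: memvD; first exact: memvD (sub _ _ am vm) bv.
  by apply: memvD; [exact: sub|rewrite memvN].
move=> j; split; first exact: fin.
exists 0, (lie (e i) (f j)); rewrite add0r mem0v; split=> //.
by rewrite td_ef; case: eqP => _; rewrite ?hh_in ?mem0v.
Qed.

Lemma kap_h_inj x y : x \in h -> y \in h ->
  (forall i, kap (hh i) x = kap (hh i) y) -> x = y.
Proof.
move=> xh yh E; apply/subr0_eq; apply: (al_inj g_ss (td := td)) => [|i].
  exact: memvB.
have /eqP := E i; rewrite !kap_hh // -subr_eq0 -mulrBl mulf_eq0.
rewrite (negPf (kc_neq0 char0 g_ss i)) orbF => /eqP <-.
exact: (linB (wt_at_linear (al i))).
Qed.

(** The component along [h] is [kap (e i) y] times the element of [h] that represents [al i] for the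
    Killing form, which is [hh i] divided by [kc i] according to [kap_hh]. *)
Lemma p0_e i y : y \in td_nm td ->
  lie (e i) y = pm (lie (e i) y) + (kap (e i) y / kc i) *: hh i.
Proof.
move=> ym; have [a [b [E am bh]]] := lie_e_nm i ym.
have [||pE p0E _] := @tp_unique (lie (e i) y) a b 0 _ am bh; rewrite ?addr0 ?mem0v //.
rewrite pE {1}E; congr (_ + _); rewrite -p0E.
apply: kap_h_inj => // [|j]; first by rewrite memvZ // hh_in.
have hj := hh_in j.
rewrite killingC kap_00 (p0_id hj) lieC kapNl killing_inv (lieC (e i)) lie_he //.
rewrite (bilNr kb) opprK kapZr kapZr [kap (hh j) _]killingC kap_hh //.
by rewrite [RHS]mulrCA divfK ?kc_neq0 // [kap y _]killingC.
Qed.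

(** This is (2 rho, al i) = (al i, al i). In the bracket of [e i] with [zcas] the terms along n-
    cancel by [sp_lie_left]; the components along [h] from [p0_e] reassemble, through the dual list,
    to the bracket of [e i] with [hh i] divided by [kc i]. *)
Lemma al_zcas i : wt_at (al i) zcas * kc i = 2%:R.
Proof.
have E : lie (e i) zcas = (kc i)^-1 *: lie (e i) (hh i).
  rewrite lie_sumr; under eq_bigr do rewrite lie_leib.
  rewrite big_split /= sp_lie_left; last first.
    by move=> x xn; have [sub ein _] := td_np_gen td; apply: sub.
  rewrite addrC -sumrB.
  have pE : pp (e i) = e i.
    have [_ ein _] := td_np_gen td.
    by have [] := @tp_unique (e i) 0 0 (e i); rewrite ?add0r ?mem0v.
  rewrite -[in RHS]pE -spE' lie_suml scaler_sumr; apply: eq_big_seq => q /sp_in [_ qm].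
  rewrite -lieNr -lieDr {1}(p0_e i qm) addrAC subrr add0r lieZr lieZl scalerA.
  by congr (_ *: _); rewrite mulrC killingC.
move: E; rewrite (lieC _ zcas) lie_he ?zcas_h // (lieC _ (hh i)) lie_hhe scalerN.
move=> /oppr_inj /eqP; rewrite scalerA -subr_eq0 -scalerBl scaler_eq0 => /orP [|/eqP /e_neq0 //].
rewrite subr_eq0 => /eqP ->.
by rewrite mulrAC mulVf ?kc_neq0 // mul1r.
Qed.

Definition bcas (nu mu : weight td) : k :=
  \sum_(q <- s0) wt_at nu q.1 * wt_at mu q.2.

Lemma bcas_al nu i : bcas nu (al i) * kc i = wt_at nu (hh i).
Proof.
rewrite mulr_suml -[in RHS](p0_id (hh_in i)) -s0E' wt_at_sumr.
apply: eq_big_seq => q /s0_in [_ qh].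
by rewrite wt_atZr killingC kap_hh // -mulrA mulrC.
Qed.
Lemma al_bcas nu i : bcas (al i) nu * kc i = wt_at nu (hh i).
Proof.
rewrite mulr_suml -[in RHS](p0_id (hh_in i)) -s0E wt_at_sumr.
apply: eq_big_seq => q /s0_in [qh _].
by rewrite wt_atZr killingC kap_hh // mulrAC.
Qed.
Lemma bcasDl nu nu' mu : bcas (nu + nu') mu = bcas nu mu + bcas nu' mu.
Proof.
by rewrite -big_split; apply: eq_bigr => q _ /=; rewrite wt_atDl mulrDl.
Qed.
Lemma bcasDr nu mu mu' : bcas nu (mu + mu') = bcas nu mu + bcas nu mu'.
Proof.
by rewrite -big_split; apply: eq_bigr => q _ /=; rewrite wt_atDl mulrDr.
Qed.

Definition Ccas nu := bcas nu nu + wt_at nu zcas.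

Lemma np_kill (M : lieMod g) (m : M) : (forall i, lm_act (e i) m = 0) ->
  forall x, x \in td_np td -> lm_act x m = 0.
Proof.
move=> em; apply: (subalg_ind (S := fun x => lm_act x m = 0) (td_np_gen td)) => //.
  by split=> [|a u v hu hv]; rewrite ?act0l // actDl actZl hu hv scaler0 addr0.
by move=> a b ha hb; rewrite lm_lie ha hb !act0r subrr.
Qed.

Lemma casimir_sing (M : lieMod g) (m : M) nu : (forall i, lm_act (e i) m = 0) ->
  is_wt nu m -> casimir s m = Ccas nu *: m.
Proof.
move=> em wm; rewrite (casimir_eq m ds tri_list_dual) /casimir !big_cat /=.
rewrite addrA [X in _ + X]big1_seq ?addr0; last first.
  move=> p /andP [_ /mapP [q /sp_in [qp _] ->]] /=.
  by rewrite (np_kill em qp) act0r.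
rewrite scalerDl addrC; congr (_ + _).
  rewrite scaler_suml; apply: eq_big_seq => q /s0_in [q1 q2].
  by rewrite (wm _ q2) actZr (wm _ q1) scalerA mulrC.
rewrite -(wm _ zcas_h) act_suml; apply: eq_big_seq => q /sp_in [qp _].
by rewrite act_swap (np_kill em qp) act0r addr0.
Qed.

Definition root_sum (n : I -> nat) : weight td := \sum_i al i *+ n i.

(** With nu = lam - root_sum n the difference is (root_sum n, lam + nu + 2 rho), the sum of the n_i
    (lam(h_i) + nu(h_i) + 2) / kc_i. Each term with n_i > 0 is positive because lam and nu are both
    dominant. *)
Lemma Ccas_diff lam n :
  (forall i, exists a, wt_at lam (hh i) = a%:R) ->
  (forall i, exists a, wt_at (lam - root_sum n) (hh i) = a%:R) ->
  (exists i, 0 < n i)%N -> qpos (Ccas lam - Ccas (lam - root_sum n)).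
Proof.
set nu := lam - _ => dl dn [i0 i0n].
have lE : lam = nu + root_sum n by rewrite /nu subrK.
have brs mu : bcas mu (root_sum n) = \sum_i (n i)%:R * (wt_at mu (hh i) / kc i).
  rewrite /root_sum; elim/big_rec2: _ => [|i y1 y2 _ <-].
    by rewrite /bcas big1 // => q _; rewrite wt_at0l mulr0.
  rewrite bcasDr; congr (_ + _); rewrite -(bcas_al mu i) mulfK ?kc_neq0 //.
  by rewrite /bcas mulr_sumr; apply: eq_bigr => q _; rewrite wt_atMn mulrCA.
have rsb mu : bcas (root_sum n) mu = \sum_i (n i)%:R * (wt_at mu (hh i) / kc i).
  rewrite /root_sum; elim/big_rec2: _ => [|i y1 y2 _ <-].
    by rewrite /bcas big1 // => q _; rewrite wt_at0l mul0r.
  rewrite bcasDl; congr (_ + _); rewrite -(al_bcas mu i) mulfK ?kc_neq0 //.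
  by rewrite /bcas mulr_sumr; apply: eq_bigr => q _; rewrite wt_atMn mulrA.
have -> : Ccas lam - Ccas nu =
    \sum_i (n i)%:R * ((wt_at lam (hh i) + wt_at nu (hh i) + 2%:R) / kc i).
  have -> : Ccas lam - Ccas nu =
     bcas lam (root_sum n) + bcas (root_sum n) nu + wt_at (root_sum n) zcas.
    rewrite /Ccas {1}lE bcasDl; rewrite {2}lE bcasDr lE !bcasDl !bcasDr wt_atDl.
    by ring.
  rewrite brs rsb wt_at_suml -!big_split; apply: eq_bigr => i _ /=.
  have kn := kc_neq0 char0 g_ss i.
  have -> : wt_at (al i *+ n i) zcas = (n i)%:R * (2%:R / kc i).
    by rewrite wt_atMn -(al_zcas i) mulfK.
  by rewrite !mulrDl !mulrDr.
have pos i : (0 < n i)%N ->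
    qpos ((n i)%:R * ((wt_at lam (hh i) + wt_at nu (hh i) + 2%:R) / kc i)).
  move=> ni; have [a aE] := dl i; have [b bE] := dn i.
  have [c cE] := kc_pos char0 g_ss i.
  (* The identity [2 * kc i = c.+1] clears the denominator [kc i]; the predecessor undoes the
     successor in [qpos]. *)
  exists c, (n i * (a + b + 2) * 2).-1; rewrite prednK; last first.
    by rewrite !muln_gt0 ni addnS.
  rewrite -cE aE bE !natrM !natrD -!mulrA; congr (_ * (_ * _)).
  by rewrite mulrCA mulVf ?kc_neq0 // mulr1.
rewrite (bigD1 i0) //=.
elim/big_rec: _ => [|i x _ hx]; first by rewrite addr0; apply: pos.
case: (posnP (n i)) => [->|ni]; first by rewrite mul0r add0r.
by rewrite addrCA; apply: qposD => //; apply: pos.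
Qed.
End SingularVectors.

Lemma casimir_theory (td : triangular_decomposition g) :
  exists C : weight td -> k,
  (forall s (M : lieMod g) (m : M) nu, dual_list s ->
     (forall i, lm_act (td_ei td i) m = 0) -> is_wt nu m ->
     casimir s m = C nu *: m) /\
  (forall lam n, dominant_integral lam -> dominant_integral (lam - root_sum n) ->
     (exists i, 0 < n i)%N -> qpos (C lam - C (lam - root_sum n))).
Proof.
have [r rh r1] := rho_exists g_ss td.
have [pm [p0 [pp tp]]] := tri_proj_exists td.
have [s ds] := dual_list_exists td.
exists (@Ccas td pm p0 pp s); split.
  move=> t M m nu dt em wm; rewrite (casimir_eq m dt ds).
  exact: (casimir_sing rh r1 tp ds em wm).
by move=> lam n dl dn; apply: (Ccas_diff rh r1 tp ds).
Qed.
End Casimir.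

(** * Modules over g (x) A *)

Section GModules.
Variables (k : closedFieldType) (char0 : [pchar k] =i pred0).
Variables (g : finLieAlgType k) (g_ss : semisimple g).
Variable td : triangular_decomposition g.
Local Notation e := (td_ei td).
Local Notation f := (td_fi td).
Local Notation hh := (td_hi td).
Local Notation h := (td_h td).
Local Notation al := (al (td := td)).

Variable M : lieMod g.
Definition g_stable (S : M -> Prop) := subsp S /\ forall x u, S u -> S (lm_act x u).
Definition singular (nu : weight td) (m : M) :=
  is_wt nu m /\ forall i, lm_act (e i) m = 0.

Lemma singular_dominant nu m : m <> 0 -> singular nu m ->
  (forall i, exists n, iter n (lm_act (f i)) m = 0) -> dominant_integral nu.
Proof.
move=> m0 [wm em] fn i; have [n hn] := fn i.
have [||||||p [pE _]] := @sl2_dominant k char0 g M (e i) (f i) (hh i) m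
  (wt_at nu (hh i)) _ _ _ _ n.
- exact: lie_ef.
- exact: lie_hhf.
- exact: em.
- exact: wm (hh_in i).
- exact: m0.
- exact: hn.
by exists p.
Qed.

(** Raise until all [e i] kill the vector, then extract a weight vector from the killed vectors of
    [S], a subspace that [h] preserves. *)
Lemma singular_find (S : M -> Prop) (P : weight td -> Prop) m :
  g_stable S -> (forall u : M, locnil e u) -> wspan P m ->
  (forall u : M, wspan P u) -> S m -> m <> 0 ->
  exists nu s, [/\ P nu, singular nu s, S s & s <> 0].
Proof.
move=> [sS gS] en wm wM Sm m0.
have [|u [Su u0 eu]] := locnil_last (S := S) (en m) Sm m0.
  by move=> j u; apply: gS.
pose S' v := S v /\ forall i, lm_act (e i) v = 0.
have [||//|nu [s [Pn ws [Ss es] s0]]] := @wspan_find k g td M S' P u _ _ (wM u) _ u0.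
- split; first by split=> [|i]; [exact: sS.1|rewrite act0r].
  move=> a v w [Sv ev] [Sw ew]; split; first exact: sS.2.
  by move=> i; rewrite actDr actZr ev ew scaler0 addr0.
- move=> y v yh [Sv ev]; split; first exact: gS.
  move=> i; rewrite act_swap ev act0r addr0 lieC lie_he // actNl actZl ev.
  by rewrite scaler0 oppr0.
by exists nu, s.
Qed.
End GModules.

Section MapModules.
Variables (k : closedFieldType) (char0 : [pchar k] =i pred0).
Variables (g : finLieAlgType k) (g_ss : semisimple g) (A : comAlgType k).
Variable td : triangular_decomposition g.
Local Notation L := (mapAlg g A).
Local Notation e := (td_ei td).
Local Notation f := (td_fi td).
Local Notation hh := (td_hi td).
Local Notation h := (td_h td).
Local Notation I := 'I_(td_rank td).
Local Notation al := (al (td := td)).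

Lemma mtens_bilin : bilin (@mtens k g A). Proof. exact: tens_bilin. Qed.
Lemma mtensDl x y (a : A) : mtens (x + y) a = mtens x a + mtens y a :> L.
Proof. exact: (bilDl mtens_bilin). Qed.
Lemma mtensDr (x : g) (a b : A) : mtens x (a + b) = mtens x a + mtens x b :> L.
Proof. exact: (bilDr mtens_bilin). Qed.
Lemma mtensZl c (x : g) (a : A) : mtens (c *: x) a = c *: mtens x a :> L.
Proof. exact: (bilZl mtens_bilin). Qed.
Lemma mtensZr c (x : g) (a : A) : mtens x (c *: a) = c *: mtens x a :> L.
Proof. exact: (bilZr mtens_bilin). Qed.
Lemma mtens0l (a : A) : mtens 0 a = 0 :> L.
Proof. exact: (bil0l mtens_bilin). Qed.
Lemma mtens0r (x : g) : mtens x 0 = 0 :> L.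
Proof. exact: (bil0r mtens_bilin). Qed.
Lemma mtensNl (x : g) (a : A) : mtens (- x) a = - mtens x a :> L.
Proof. exact: (bilNl mtens_bilin). Qed.
Lemma mtens_lie x y (a b : A) : lie (mtens x a : L) (mtens y b) = mtens (lie x y) (a * b).
Proof. exact: map_lie_tens. Qed.
Lemma mtens_ind (P : L -> Prop) : subsp P -> (forall x a, P (mtens x a)) ->
  forall X, P X.
Proof.
move=> sP Pm; apply: tensor_ind => //; first exact: sP.1.
  exact: (subspD sP).
exact: (subspZ sP).
Qed.

Lemma mtens1_linear : linear (fun x => mtens x 1 : L).
Proof. exact: mtens_bilin.1. Qed.
Lemma mtens1_lie : {morph (fun x => mtens x 1 : L) : x y / lie x y}.
Proof. by move=> x y; rewrite mtens_lie mulr1. Qed.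

Definition gmod (M : lieMod L) : lieMod g := lm_pull mtens1_linear mtens1_lie M.

Lemma gmodE (M : lieMod L) x (m : M) :
  lm_act (l := gmod M) x m = lm_act (mtens x 1 : L) m.
Proof. by []. Qed.

Lemma wordnil_gmod (M : lieMod L) (J : Type) (F : J -> g) n (m : M) :
  wordnil F (M := gmod M) n m <-> wordnil (fun j => mtens (F j) 1 : L) n m.
Proof.
elim: n m => [//|n IH] m /=.
by split=> hm j; have := hm j => /IH.
Qed.

Lemma locnil_map (J : Type) (F : J -> g) :
  (forall x, locnil F (M := lm_adj g) x) ->
  forall X, locnil (fun j => mtens (F j) 1 : L) (M := lm_adj L) X.
Proof.
move=> Fn; apply: mtens_ind; first exact: locnil_subsp.
move=> x a; have [n hn] := Fn x; exists n.
elim: n x hn => [|n IH] x /= => [->|hn j]; first exact: mtens0l.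
by have := IH _ (hn j); rewrite mtens_lie mul1r.
Qed.

Section Module.
Variable M : lieMod L.
Implicit Types (u m : M).

Definition Lstable (S : M -> Prop) :=
  subsp S /\ forall x u, S u -> S (lm_act x u).

Definition generates m := forall S, Lstable S -> S m -> forall u, S u.

(** The bracket of x (x) a and y (x) 1 is [x, y] (x) a, so it is enough to treat the generators of
    [g], each with all coefficients. *)
Lemma Lstable_gen (S : M -> Prop) : subsp S ->
  (forall i a u, S u -> S (lm_act (mtens (e i) a : L) u)) ->
  (forall i a u, S u -> S (lm_act (mtens (f i) a : L) u)) -> Lstable S.
Proof.
move=> sS eS fS; split=> // X.
move: X; apply: (mtens_ind (P := fun X => forall u, S u -> S (lm_act X u))).
  split=> [u _|a x y hx hy u Su]; first by rewrite act0l; apply: sS.1.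
  by rewrite actDl actZl; apply: sS.2; [apply: hx|apply: hy].
move=> x; apply: (g_ind (td := td)
  (S := fun x => forall a u, S u -> S (lm_act (mtens x a : L) u))) x => //.
  split=> [a u _|c x y hx hy a u Su]; first by rewrite mtens0l act0l; apply: sS.1.
  by rewrite mtensDl mtensZl actDl actZl; apply: sS.2; [apply: hx|apply: hy].
move=> x y hx hy a u Su; rewrite -(mulr1 a) -mtens_lie lm_lie.
by apply: (subspB sS); [apply/hx/hy|apply/hy/hx].
Qed.

Lemma locnil_gen (J : Type) (F : J -> g) m : generates m ->
  (forall x, locnil F (M := lm_adj g) x) -> locnil F (M := gmod M) m ->
  forall u, locnil F (M := gmod M) u.
Proof.
move=> gm Fn [n hn] u; have Fn' := locnil_map Fn.
have [p hp] : locnil (fun j => mtens (F j) 1 : L) u.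
  apply: (gm (locnil (fun j => mtens (F j) 1 : L) (M := M))).
    by split; [exact: locnil_subsp|move=> x v; apply: locnil_act].
  by exists n; apply/wordnil_gmod.
by exists p; apply/wordnil_gmod.
Qed.

Definition hwv (chi : g -> A -> k) m :=
  (forall i a, lm_act (mtens (e i) a : L) m = 0) /\
  (forall y a, y \in h -> lm_act (mtens y a : L) m = chi y a *: m).

(** The index counts the occurrences of each [f i] and so determines the weight. Scalars form a
    constructor so that [fspan] is closed under linear combinations with plain sums. *)
Inductive fword m : (I -> nat) -> M -> Prop :=
| fword0 : fword m (fun=> 0%N) m
| fwordZ c n u : fword m n u -> fword m n (c *: u)
| fwordS i a n u : fword m n u ->
    fword m (fun j => n j + (j == i))%N (lm_act (mtens (f i) a : L) u).

Definition fspan m u := exists s : seq M, u = \sum_(v <- s) v /\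
  forall v, v \in s -> exists n, fword m n v.

Lemma fspan_subsp m : subsp (fspan m).
Proof.
split; first by exists [::]; rewrite big_nil.
move=> a u v [s [-> hs]] [t [-> ht]]; exists ([seq a *: w | w <- s] ++ t).
split; first by rewrite big_cat big_map /= scaler_sumr.
move=> w; rewrite mem_cat => /orP [/mapP [q /hs [n qn] ->]|/ht //].
by exists n; apply: fwordZ.
Qed.

Lemma fword_fspan m n u : fword m n u -> fspan m u.
Proof.
move=> hu; exists [:: u]; rewrite big_seq1; split=> // v.
by rewrite inE => /eqP ->; exists n.
Qed.

Lemma fspan_f m i a u : fspan m u -> fspan m (lm_act (mtens (f i) a : L) u).
Proof.
move=> [s [-> hs]]; rewrite act_sumr; apply: (subsp_sum_in (fspan_subsp m)).
by move=> v /hs [n vn]; apply: (fword_fspan (fwordS i a vn)).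
Qed.

(** Elements of [h] and the [e j] are moved to the right through a word. Passing [h] by a letter
    only changes its coefficient; passing [e j] by [f i] produces an element of [h], which is why
    [h] is treated first. *)
Lemma fspan_stable chi m : hwv chi m -> Lstable (fspan m).
Proof.
move=> [em hm]; have sF := fspan_subsp m.
have hF y a n u : y \in h -> fword m n u -> fspan m (lm_act (mtens y a : L) u).
  move=> yh; elim=> {n u} [|c n u _ IH|i b n u hu IH].
  - by rewrite hm //; apply: (subspZ sF); apply: (fword_fspan (fword0 m)).
  - by rewrite actZr; apply: (subspZ sF).
  rewrite act_swap mtens_lie lie_hf // mtensZl actZl.
  apply: (subspD sF); last exact: fspan_f.
  by apply: (subspZ sF); apply: (fword_fspan (fwordS i _ hu)).
have eF j a n u : fword m n u -> fspan m (lm_act (mtens (e j) a : L) u).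
  elim=> {n u} [|c n u _ IH|i b n u hu IH].
  - by rewrite em; apply: sF.1.
  - by rewrite actZr; apply: (subspZ sF).
  rewrite act_swap mtens_lie td_ef; apply: (subspD sF); last exact: fspan_f.
  case: eqP => _; last by rewrite mtens0l act0l; apply: sF.1.
  exact: hF (hh_in j) hu.
apply: Lstable_gen => // [i a u|i a u]; last exact: fspan_f.
move=> [s [-> hs]]; rewrite act_sumr; apply: (subsp_sum_in sF).
by move=> v /hs [n vn]; apply: eF vn.
Qed.

Lemma root_sumS n i :
  root_sum (fun j => n j + (j == i))%N = root_sum n + al i :> weight td.
Proof.
rewrite /root_sum; under eq_bigr do rewrite mulrnDr.
rewrite big_split /=; congr (_ + _); rewrite (bigD1 i) //= eqxx mulr1n big1 ?addr0 //.
by move=> j /negPf ->; rewrite mulr0n.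
Qed.

Lemma root_sum0 : root_sum (fun=> 0%N) = 0 :> weight td.
Proof. by rewrite /root_sum big1. Qed.

Lemma fword_wt lam m n u : is_wt (M := gmod M) lam m -> fword m n u ->
  is_wt (M := gmod M) (lam - root_sum n) u.
Proof.
move=> wm; elim=> {n u} [|c n u _ IH|i a n u _ IH].
- by rewrite root_sum0 subr0.
- exact: (subspZ (is_wt_subsp (gmod M) _)).
move=> y yh; have wu : lm_act (mtens y 1 : L) u = _ := IH y yh.
rewrite gmodE act_swap wu mtens_lie lie_hf // mtensZl actZl mul1r actZr -scalerDl.
by rewrite root_sumS opprD addrA !wt_atBl addrC.
Qed.

Lemma fword_pos m n u : fword m n u ->
  (exists c, u = c *: m) \/ exists i, (0 < n i)%N.
Proof.
elim=> {n u} [|c n u _ [[d ->]|H]|i a n u _ _]; last first.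
- by right; exists i; rewrite eqxx addn1.
- by right.
- by left; exists (c * d); rewrite scalerA.
by left; exists 1; rewrite scale1r.
Qed.

Definition below (lam nu : weight td) := exists n, nu = lam - root_sum n.
Definition sbelow (lam nu : weight td) :=
  exists n, nu = lam - root_sum n /\ exists i, (0 < n i)%N.

Lemma root_sum_neq0 n i : (0 < n i)%N -> root_sum n <> 0 :> weight td.
Proof.
have [r rh r1] := rho_exists g_ss td => ni E.
have := congr1 (fun l : weight td => wt_at l r) E.
rewrite wt_at_suml wt_at0l; under eq_bigr do rewrite wt_atMn r1 mulr1.
rewrite -natr_sum => /eqP; rewrite natr_neq0 // sum_nat_eq0 => /forallP /(_ i).
by rewrite implyTb eqn0Ngt ni.
Qed.

Lemma not_sbelow lam : ~ sbelow lam lam.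
Proof.
move=> [n [E [i ni]]]; apply: (root_sum_neq0 ni).
by have /eqP := E; rewrite eq_sym subr_eq addrC -subr_eq subrr eq_sym => /eqP.
Qed.

Lemma hwv_span chi lam m u : hwv chi m -> is_wt (M := gmod M) lam m ->
  fspan m u -> exists c, wspan (M := gmod M) (sbelow lam) (u - c *: m).
Proof.
move=> hm wm [s [-> hs]]; elim: s hs => [|v s IH] hs.
  by exists 0; rewrite big_nil scale0r subr0; apply: (wspan_subsp (gmod M) _).1.
have [|c hc] := IH; first by move=> w ws; apply: hs; rewrite inE ws orbT.
have [n vn] := hs v (mem_head _ _).
have sW := wspan_subsp (gmod M) (sbelow lam).
rewrite big_cons; have [[d ->]|ni] := fword_pos vn.
  by exists (d + c); rewrite scalerDl opprD addrACA subrr add0r.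
exists c; rewrite -addrA; apply: (subspD sW) => //.
by apply: is_wt_wspan (fword_wt wm vn); exists n.
Qed.

Lemma hwv_wspan chi lam m u : hwv chi m -> is_wt (M := gmod M) lam m ->
  fspan m u -> wspan (M := gmod M) (below lam) u.
Proof.
move=> hm wm [s [-> hs]]; apply: (subsp_sum_in (wspan_subsp (gmod M) _)).
move=> v /hs [n vn]; apply: is_wt_wspan (fword_wt wm vn).
by exists n.
Qed.

Lemma gen_fspan chi m u : hwv chi m -> generates m -> fspan m u.
Proof.
move=> hm gm; apply: (gm (fspan m)); first exact: fspan_stable hm.
exact: fword_fspan (fword0 m).
Qed.

(** Modulo a multiple of [m], the vector [u] is a sum of vectors of weights strictly below [lam];
    the difference also has weight [lam], hence is zero. *)
Lemma hwv_line chi (lam : weight td) m u : hwv chi m -> generates m ->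
  is_wt (M := gmod M) lam m -> is_wt (M := gmod M) lam u ->
  exists c, u = c *: m.
Proof.
move=> hm gm wm wu; have [c hc] := hwv_span hm wm (gen_fspan u hm gm).
exists c; apply/subr0_eq; apply: (wspan_wt (M := gmod M) (nu := lam) hc).
  have sW := is_wt_subsp (gmod M) lam.
  by apply: (subspB sW) => //; apply: (subspZ sW).
exact: not_sbelow.
Qed.
End Module.
End MapModules.

(** * Local Weyl modules *)

Section WeylModules.
Variables (k : closedFieldType) (char0 : [pchar k] =i pred0).
Variables (g : finLieAlgType k) (g_ss : semisimple g) (A : comAlgType k).
Variable td : triangular_decomposition g.
Local Notation L := (mapAlg g A).
Local Notation e := (td_ei td).
Local Notation f := (td_fi td).
Local Notation hh := (td_hi td).
Local Notation h := (td_h td).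
Local Notation I := 'I_(td_rank td).
Local Notation al := (al (td := td)).
Implicit Types (psi phi : Xrat A -> weight td).

Lemma Xrat_ext (x y : Xrat A) : (forall a, pt_eval x a = pt_eval y a) -> x = y.
Proof.
case: x y => [fx cx] [fy cy] E.
have {}E : fx = fy by apply/funext => a; apply: E.
case: _ / E cx cy => - [[p1] [p2] [p3]] [[q1] [q2] [q3]].
by rewrite (Prop_irrelevance p1 q1) (Prop_irrelevance p2 q2) (Prop_irrelevance p3 q3).
Qed.

Lemma pt_evalD (x : Xrat A) a b : pt_eval x (a + b) = pt_eval x a + pt_eval x b.
Proof. exact: (rmorphD (x : {lrmorphism A -> k^o})). Qed.
Lemma pt_evalN (x : Xrat A) a : pt_eval x (- a) = - pt_eval x a.
Proof. exact: (rmorphN (x : {lrmorphism A -> k^o})). Qed.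
Lemma pt_evalB (x : Xrat A) a b : pt_eval x (a - b) = pt_eval x a - pt_eval x b.
Proof. by rewrite pt_evalD pt_evalN. Qed.
Lemma pt_eval1 (x : Xrat A) : pt_eval x 1 = 1.
Proof. exact: (rmorph1 (x : {lrmorphism A -> k^o})). Qed.
Lemma pt_evalM (x : Xrat A) a b : pt_eval x (a * b) = pt_eval x a * pt_eval x b.
Proof. exact: (rmorphM (x : {lrmorphism A -> k^o})). Qed.
Lemma pt_evalX (x : Xrat A) a n : pt_eval x (a ^+ n) = pt_eval x a ^+ n.
Proof. exact: (rmorphXn (x : {lrmorphism A -> k^o})). Qed.
Lemma pt_evalZ (x : Xrat A) c a : pt_eval x (c *: a) = c * pt_eval x a.
Proof. by rewrite /pt_eval linearZ. Qed.
Lemma pt_eval0 (x : Xrat A) : pt_eval x 0 = 0.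
Proof. exact: (rmorph0 (x : {lrmorphism A -> k^o})). Qed.

Lemma map_eval_bilin (x : Xrat A) : bilin (fun (y : g) a => pt_eval x a *: y).
Proof.
split=> [a c y y'|y c a b]; first by rewrite scalerDr !scalerA mulrC.
by rewrite pt_evalD pt_evalZ scalerDl scalerA.
Qed.
Lemma map_evalE (x : Xrat A) y a : map_eval x (mtens y a : L) = pt_eval x a *: y.
Proof. exact: (tlift_tens (map_eval_bilin x)). Qed.
Lemma map_eval_linear (x : Xrat A) : linear (map_eval x : L -> g).
Proof. exact: (tlift_linear (map_eval_bilin x)). Qed.

Definition chi psi (y : g) (a : A) : k :=
  \sum_(x \in Supp psi) wt_at (psi x) y * pt_eval x a.

(** The relations of [local_weyl] reduced to the generators [e i] and to pure tensors; [wgen_vec]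
    and [weyl_lift] show that they define the same module. *)
Definition weyl_vec (M : lieMod L) psi (m : M) :=
  hwv td (chi psi) m /\ forall i n, wt_at (wt psi) (hh i) = n%:R ->
    iter n.+1 (lm_act (mtens (f i) 1 : L)) m = 0.

Definition wgen psi : local_weyl psi := pgen (lie_rel (weyl_rel psi)) tt.

Lemma wgenE psi (X : L) : lm_act (l := local_weyl psi) X (wgen psi) =
  pclass (lie_rel (weyl_rel psi)) (POp X (PGen tt)).
Proof. by rewrite pclass_op. Qed.

Lemma sub_map_mtens (U : {vspace g}) x (a : A) : x \in U -> Defs.sub_map U (mtens x a : L).
Proof.
move=> xU; exists [:: (x, a)]; rewrite big_seq1; split=> //=.
by rewrite xU.
Qed.

Lemma wgen_vec psi : weyl_vec psi (wgen psi).
Proof.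
split; last first.
  move=> i n E; have /pclassP := pc_rel (lr_rel (weyl_f E)).
  have IT p : pclass (lie_rel (weyl_rel psi))
      (iter p (POp (mtens (f i) 1 : L)) (PGen tt)) =
    iter p (lm_act (l := local_weyl psi) (mtens (f i) 1 : L)) (wgen psi).
    by elim: p => [//|p IH] /=; rewrite pclass_op IH.
  by rewrite IT pclass0.
split=> [i a|y a yh]; rewrite wgenE.
  rewrite -pclass0; apply/pclassP/pc_rel/lr_rel/weyl_np/sub_map_mtens.
  by have [_ ein _] := td_np_gen td.
rewrite -pclassZ; apply/pclassP; have := pc_rel (lr_rel (weyl_h psi (sub_map_mtens a yh))).
rewrite /chi; congr (pcong _ _ (PScale _ _)).
by apply: eq_fsbigr => x _; rewrite map_evalE wt_atZr mulrC.
Qed.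

Lemma wgen_generates psi : generates (wgen psi).
Proof.
move=> S [sS lS] Sw u; elim/presented_ind: u => [[]|||a x Sx|X x Sx] //.
- exact: sS.1.
- by move=> x y Sx Sy; apply: (subspD sS).
- exact: (subspZ sS).
- exact: lS.
Qed.

Definition lie_hom (M N : lieMod L) (F : M -> N) :=
  linear F /\ forall X u, F (lm_act X u) = lm_act X (F u).

Lemma hom_ext (M N : lieMod L) (F G : M -> N) m : lie_hom F -> lie_hom G ->
  generates m -> F m = G m -> forall u, F u = G u.
Proof.
move=> [lF hF] [lG hG] gm E; apply: (gm (fun u => F u = G u)) => //.
split; first split; first by rewrite (lin0 lF) (lin0 lG).
  by move=> a u v Eu Ev; rewrite lF lG Eu Ev.
by move=> X u Eu; rewrite hF hG Eu.
Qed.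

Lemma hwv_np (M : lieMod L) (c : g -> A -> k) (m : M) x a : hwv td c m ->
  x \in td_np td -> lm_act (mtens x a : L) m = 0.
Proof.
move=> [em _] xn; move: x xn a; apply: (subalg_ind
   (S := fun x => forall a, lm_act (mtens x a : L) m = 0) (td_np_gen td)) => //.
  split=> [a|c' u v hu hv a]; first by rewrite mtens0l act0l.
  by rewrite mtensDl mtensZl actDl actZl hu hv scaler0 addr0.
move=> x y hx hy a; rewrite -(mulr1 a) -mtens_lie lm_lie hx hy.
by rewrite !act0r subrr.
Qed.

Lemma weyl_lift (M : lieMod L) psi (m : M) : finite_set (Supp psi) -> weyl_vec psi m ->
  exists2 F : local_weyl psi -> M, lie_hom F & F (wgen psi) = m.
Proof.
move=> fin [hm fm].
pose op (X : L) (u : M) := lm_act X u.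
have lop X : linear (op X) by apply: (lm_bilin M).2.
have frel e1 e2 : lie_rel (weyl_rel psi) e1 e2 ->
    pfold (fun _ : unit => m) op e1 = pfold (fun _ : unit => m) op e2.
  case=> {e1 e2} [e1 e2|a X Y e1|X Y e1] /=; last 1 first.
  - by rewrite /op lm_lie scaleN1r.
  - case=> {e1 e2} [al' [s [/allP hs ->]]|i n E|al' [s [/allP hs ->]]].
    + rewrite /= /op act_suml big_seq big1 // => p /hs pn.
      exact: hwv_np hm pn.
    + rewrite [RHS]/= -(fm i n E); elim: (n.+1) => [//|p /= ->] //.
    rewrite /= /op act_suml.
    have -> : \sum_(x \in Supp psi) wt_at (psi x) (map_eval x (\sum_(p <- s) mtens p.1 p.2 : L))
      = \sum_(p <- s) chi psi p.1 p.2.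
      have E x : wt_at (psi x) (map_eval x (\sum_(p <- s) mtens p.1 p.2 : L)) =
         \sum_(p <- s) wt_at (psi x) p.1 * pt_eval x p.2.
        rewrite (lin_sum (map_eval_linear x)) wt_at_sumr.
        by apply: eq_bigr => p _; rewrite map_evalE wt_atZr mulrC.
      under eq_fsbigr do rewrite E.
      rewrite fsbig_finite //= exchange_big; apply: eq_bigr => p _.
      by rewrite /chi fsbig_finite.
    rewrite scaler_suml; apply: eq_big_seq => p /hs pn.
    exact: hm.2.
  - by rewrite /op actDl actZl.
exists (plift (R := lie_rel (weyl_rel psi)) (fun _ : unit => m) op).
  split; first exact: plift_linear lop frel.
  by move=> X u; apply: plift_op lop frel _ _.
exact: plift_gen lop frel _.
Qed.

Lemma chi_widen (U : set (Xrat A)) psi y a : finite_set U -> Supp psi `<=` U ->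
  chi psi y a = \sum_(x <- fset_set U) wt_at (psi x) y * pt_eval x a.
Proof.
move=> fU sU; rewrite /chi (fsbig_widen _ _ _ sU) ?fsbig_finite // => x [_ /= nx].
by have /negP := nx; rewrite negbK => /eqP ->; rewrite wt_at0l mul0r.
Qed.

Lemma wt_widen (U : set (Xrat A)) psi : finite_set U -> Supp psi `<=` U ->
  wt psi = \sum_(x <- fset_set U) psi x.
Proof.
move=> fU sU; rewrite /wt (fsbig_widen _ _ _ sU) ?fsbig_finite // => x [_ /= nx].
by have /negP := nx; rewrite negbK => /eqP.
Qed.

Lemma chi1 psi y : finite_set (Supp psi) -> chi psi y 1 = wt_at (wt psi) y.
Proof.
move=> fU; rewrite (chi_widen _ _ fU) // (wt_widen fU) // wt_at_suml.
by apply: eq_bigr => x _; rewrite pt_eval1 mulr1.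
Qed.

Lemma wt_dominant psi : in_E psi -> dominant_integral (wt psi).
Proof.
move=> [fU dU] i; rewrite (wt_widen fU) // wt_at_suml.
elim/big_ind: _ => [|u v [a ->] [b ->]|x _]; first by exists 0.
  by exists (a + b)%N; rewrite natrD.
exact: dU.
Qed.

Lemma hwv_wt (M : lieMod L) psi (m : M) : finite_set (Supp psi) ->
  hwv td (chi psi) m -> is_wt (td := td) (M := gmod M) (wt psi) m.
Proof. by move=> fU [_ hm] y yh; rewrite gmodE hm // chi1. Qed.

Definition annihilates (M : lieMod L) (a : A) :=
  forall x b (u : M), lm_act (mtens x (a * b) : L) u = 0.

Lemma annihilatesM (M : lieMod L) a b : annihilates M a -> annihilates M (a * b).
Proof. by move=> h x c u; rewrite -mulrA; apply: h. Qed.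

(** The tensors with coefficients in the ideal [a A] span an ideal of [g (x) A], so the vectors they
    kill form a submodule. *)
Lemma annihilates_gen (M : lieMod L) (m : M) a : generates m ->
  (forall x b, lm_act (mtens x (a * b) : L) m = 0) -> annihilates M a.
Proof.
move=> gm am x b u; move: x b.
apply: (gm (fun u => forall x b, lm_act (mtens x (a * b) : L) u = 0)) => //.
split; first split=> [x b|c v w hv hw x b]; first by rewrite act0r.
  by rewrite actDr actZr hv hw scaler0 addr0.
move=> X v hv; move: X; apply: mtens_ind.
  split=> [x b|c X Y hX hY x b]; first by rewrite act0l act0r.
  by rewrite actDl actZl actDr actZr hX hY scaler0 addr0.
by move=> y c x b; rewrite act_swap mtens_lie -mulrA !hv act0r addr0.
Qed.

(** * Powers of a function vanishing on the support annihilate the Weyl module *)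

Section Power.
Variables (M : lieMod L) (psi : Xrat A -> weight td) (m : M) (a : A).
Hypotheses (psiE : in_E psi) (wm : weyl_vec psi m).
Hypothesis a0 : forall x, Supp psi x -> pt_eval x a = 0.

Lemma h_pow_kill y n b : y \in h -> lm_act (mtens y (a ^+ n.+1 * b) : L) m = 0.
Proof.
move=> yh; rewrite wm.1.2 // (chi_widen _ _ psiE.1) // big_seq big1 ?scale0r // => x.
rewrite in_fset_set; last exact: psiE.1.
by move=> /set_mem /a0 ax; rewrite pt_evalM pt_evalX ax expr0n /= mul0r mulr0.
Qed.

Section Index.
Variable i : I.

Definition fmon (s : seq nat) : M :=
  foldr (fun j u => lm_act (mtens (f i) (a ^+ j) : L) u) m s.

Lemma h_fmon s t : exists l, [/\
  lm_act (mtens (hh i) (a ^+ t.+1) : L) (fmon s) = \sum_(s' <- l) - 2%:R *: fmon s',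
  size l = size s &
  forall s', s' \in l -> size s' = size s /\ sumn s' = (sumn s + t.+1)%N].
Proof.
elim: s => [|j s [l [E szl hl]]].
  by exists [::]; rewrite big_nil /= -[a ^+ _]mulr1 h_pow_kill // hh_in.
exists (((t.+1 + j)%N :: s) :: [seq j :: s' | s' <- l]); split.
- rewrite big_cons big_map /= act_swap mtens_lie lie_hhf mtensZl actZl -exprD E.
  rewrite act_sumr; congr (_ + _); apply: eq_bigr => s' _ /=.
  by rewrite actZr.
- by rewrite /= size_map szl.
move=> s'; rewrite inE => /orP [/eqP ->|/mapP [s1 /hl [sz sm] ->]] /=.
  by split=> //; rewrite -addnA addnC.
by rewrite sz sm addnA.
Qed.

Lemma e_fmon s : exists l, [/\
  lm_act (mtens (e i) a : L) (fmon s) = \sum_(s' <- l) - 2%:R *: fmon s',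
  size l = 'C(size s, 2) &
  forall s', s' \in l -> (size s').+1 = size s /\ sumn s' = (sumn s).+1].
Proof.
elim: s => [|j s [l [E szl hl]]].
  by exists [::]; rewrite big_nil /= -[a]mulr1 wm.1.1.
have [l' [E' szl' hl']] := h_fmon s j.
exists (l' ++ [seq j :: s' | s' <- l]); split.
- rewrite big_cat big_map /= act_swap mtens_lie lie_ef -exprS E' E.
  rewrite act_sumr; congr (_ + _); apply: eq_bigr => s' _ /=.
  by rewrite actZr.
- by rewrite size_cat size_map szl' szl /= binS bin1 addnC.
move=> s'; rewrite mem_cat => /orP [/hl' [sz sm]|/mapP [s1 /hl [sz sm] ->]] /=.
  by rewrite sz sm addnC.
by rewrite sz sm addnS.
Qed.

(* The coefficient depends only on the length of [s]: each application of
   [e_i (x) a] merges two factors, in one of [size s choose 2] ways. *)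
Lemma e_iter_fmon r : exists2 c : k, c != 0 & forall s, size s = r.+1 ->
  iter r (lm_act (mtens (e i) a : L)) (fmon s) = c *: fmon [:: (sumn s + r)%N].
Proof.
elim: r => [|r [c c0 hc]].
  exists 1; first exact: oner_neq0.
  by case=> [//|j [|//]] _; rewrite scale1r /= !addn0.
exists ('C(r.+2, 2)%:R * (- 2%:R * c)).
  by rewrite !mulf_neq0 ?oppr_eq0 ?natr_neq0 // -lt0n bin_gt0.
move=> s szs; rewrite iterSr; have [l [-> szl hl]] := e_fmon s.
have itl : linear (iter r (lm_act (l := M) (mtens (e i) a : L))).
  elim: r {hc szs szl} => [//|r IH] x u v /=.
  by rewrite IH actDr actZr.
rewrite (lin_sum itl) -szs -szl mulr_natl -scalerMnl -[size l]/(size l).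
rewrite (eq_big_seq (fun=> (- 2%:R * c) *: fmon [:: (sumn s + r.+1)%N])).
  by rewrite big_const_seq count_predT iter_addr_0.
move=> s' /hl [sz sm]; rewrite (linZ itl) hc; last by apply: succn_inj; rewrite sz.
by rewrite scalerA sm addSnnS.
Qed.

(** Apply the n-th power of [e i (x) a] to the Weyl relation that kills [m] by the power n+1 of
    [f i (x) 1]. As [hh i (x) a^j] kills [m] for j > 0, the n+1 factors merge into one, leaving a
    nonzero multiple of [f i (x) a^n] applied to [m]. *)
Lemma f_pow_kill1 : exists n, lm_act (mtens (f i) (a ^+ n) : L) m = 0.
Proof.
have [n nE] := wt_dominant psiE i; exists n.
have := wm.2 i n nE.
have -> : iter n.+1 (lm_act (mtens (f i) 1 : L)) m = fmon (nseq n.+1 0%N).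
  by elim: n.+1 => [//|p /= ->]; rewrite expr0.
have [c c0 hc] := e_iter_fmon n => E.
have := hc (nseq n.+1 0%N) (size_nseq _ _).
rewrite E sumn_nseq mul0n /=.
have -> : iter n (lm_act (l := M) (mtens (e i) a : L)) 0 = 0.
  by elim: (n) => [//|p /= ->]; rewrite act0r.
by move=> /esym/eqP; rewrite scaler_eq0 (negPf c0) /= => /eqP.
Qed.

Lemma f_kill_mul b c : lm_act (mtens (f i) b : L) m = 0 ->
  lm_act (mtens (f i) (b * c) : L) m = 0.
Proof.
move=> fb; have := act_swap (mtens (hh i) c : L) (mtens (f i) b) m.
rewrite fb act0r mtens_lie lie_hhf mtensZl actZl (wm.1.2 (hh i)) ?hh_in // actZr fb.
move=> /esym/eqP; rewrite scaler0 addr0 scaler_eq0 oppr_eq0 natr_neq0 //=.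
by rewrite mulrC => /eqP.
Qed.
End Index.

Lemma pow_kill : exists N, forall x b, lm_act (mtens x (a ^+ N * b) : L) m = 0.
Proof.
(* Admitting every exponent from [K] on makes the thresholds of two elements add under linear
   combinations and brackets. *)
pose G (x : g) := exists K, forall p b, lm_act (mtens x (a ^+ (K + p) * b) : L) m = 0.
have GG : forall x, G x.
  apply: (g_ind (td := td)).
  - split; first by exists 0%N => p b; rewrite mtens0l act0l.
    move=> c x y [K hK] [K' hK']; exists (K + K')%N => p b.
    rewrite mtensDl mtensZl actDl actZl -{1}addnA hK scaler0 add0r.
    by rewrite (addnC K) -addnA hK'.
  - move=> x y [K hK] [K' hK']; exists (K + K')%N => p b.
    have -> : a ^+ (K + K' + p) * b = a ^+ (K + 0) * 1 * (a ^+ (K' + p) * b).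
      by rewrite addn0 mulr1 mulrA -exprD addnA.
    by rewrite -mtens_lie lm_lie hK hK' !act0r subrr.
  - by move=> i; exists 0%N => p b; rewrite wm.1.1.
  move=> i; have [K hK] := f_pow_kill1 i; exists K => p b.
  by rewrite exprD -mulrA; apply: f_kill_mul.
have [K hK] := choice GG.
pose X := vbasis (fullv : {vspace g}).
pose N := (\sum_(j < \dim (fullv : {vspace g})) K (X`_j)%R)%N.
exists N => x b; rewrite (coord_basis (vbasisP _) (memvf x)).
rewrite (bil_suml (mtens_bilin g A)) act_suml big1 // => j _.
by rewrite mtensZl actZl /N (bigD1 j) //= hK scaler0.
Qed.
End Power.

Lemma ann_power (M : lieMod L) psi (m : M) a : in_E psi -> weyl_vec psi m ->
  generates m -> (forall x, Supp psi x -> pt_eval x a = 0) ->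
  exists N, annihilates M (a ^+ N).
Proof.
move=> psiE wm gm a0; have [N hN] := pow_kill psiE wm a0.
by exists N; apply: annihilates_gen gm hN.
Qed.
End WeylModules.

Arguments wgen_generates {k g A td} psi.

(** * Tensor products of local Weyl modules with disjoint supports *)

Section TensorProduct.
Variables (k : closedFieldType) (char0 : [pchar k] =i pred0).
Variables (g : finLieAlgType k) (g_ss : semisimple g) (A : comAlgType k).
Variable td : triangular_decomposition g.
Local Notation L := (mapAlg g A).
Local Notation e := (td_ei td).
Local Notation f := (td_fi td).
Local Notation hh := (td_hi td).
Local Notation h := (td_h td).
Implicit Types (psi phi : Xrat A -> weight td).

Lemma mulA_bilin (c : A) : bilin (fun (x : g) a => mtens x (c * a) : L).
Proof.
split=> [a d x y|x d a b]; first by rewrite mtensDl mtensZl.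
by rewrite mulrDr -scalerAr mtensDr mtensZr.
Qed.
Definition mulA (c : A) : L -> L := tlift (fun (x : g) a => mtens x (c * a) : L).
Lemma mulA_mtens c x a : mulA c (mtens x a) = mtens x (c * a).
Proof. exact: (tlift_tens (mulA_bilin c)). Qed.
Lemma mulA_linear c : linear (mulA c).
Proof. exact: (tlift_linear (mulA_bilin c)). Qed.

Lemma mulA_lie c d X Y : lie (mulA c X) (mulA d Y) = mulA (c * d) (lie X Y).
Proof.
move: X; apply: mtens_ind.
  split=> [|a X X' hX hX']; first by rewrite (lin0 (mulA_linear c)) !lie0l (lin0 (mulA_linear _)).
  by rewrite (mulA_linear c) !lieDl !lieZl (mulA_linear (c * d)) hX hX'.
move=> x a; move: Y; apply: mtens_ind.
  split=> [|b X X' hX hX']; first by rewrite (lin0 (mulA_linear d)) !lie0r (lin0 (mulA_linear _)).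
  by rewrite (mulA_linear d) !lieDr !lieZr (mulA_linear (c * d)) hX hX'.
by move=> y b; rewrite !mulA_mtens !mtens_lie mulA_mtens mulrACA.
Qed.

Lemma mulAD c d X : mulA (c + d) X = mulA c X + mulA d X.
Proof.
move: X; apply: mtens_ind => [|x a].
  split=> [|a X X' hX hX']; first by rewrite !(lin0 (mulA_linear _)) addr0.
  by rewrite !(mulA_linear _) hX hX' scalerDr addrACA.
by rewrite !mulA_mtens mulrDl mtensDr.
Qed.

Lemma mulA1 X : mulA 1 X = X.
Proof.
move: X; apply: mtens_ind => [|x a]; last by rewrite mulA_mtens mul1r.
split=> [|a X X' hX hX']; first by rewrite !(lin0 (mulA_linear _)).
by rewrite !(mulA_linear _) hX hX'.
Qed.

Lemma mulAN c X : mulA (- c) X = - mulA c X.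
Proof.
apply/eqP; rewrite -addr_eq0 -mulAD addNr; apply/eqP.
move: X; apply: mtens_ind => [|x a]; last by rewrite mulA_mtens mul0r mtens0r.
split=> [|a X X' hX hX']; first by rewrite !(lin0 (mulA_linear _)).
by rewrite !(mulA_linear _) hX hX' scaler0 addr0.
Qed.

Lemma annihilates_mulA (M : lieMod L) c X (u : M) :
  annihilates M c -> lm_act (mulA c X) u = 0.
Proof.
move=> ac; move: X; apply: mtens_ind => [|x a]; last by rewrite mulA_mtens ac.
split=> [|a X X' hX hX']; first by rewrite (lin0 (mulA_linear _)) act0l.
by rewrite (mulA_linear _) actDl actZl hX hX' scaler0 addr0.
Qed.

Lemma separate (s t : seq (Xrat A)) : (forall x, x \in s -> x \notin t) ->
  exists a, (forall x, x \in s -> pt_eval x a = 1) /\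
            (forall y, y \in t -> pt_eval y a = 0).
Proof.
move=> st.
have sep1 (x : Xrat A) (l : seq (Xrat A)) : x \notin l -> exists a,
    pt_eval x a = 1 /\ forall y, y \in l -> pt_eval y a = 0.
  elim: l => [|y l IH]; first by exists 1; rewrite pt_eval1.
  rewrite inE negb_or => /andP [xy /IH [a [ax al]]].
  have [d dne] : exists d, pt_eval x d != pt_eval y d.
    apply: contrapT => nd; case/eqP: xy; apply: Xrat_ext => d.
    by apply/eqP; apply: contrapT => /negP ne; apply: nd; exists d.
  exists (a * ((pt_eval x d - pt_eval y d)^-1 *: (d - pt_eval y d *: 1))); split.
    rewrite pt_evalM ax pt_evalZ pt_evalB pt_evalZ pt_eval1 mulr1 mul1r mulVf //.
    by rewrite subr_eq0.
  move=> z; rewrite inE pt_evalM => /orP [/eqP ->|/al ->]; last by rewrite mul0r.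
  by rewrite pt_evalZ pt_evalB pt_evalZ pt_eval1 mulr1 subrr !mulr0.
elim: s st => [|x s IH] st; first by exists 0; split=> // y _; rewrite pt_eval0.
have [b [bx bt]] := sep1 x t (st x (mem_head _ _)).
have [|a [as_ at_]] := IH; first by move=> z zs; apply: st; rewrite inE zs orbT.
(* This combination is 1 where [a] or [b] is 1, and 0 where both vanish. *)
exists (1 - (1 - b) * (1 - a)); split=> z.
  rewrite inE pt_evalB pt_evalM !pt_evalB !pt_eval1 => /orP [/eqP ->|/as_ ->].
    by rewrite bx subrr mul0r subr0.
  by rewrite subrr mulr0 subr0.
by move=> zt; rewrite pt_evalB pt_evalM !pt_evalB !pt_eval1 bt // at_ // !subr0 mulr1 subrr.
Qed.

(** The element [c] lifts the idempotent [a] modulo a power of a (1 - a). Since 1 - b^n is divisible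
    by 1 - b, the choice b = 1 - a^(N+1) makes [c] divisible by a^(N+1), while 1 - c is the power
    N+1 of 1 - a^(N+1), hence divisible by (1 - a)^(N+1). *)
Lemma idempotent_lift (a : A) N : exists q q', 
  let c := 1 - (1 - a ^+ N.+1) ^+ N.+1 in
  c = a ^+ N * q /\ 1 - c = (1 - a) ^+ N * q'.
Proof.
have dv (b : A) n : exists q, 1 - b ^+ n = (1 - b) * q.
  by exists (\sum_(i < n) b ^+ i); rewrite -opprB subrX1 -mulNr opprB.
have [q E] := dv (1 - a ^+ N.+1) N.+1; have [q' E'] := dv a N.+1.
exists (a * q), ((1 - a) * q' ^+ N.+1); split.
  by rewrite E subKr exprSr mulrA.
by rewrite subKr E' exprMn exprSr mulrA.
Qed.

(** * The action cut by an element that acts as an idempotent *)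

Section Cut.
Variables (M : lieMod L) (c : A).
Hypothesis ac : annihilates M (c * (1 - c)).

Definition cut_act (X : L) (u : M) : M := lm_act (mulA c X) u.

Lemma cut_bilin : bilin cut_act.
Proof.
split=> [u a X Y|X]; last exact: (lm_bilin M).2.
by rewrite /cut_act (mulA_linear c) actDl actZl.
Qed.

(** The bracket of cX and cY carries the factor c^2; that it acts like [c] is what makes the cut
    action respect brackets. *)
Lemma cut_sq X (u : M) : lm_act (mulA (c * c) X) u = lm_act (mulA c X) u.
Proof.
apply/eqP; rewrite eq_sym -subr_eq0 -actNl -actDl -mulAN -mulAD; apply/eqP.
by apply: annihilates_mulA; move: ac; rewrite mulrBr mulr1.
Qed.

Lemma cut_lie X Y (u : M) :
  cut_act (lie X Y) u = cut_act X (cut_act Y u) - cut_act Y (cut_act X u).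
Proof. by rewrite /cut_act -lm_lie mulA_lie cut_sq. Qed.

Definition cut : lieMod L := LieMod cut_bilin cut_lie.
End Cut.

Lemma ann_compl (M : lieMod L) c :
  annihilates M (c * (1 - c)) -> annihilates M ((1 - c) * (1 - (1 - c))).
Proof. by rewrite subKr mulrC. Qed.

Lemma cut_comm (M : lieMod L) c X Y (u : M) : annihilates M (c * (1 - c)) ->
  lm_act (mulA c X) (lm_act (mulA (1 - c) Y) u) =
  lm_act (mulA (1 - c) Y) (lm_act (mulA c X) u).
Proof. by move=> ac; rewrite act_swap mulA_lie annihilates_mulA // add0r. Qed.

Lemma cut_sum (M : lieMod L) c X (u : M) :
  lm_act (mulA c X) u + lm_act (mulA (1 - c) X) u = lm_act X u.
Proof. by rewrite -actDl -mulAD addrC subrK mulA1. Qed.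

(** Factors [F] are traded for [G] one at a time. The commutator of [H] and [F] is -2 G, and [G]
    commutes with [F]; as G^r m is an eigenvector of [H], applying [H] to F^(p+1) G^r m = 0 leaves
    F^p G^(r+1) m = 0. *)
Lemma f_cut_nil (M : lieMod L) (m : M) c i (x : k) K :
  annihilates M (c * (1 - c)) ->
  lm_act (mtens (hh i) c : L) m = x *: m ->
  iter K (lm_act (mtens (f i) 1 : L)) m = 0 ->
  iter K (lm_act (mtens (f i) c : L)) m = 0.
Proof.
move=> ac hm FK.
set F := lm_act (mtens (f i) 1 : L) in FK *; set G := lm_act (mtens (f i) c : L).
set H := lm_act (mtens (hh i) c : L) in hm.
have FG u : F (G u) = G (F u).
  by rewrite /F /G act_swap mtens_lie liexx mtens0l act0l add0r.
have HF u : H (F u) = - 2%:R *: G u + F (H u).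
  by rewrite /H /F act_swap mtens_lie lie_hhf mtensZl actZl mulr1.
have HG u : H (G u) = - 2%:R *: G u + G (H u).
  rewrite /H /G act_swap mtens_lie lie_hhf mtensZl actZl.
  by rewrite -(mulr1 (c * c)) -mulA_mtens cut_sq // mulA_mtens mulr1.
have FD u v : F (u + v) = F u + F v by apply: actDr.
have FZ d u : F (d *: u) = d *: F u by apply: actZr.
have GZ d u : G (d *: u) = d *: G u by apply: actZr.
have HGr r : H (iter r G m) = (x - (2 * r)%:R) *: iter r G m.
  elim: r => [|r IH]; first by rewrite muln0 subr0.
  by rewrite iterS HG IH GZ -scalerDl; congr (_ *: _); ring.
have FpG p u : iter p F (G u) = G (iter p F u).
  by elim: p => [//|p IH] /=; rewrite IH FG.
have FpZ p d u : iter p F (d *: u) = d *: iter p F u.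
  by elim: p => [//|p IH] /=; rewrite IH FZ.
have HFp p u : H (iter p.+1 F u) =
    - (2 * p.+1)%:R *: iter p F (G u) + iter p.+1 F (H u).
  elim: p => [|p IH]; first by rewrite /= HF muln1.
  rewrite iterS HF IH FD FZ addrA -FpG -!iterS; congr (_ + _).
  by rewrite -scalerDl; congr (_ *: _); ring.
suff Q p r : (p + r)%N = K -> iter p F (iter r G m) = 0.
  by apply: (Q 0%N K).
elim: r p => [|r IH] p; first by rewrite addn0 => ->.
rewrite addnS -addSn => E; have := HFp p (iter r G m).
rewrite (IH _ E) HGr FpZ (IH _ E) scaler0 addr0 /H act0r => /esym/eqP.
rewrite scaler_eq0 oppr_eq0 natr_neq0 // muln_eq0 /= => /eqP.
by rewrite -iterS.
Qed.

Lemma tens_leib (M N : lieMod L) X (u : M) (v : N) a b :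
  iter a.+1 (lm_act X) u = 0 -> iter b.+1 (lm_act X) v = 0 ->
  iter (a + b).+1 (lm_act (l := lm_tensor M N) X) (tens u v) = 0.
Proof.
have [tl tr] := @tens_bilin k M N.
have t0l w : tens (0 : M) (w : N) = 0 by exact: (lin0 (tl w)).
have t0r (w : M) : tens w (0 : N) = 0 by exact: (lin0 (tr w)).
have itl n : linear (iter n (lm_act (l := lm_tensor M N) X)).
  elim: n => [//|n IH] x w w'; rewrite !iterS IH.
  exact: (lm_bilin (lm_tensor M N)).2.
have [n] := ubnP (a + b); elim: n a b u v => [//|n IH] a b u v.
rewrite ltnS => lt ua vb; rewrite iterSr /= tm_act_tens (linD (itl _)).
have -> : iter (a + b) (lm_act (l := lm_tensor M N) X) (tens (lm_act X u) v) = 0.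
  case: a lt ua => [|a] lt ua; first by rewrite /= in ua; rewrite ua t0l (lin0 (itl _)).
  by rewrite addSn IH // -iterSr.
rewrite add0r; case: b lt vb => [|b] lt vb.
  by rewrite /= in vb; rewrite vb t0r (lin0 (itl _)).
by rewrite addnS IH // ?addnS // -?iterSr // -addnS.
Qed.

Lemma chi_mul1 phi c y a : (forall x, Supp phi x -> pt_eval x c = 1) ->
  chi phi y (c * a) = chi phi y a.
Proof.
move=> c1; apply: eq_fsbigr => x /set_mem /c1 cx.
by rewrite pt_evalM cx mul1r.
Qed.

Lemma chi_mul0 phi c y a : (forall x, Supp phi x -> pt_eval x c = 0) ->
  chi phi y (c * a) = 0.
Proof.
move=> c0; apply: fsbig1 => x /c0 cx.
by rewrite pt_evalM cx mul0r mulr0.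
Qed.

(** The delicate relation is the power of [f i]. From [f_cut_nil] comes an exponent governed by
    [psi], possibly too large; the sl2 triple of the cut action lowers it to the one that [phi]
    prescribes, provided [m] is nonzero. *)
Lemma cut_weyl psi phi (M : lieMod L) (m : M) c (ac : annihilates M (c * (1 - c))) :
  in_E psi -> in_E phi -> weyl_vec psi m ->
  (forall y a, chi psi y (c * a) = chi phi y a) ->
  weyl_vec (M := cut ac) phi m.
Proof.
move=> psiE phiE [[em hm] fm] cE; have hwm : hwv td (M := cut ac) (chi phi) m.
  split=> [i a|y a yh]; rewrite /= /cut_act mulA_mtens; first exact: em.
  by rewrite hm // cE.
split=> // i n nE; have [K KE] := wt_dominant psiE i.
have itE p : iter p (lm_act (l := cut ac) (mtens (f i) 1 : L)) =1
    iter p (lm_act (l := M) (mtens (f i) c : L)).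
  by apply: eq_iter => u; rewrite -[LHS]/(lm_act (l := M) (mulA c (mtens (f i) 1)) u) mulA_mtens mulr1.
have [->|m0] := pselect (m = 0).
  by elim: n.+1 => [//|p /= ->]; rewrite /cut_act act0r.
have hc : lm_act (mtens (hh i) c : L) m = chi psi (hh i) c *: m.
  by rewrite hm // hh_in.
have FK := f_cut_nil ac hc (fm i K KE); rewrite -itE in FK.
have [||||p [pE Fp]] := @sl2_dominant k char0 L (cut ac) (mtens (e i) 1 : L)
   (mtens (f i) 1) (mtens (hh i) 1) m (chi phi (hh i) 1) _ _ _ _ K.+1 m0 FK.
- by rewrite mtens_lie lie_ef mulr1.
- by rewrite mtens_lie lie_hhf mulr1 mtensZl.
- exact: hwm.1.
- by rewrite (hwm.2 (hh i)) // hh_in.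
suff <- : p = n by [].
by apply: (natr_inj0 char0); rewrite -pE -nE chi1 //; apply: phiE.1.
Qed.

Lemma cut_iter_comm (M : lieMod L) c (ac : annihilates M (c * (1 - c)))
    (ac' : annihilates M ((1 - c) * (1 - (1 - c)))) X Y n (u : M) :
  iter n (lm_act (l := cut ac) X) (lm_act (l := cut ac') Y u) =
  lm_act (l := cut ac') Y (iter n (lm_act (l := cut ac) X) u).
Proof. by elim: n => [//|n IH]; rewrite !iterS IH; exact (cut_comm X Y _ ac). Qed.

(** The relations of a Weyl vector for one cut action involve only operators that commute with the
    other. *)
Lemma cut_weyl_stable phi (M : lieMod L) c (ac : annihilates M (c * (1 - c)))
    (ac' : annihilates M ((1 - c) * (1 - (1 - c)))) :
  Lstable (M := cut ac') (fun u => weyl_vec (M := cut ac) phi u).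
Proof.
have itl X n : linear (iter n (lm_act (l := cut ac) X)).
  elim: n => [//|n IH] x w w'; rewrite !iterS IH.
  exact: (lm_bilin (cut ac)).2.
split; first split.
- split; first split=> [i a|y a yh]; rewrite ?act0r ?scaler0 //.
  by move=> i n _; apply: (lin0 (itl _ _)).
- move=> a u v [[eu hu] fu] [[ev hv] fv]; split; first split=> [i b|y b yh].
  + by rewrite (lm_bilin (cut ac)).2 eu ev scaler0 addr0.
  + by rewrite (lm_bilin (cut ac)).2 hu // hv // scalerDr !scalerA mulrC.
  + by move=> i n nE; rewrite itl fu // fv // scaler0 addr0.
move=> X u [[eu hu] fu]; split; first split=> [i a|y a yh].
- have := cut_iter_comm ac ac' (mtens (e i) a) X 1 u => /= ->.
  have E := eu i a; rewrite /= in E; rewrite E.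
  exact: (lin0 ((lm_bilin (cut ac')).2 X)).
- have := cut_iter_comm ac ac' (mtens y a) X 1 u => /= ->.
  have E := hu y a yh; rewrite /= in E; rewrite E.
  exact: (linZ ((lm_bilin (cut ac')).2 X)).
- by move=> i n nE; rewrite cut_iter_comm fu // act0r.
Qed.

(** * The untwisted tensor decomposition *)

Section Decomposition.
Variables (phi phi' : Xrat A -> weight td).
Hypotheses (phiE : in_E phi) (phi'E : in_E phi').
Hypothesis disj : Supp phi `&` Supp phi' = set0.

Let U := Supp phi `|` Supp phi'.
Let fU : finite_set U. Proof. by rewrite finite_setU; split; [apply: phiE.1|apply: phi'E.1]. Qed.
Let subs : Supp (phi \+ phi') `<=` U.
Proof.
move=> x /= nx; rewrite /U /=; have [p0|pn] := eqVneq (phi x) 0; last by left.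
by right; apply: contra nx => /eqP E; rewrite /= p0 E addr0.
Qed.

Let s1 : Supp phi `<=` U. Proof. by move=> x; left. Qed.
Let s2 : Supp phi' `<=` U. Proof. by move=> x; right. Qed.

Lemma disj_l x : Supp phi x -> phi' x = 0.
Proof.
move=> px; apply/eqP; apply: contrapT => /negP p'x.
by have : (Supp phi `&` Supp phi') x; [split|rewrite disj].
Qed.
Lemma disj_r x : Supp phi' x -> phi x = 0.
Proof.
move=> px; apply/eqP; apply: contrapT => /negP p'x.
by have : (Supp phi `&` Supp phi') x; [split|rewrite disj].
Qed.

Lemma in_E_add : in_E (phi \+ phi').
Proof.
split; first exact: sub_finite_set subs fU.
move=> x i /=; have [a aE] := phiE.2 x i; have [b bE] := phi'E.2 x i.
by exists (a + b)%N; rewrite wt_atDl aE bE natrD.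
Qed.

Lemma chi_add y a : chi (phi \+ phi') y a = chi phi y a + chi phi' y a.
Proof.
rewrite (chi_widen _ _ fU subs) (chi_widen _ _ fU s1) (chi_widen _ _ fU s2).
by rewrite -big_split; apply: eq_bigr => x _ /=; rewrite wt_atDl mulrDl.
Qed.

Lemma wt_add : wt (phi \+ phi') = wt phi + wt phi'.
Proof.
rewrite (wt_widen fU subs) (wt_widen fU s1) (wt_widen fU s2).
by rewrite -big_split.
Qed.
Local Notation W := (local_weyl phi).
Local Notation W' := (local_weyl phi').
Local Notation W'' := (local_weyl (phi \+ phi')).
Local Notation w := (wgen phi).
Local Notation w' := (wgen phi').
Local Notation w'' := (wgen (phi \+ phi')).

Lemma weyl_vec_tens : weyl_vec (M := lm_tensor W W') (phi \+ phi') (tens w w').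
Proof.
have [tl tr] := @tens_bilin k W W'.
have [[ew hw] fw] := wgen_vec phi; have [[ew' hw'] fw'] := wgen_vec phi'.
split; first split=> [i a|y a yh]; rewrite /= ?tm_act_tens.
- by rewrite ew ew' (lin0 (tl _)) (lin0 (tr _)) addr0.
- by rewrite hw // hw' // (linZ (tl _)) (linZ (tr _)) -scalerDl chi_add.
move=> i n nE; have [a aE] := wt_dominant phiE i; have [b bE] := wt_dominant phi'E i.
have -> : n = (a + b)%N.
  by apply: (natr_inj0 char0); rewrite -nE wt_add wt_atDl aE bE natrD.
exact (tens_leib (fw i a aE) (fw' i b bE)).
Qed.

Lemma cut_element : exists c, [/\ annihilates W (1 - c), annihilates W' c,
  annihilates W'' (c * (1 - c)),
  forall x, Supp phi x -> pt_eval x c = 1 &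
  forall x, Supp phi' x -> pt_eval x c = 0].
Proof.
have [a [a1 a0]] : exists a, (forall x, Supp phi x -> pt_eval x a = 1) /\
    (forall x, Supp phi' x -> pt_eval x a = 0).
  have [|a [a1 a0]] := @separate (fset_set (Supp phi)) (fset_set (Supp phi')).
    move=> x; rewrite !in_fset_set; [|exact: phi'E.1|exact: phiE.1].
    move=> /set_mem px; apply/negP => /set_mem p'x.
    by have : (Supp phi `&` Supp phi') x by []; rewrite disj.
  exists a; split=> x px; [apply: a1|apply: a0]; rewrite in_fset_set ?mem_set //.
    exact: phiE.1.
  exact: phi'E.1.
have a1' x : Supp phi x -> pt_eval x (1 - a) = 0.
  by move=> /a1 ax; rewrite pt_evalB pt_eval1 ax subrr.
have [N1 h1] := ann_power char0 phiE (wgen_vec phi) (wgen_generates phi) a1'.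
have [N2 h2] := ann_power char0 phi'E (wgen_vec phi') (wgen_generates phi') a0.
have aa x : Supp (phi \+ phi') x -> pt_eval x (a * (1 - a)) = 0.
  move=> /subs [/a1 ax|/a0 ax]; rewrite pt_evalM pt_evalB pt_eval1 ax.
    by rewrite subrr mulr0.
  by rewrite mul0r.
have [N3 h3] := ann_power char0 in_E_add (wgen_vec _) (wgen_generates _) aa.
have annW (M : lieMod L) b N N' : (N <= N')%N -> annihilates M (b ^+ N) -> annihilates M (b ^+ N').
  by move=> le hb; rewrite -(subnKC le) exprD; apply: annihilatesM.
(* One exponent for three modules: a power of 1 - a kills [W], one of [a] kills [W'], and one of a
   (1 - a) kills [W'']. *)
pose N := (N1 + N2 + N3)%N.
have [q [q' [E E']]] := idempotent_lift a N.
set c := 1 - _ in E E'; exists c; split.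
- by rewrite E'; apply/annihilatesM/annW/h1; rewrite /N -addnA leq_addr.
- by rewrite E; apply/annihilatesM/annW/h2; rewrite /N addnAC leq_addl.
- rewrite E' E mulrACA -exprMn; apply/annihilatesM/annW/h3.
  by rewrite /N leq_addl.
- move=> x /a1 ax; rewrite /c pt_evalB pt_evalX pt_evalB pt_evalX pt_eval1 ax.
  by rewrite expr1n subrr expr0n /= subr0.
- move=> x /a0 ax; rewrite /c pt_evalB pt_evalX pt_evalB pt_evalX pt_eval1 ax.
  by rewrite expr0n /= subr0 expr1n subrr.
Qed.

Theorem weyl_tensor : lm_iso W'' (lm_tensor W W').
Proof.
have [tl tr] := @tens_bilin k W W'.
have [c [aW aW' aW'' c1 c0]] := cut_element.
have inE := in_E_add.
have aWc := ann_compl aW''.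
have [F [lF hF] Fw] := weyl_lift inE.1 weyl_vec_tens.
have w1 : weyl_vec (M := cut aW'') phi w''.
  apply: (cut_weyl aW'' inE phiE (wgen_vec _)) => y a.
  by rewrite chi_add chi_mul1 // chi_mul0 // addr0.
have w2 : weyl_vec (M := cut aWc) phi' w''.
  apply: (cut_weyl aWc inE phi'E (wgen_vec _)) => y a.
  rewrite chi_add chi_mul0 ?chi_mul1 ?add0r // => x; rewrite pt_evalB pt_eval1.
    by move=> /c0 ->; rewrite subr0.
  by move=> /c1 ->; rewrite subrr.
(* The inverse is built in two stages. [T] maps [W'] to [W''] with the action cut by 1 - c; each
   [T v] is again a Weyl vector for the action cut by [c], so [W] maps to [W''] with [w] sent to
   [T v]. *)
have [T [lT hT] Tw] := weyl_lift phi'E.1 w2.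
have wT v : weyl_vec (M := cut aW'') phi (T v).
  move: v; apply: (wgen_generates phi'); last by rewrite Tw.
  have [sS gS] := cut_weyl_stable phi aW'' aWc.
  split; first split.
  - by rewrite (lin0 lT); apply: sS.1.
  - by move=> a u v hu hv; rewrite lT; apply: sS.2.
  - by move=> X u hu; rewrite hT; apply: gS.
have /choice [B hB] : forall v, exists G : W -> cut aW'', lie_hom G /\ G w = T v.
  by move=> v; have [G hG Gw] := weyl_lift phiE.1 (wT v); exists G.
have gw := wgen_generates phi.
have bB : bilin (fun u v => B v u : W'').
  split=> [v|u a v v']; first exact: (hB v).1.1.
  (* Homomorphisms from [W] are determined by the image of [w], so linearity in [v] is inherited
     from [T]. *)
  apply: (hom_ext (M := W) (N := cut aW'') (F := B (a *: v + v'))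
    (G := fun u => a *: B v u + B v' u) (hB _).1 _ gw).
    split=> [b x y|X x].
      rewrite (hB v).1.1 (hB v').1.1 !scalerDr addrACA !scalerA (mulrC a).
      by congr (_ + _).
    rewrite (hB v).1.2 (hB v').1.2.
    by rewrite (lm_bilin (cut aW'')).2.
  by rewrite !(hB _).2 lT.
have BX X u v : B (lm_act X v) u = lm_act (l := cut aWc) X (B v u).
  move: u; apply: (hom_ext (M := W) (N := cut aW'') (F := B (lm_act X v))
    (G := fun u => lm_act (l := cut aWc) X (B v u)) (hB _).1 _ gw).
    split=> [b x y|Y x].
      by rewrite (hB v).1.1 (lm_bilin (cut aWc)).2.
    rewrite (hB v).1.2; exact (esym (cut_comm _ _ _ aW'')).

  by rewrite !(hB _).2 hT.
pose G : tensor W W' -> W'' := tlift (fun u v => B v u).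
have lG : linear G := tlift_linear bB.
have Gt u v : G (tens u v) = B v u := tlift_tens bB u v.
have hG : lie_hom (M := lm_tensor W W') G.
  split=> // X; apply: (tensor_lin_ext (F := fun t => G (lm_act (l := lm_tensor W W') X t))
    (G := fun t => lm_act X (G t))).
  - by move=> a s t; rewrite (lm_bilin (lm_tensor W W')).2 lG.
  - by move=> a s t; rewrite lG (lm_bilin W'').2.
  - move=> u v; rewrite /= tm_act_tens (linD lG) !Gt (hB v).1.2 BX.
    exact (cut_sum (M := W'') c X (B v u)).
(* On the tensor product cX acts on the first factor only and (1 - c)X on the second only, so the
   two factors can be generated one after the other. *)
have gt : generates (M := lm_tensor W W') (tens w w').
  move=> S [sS gS] Sw.
  have S1 u : S (tens u w').
    move: u; apply: gw => //; split; first split.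
    - by rewrite (lin0 (tl _)); apply: sS.1.
    - by move=> a u v hu hv; rewrite tl; apply: sS.2.
    move=> X u hu; have : S (tm_act (mulA c X) (tens u w')) := gS _ _ hu.
    rewrite tm_act_tens.
    rewrite (annihilates_mulA _ _ aW') (lin0 (tr _)) addr0.
    by rewrite -(cut_sum c X u) (annihilates_mulA _ _ aW) addr0.
  move=> t; elim/tensor_ind: t => [u v|||].
  - move: v; apply: (wgen_generates phi') => //; split; first split.
    + by rewrite (lin0 (tr _)); apply: sS.1.
    + by move=> a v v' hv hv'; rewrite tr; apply: sS.2.
    move=> X v hv; have : S (tm_act (mulA (1 - c) X) (tens u v)) := gS _ _ hv.
    rewrite tm_act_tens.
    rewrite (annihilates_mulA _ _ aW) (lin0 (tl _)) add0r.
    by rewrite -(cut_sum c X v) (annihilates_mulA _ _ aW') add0r.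
  - exact: sS.1.
  - by move=> x y; apply: (subspD sS).
  - by move=> a x; apply: (subspZ sS).
exists F; split=> //; exists G.
  apply: (hom_ext (M := W'') (N := W'') (F := G \o F) (G := id) _ _ (wgen_generates _)) => //.
    split; first exact: comp_linear.
    by move=> X u /=; rewrite hF hG.2.
  by rewrite /= Fw Gt (hB _).2 Tw.
apply: (hom_ext (M := lm_tensor W W') (N := lm_tensor W W') (F := F \o G) (G := id) _ _ gt) => //.
  split; first exact: comp_linear.
  by move=> X u /=; rewrite hG.2 hF.
by rewrite /= Gt (hB _).2 Tw Fw.
Qed.
End Decomposition.
End TensorProduct.

(** * Local Weyl modules supported at one point *)

Section Twist.
Variables (k : closedFieldType) (char0 : [pchar k] =i pred0).
Variables (g : finLieAlgType k) (g_ss : semisimple g) (A : comAlgType k).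
Variable td : triangular_decomposition g.
Local Notation L := (mapAlg g A).
Local Notation e := (td_ei td).
Local Notation f := (td_fi td).
Local Notation hh := (td_hi td).
Local Notation h := (td_h td).
Local Notation al := (al (td := td)).

Lemma map_eval_lie (x : Xrat A) : {morph (map_eval x : L -> g) : X Y / lie X Y}.
Proof.
move=> X Y; have lm := @map_eval_linear k g A x.
move: X; apply: mtens_ind.
  split=> [|a X X' hX hX']; first by rewrite lie0l (lin0 lm) lie0l.
  by rewrite lieDl lieZl lm hX hX' lm lieDl lieZl.
move=> y a; move: Y; apply: mtens_ind.
  split=> [|b X X' hX hX']; first by rewrite lie0r (lin0 lm) lie0r.
  by rewrite lieDr lieZr lm hX hX' lm lieDr lieZr.
move=> z b; rewrite mtens_lie !map_evalE pt_evalM lieZl lieZr scalerA.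
by rewrite mulrC.
Qed.

Definition evmod (x : Xrat A) (V : lieMod g) : lieMod L :=
  lm_pull (@map_eval_linear k g A x) (map_eval_lie x) V.

Lemma evmodE x (V : lieMod g) y a (u : V) : lm_act (l := evmod x V) (mtens y a : L) u =
  pt_eval x a *: lm_act y u.
Proof. by rewrite -actZl -map_evalE. Qed.

Definition dpt (lam : weight td) (x : Xrat A) : Xrat A -> weight td :=
  restr_to [set x] (fun=> lam).

Lemma dpt_supp lam x : Supp (dpt lam x) `<=` [set x].
Proof.
move=> y; rewrite /Supp /dpt /restr_to /=; case: ifP => [/set_mem //|_].
by rewrite eqxx.
Qed.

Lemma dptE lam x : dpt lam x x = lam.
Proof. by rewrite /dpt /restr_to mem_set. Qed.

Lemma chi_dpt lam x y a : chi (dpt lam x) y a = wt_at lam y * pt_eval x a.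
Proof.
rewrite (chi_widen _ _ (finite_set1 x) (@dpt_supp lam x)) fset_set1.
by rewrite big_seq_fset1 dptE.
Qed.

Lemma wt_dpt lam x : wt (dpt lam x) = lam.
Proof.
rewrite (wt_widen (finite_set1 x) (@dpt_supp lam x)) fset_set1.
by rewrite big_seq_fset1 dptE.
Qed.

Lemma dpt_fin lam x : finite_set (Supp (dpt lam x)).
Proof. exact: sub_finite_set (@dpt_supp lam x) (finite_set1 x). Qed.

Definition pt_weyl (M : lieMod L) (lam : weight td) x (m : M) := [/\
  forall i a, lm_act (mtens (e i) a : L) m = 0,
  forall y a, y \in h -> lm_act (mtens y a : L) m = (wt_at lam y * pt_eval x a) *: m &
  forall i n, wt_at lam (hh i) = n%:R ->
    iter n.+1 (lm_act (mtens (f i) 1 : L)) m = 0].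

Lemma pt_weylE (M : lieMod L) lam x (m : M) :
  pt_weyl lam x m <-> weyl_vec (dpt lam x) m.
Proof.
split=> [[em hm fm]|[[em hm] fm]]; split=> //.
- by split=> // y a yh; rewrite chi_dpt hm.
- by rewrite wt_dpt.
- by move=> y a yh; rewrite hm // chi_dpt.
- by move: fm; rewrite wt_dpt.
Qed.

Lemma irr_sub (V : lieMod g) (S : V -> Prop) (v : V) : irreducible V ->
  g_stable S -> S v -> v <> 0 -> forall u, S u.
Proof.
move=> [_ irr] [sS gS] Sv v0 u.
have [||E] := irr [set u | S u].
- by split=> //; [exact: sS.1|move=> a w w'; apply: sS.2].
- by move=> E; have : [set u | S u] v by []; rewrite E.
by have : [set u | S u] u by rewrite E.
Qed.

Lemma iter_f_wt (V : lieMod g) (v : V) lam i n : is_wt lam v ->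
  is_wt (lam - al i *+ n) (iter n (lm_act (f i)) v).
Proof.
move=> wv; elim: n => [|n IH]; first by rewrite mulr0n subr0.
rewrite mulrS opprD addrCA; exact: is_wt_act (is_wt_f i) IH.
Qed.

(** If [u] were nonzero it would be singular, and by irreducibility the words in the [f j] applied
    to [u] would span [V]. Their weights lie below [lam - al i *+ n.+1], so [v] is not among their
    sums. Passing to [evmod x V] makes the results on highest weight vectors over [g (x) A]
    available. *)
Lemma irr_f_nil (V : lieMod g) (v : V) lam (x : Xrat A) i n : irreducible V ->
  v <> 0 -> (forall i, lm_act (e i) v = 0) -> is_wt (td := td) lam v ->
  wt_at lam (hh i) = n%:R -> iter n.+1 (lm_act (f i)) v = 0.
Proof.
move=> irr v0 ev wv nE; set u := iter _ _ _; apply: contrapT => u0.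
have wu : is_wt (lam - al i *+ n.+1) u by apply: iter_f_wt.
have eu j : lm_act (e j) u = 0.
  have [<-|ij] := eqVneq i j.
    have hv : lm_act (hh i) v = n%:R *: v by rewrite -nE; apply/wv/hh_in.
    by rewrite /u (sl2_E (lie_ef i) (lie_hhf i) (ev i) hv) subrr mulr0 scale0r.
  rewrite /u; elim: n.+1 => [|p IH]; first exact: ev.
  by rewrite iterS act_swap td_ef eq_sym (negPf ij) act0l IH act0r addr0.
pose chiu (y : g) (a : A) := pt_eval x a * wt_at (lam - al i *+ n.+1) y.
have hu : hwv td (M := evmod x V) chiu u.
  split=> [j a|y a yh]; rewrite evmodE; first by rewrite eu scaler0.
  by rewrite wu // scalerA.
have [sF gF] := fspan_stable hu.
have vF : fspan td (M := evmod x V) u v.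
  apply: (irr_sub (S := fspan td (M := evmod x V) u) irr _ _ u0).
    split=> // y w hw; have := gF (mtens y 1) w hw.
    by rewrite evmodE pt_eval1 scale1r.
  exact: fword_fspan (fword0 _ _).
have wE (m : V) (nu : weight td) : is_wt nu m -> is_wt (M := gmod (evmod x V)) nu m.
  by move=> wm y yh; rewrite gmodE evmodE pt_eval1 scale1r wm.
have nb : ~ below (lam - al i *+ n.+1) lam.
  move=> [q qE]; have [r rh r1] := rho_exists g_ss td.
  have := congr1 (fun l : weight td => wt_at l r) qE.
  rewrite !wt_atBl wt_at_suml -addrA -{1}[wt_at lam r]addr0 => /addrI /esym/eqP.
  rewrite -opprD oppr_eq0 wt_atMn r1 mulr1; under eq_bigr do rewrite wt_atMn r1 mulr1.
  by rewrite -natr_sum -natrD natr_neq0.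
apply: v0; exact (wspan_wt (hwv_wspan hu (wE _ _ wu) vF) (wE _ _ wv) nb).
Qed.

Lemma irr_weyl (V : lieMod g) (v : V) lam (x : Xrat A) : irreducible V ->
  v <> 0 -> (forall i, lm_act (e i) v = 0) -> is_wt (td := td) lam v ->
  pt_weyl (M := evmod x V) lam x v.
Proof.
move=> irr v0 ev wv; split=> [i a|y a yh|i n nE].
- by rewrite evmodE ev scaler0.
- by rewrite evmodE wv // scalerA mulrC.
rewrite -[RHS](irr_f_nil x irr v0 ev wv nE).
apply: (eq_iter (f := lm_act (l := evmod x V) (mtens (f i) 1 : L))) => u.
by rewrite evmodE pt_eval1 scale1r.
Qed.

(** * Casimir eigenspaces of a local Weyl module at one point *)

Section PointModule.
Variables (lam : weight td) (x : Xrat A).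
Hypothesis dlam : dominant_integral lam.
Local Notation W := (local_weyl (dpt lam x)).
Local Notation w := (wgen (dpt lam x)).

Let ww : pt_weyl lam x w. Proof. exact/pt_weylE/wgen_vec. Qed.
Let gw : generates w. Proof. exact: wgen_generates. Qed.
Let hw : hwv td (chi (dpt lam x)) w. Proof. exact: (wgen_vec _).1. Qed.
Lemma wgen_wt : is_wt (M := gmod W) lam w.
Proof. by have := hwv_wt (dpt_fin lam x) hw; rewrite wt_dpt. Qed.

Lemma single_locnil (M : lieMod L) (m : M) i : generates m ->
  (exists n, iter n (lm_act (mtens (f i) 1 : L)) m = 0) ->
  forall u : M, exists n, iter n (lm_act (l := gmod M) (f i)) u = 0.
Proof.
move=> gm [n hn] u; pose F := fun _ : unit => f i.
have adF y : locnil F (M := lm_adj g) y.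
  have [p hp] := f_locnil char0 g_ss td y.
  by exists p; apply: (wordnil_sub (fun=> i) hp).
have [|p hp] := locnil_gen gm adF _ u; last by exists p; apply/(wordnil_iter (M := gmod M)).
by exists n; apply/(wordnil_iter (M := gmod M)).
Qed.

Lemma e_locnil_gen (M : lieMod L) (m : M) : generates m ->
  (forall i, lm_act (mtens (e i) 1 : L) m = 0) ->
  forall u : M, locnil e (M := gmod M) u.
Proof.
move=> gm em; apply: (locnil_gen gm (e_locnil char0 g_ss td)).
by exists 1%N => i; apply: em.
Qed.

Lemma W_fnil i (u : W) : exists n, iter n (lm_act (l := gmod W) (f i)) u = 0.
Proof.
apply: (single_locnil gw); have [n nE] := dlam i; exists n.+1.
by have [_ _ fw] := ww; apply: fw.
Qed.

Variables (C : weight td -> k) (s : seq (g * g)).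
Hypothesis ds : dual_list s.
Hypothesis Csing : forall (M : lieMod g) (m : M) nu,
  (forall i, lm_act (e i) m = 0) -> is_wt nu m -> casimir s m = C nu *: m.
Hypothesis Cdiff : forall mu n, dominant_integral mu ->
  dominant_integral (mu - root_sum n) -> (exists i, 0 < n i)%N ->
  qpos (C mu - C (mu - root_sum n)).

Definition Eig d (u : W) := casimir s (M := gmod W) u = d *: u.

Lemma Eig_stable d : g_stable (M := gmod W) (Eig d).
Proof.
split; last first.
  by move=> y u hu; rewrite /Eig casimir_act // hu actZr.
split; first by rewrite /Eig (lin0 (@casimir_linear k g s (gmod W))) scaler0.
move=> a u v hu hv; rewrite /Eig (@casimir_linear k g s (gmod W)) hu hv.
by rewrite scalerDr !scalerA mulrC.
Qed.

Lemma W_wspan (u : W) : wspan (M := gmod W) (below lam) u.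
Proof. exact: hwv_wspan hw wgen_wt (gen_fspan u hw gw). Qed.

(** A nonzero stable subspace contains a singular vector; its weight is dominant, of the form
    [lam - root_sum n], and [d] is the Casimir value there. Either some [n i] is positive and this
    value is smaller than at [lam], or the weight is [lam] and the vector lies on the line of
    [w]. *)
Lemma Eig_bound d (S : W -> Prop) u : g_stable (M := gmod W) S -> S u -> u <> 0 ->
  (forall v, S v -> Eig d v) ->
  qpos (C lam - d) \/ (d = C lam /\ S w).
Proof.
move=> gS Su u0 SE.
have [|nu [t [[n ->] [wt_t et] St t0]]] :=
    @singular_find k g td (gmod W) S (below lam) u gS _ (W_wspan u) W_wspan Su u0.
  by apply: (e_locnil_gen gw) => i; have [ew _ _] := ww; apply: ew.
have dn : dominant_integral (lam - root_sum n).
  by apply: (singular_dominant char0 t0 (conj wt_t et)) => i; apply: W_fnil.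
have dE : d = C (lam - root_sum n).
  have := Csing et wt_t; rewrite (SE _ St) => /eqP.
  by rewrite -subr_eq0 -scalerBl scaler_eq0 subr_eq0 => /orP [/eqP|/eqP].
have [[i ni]|n0] := pselect (exists i, 0 < n i)%N.
  by left; rewrite dE; apply: Cdiff => //; exists i.
have n0' : root_sum n = 0 :> weight td.
  rewrite /root_sum big1 // => i _; case: (posnP (n i)) => [->|ni]; first exact: mulr0n.
  by case: n0; exists i.
right; rewrite n0' subr0 in dE wt_t; split=> //.
have [c tE] := hwv_line char0 g_ss hw gw wgen_wt wt_t.
have c0 : c != 0.
  by apply/eqP => c0; apply: t0; rewrite tE c0 scale0r.
have -> : w = c^-1 *: t by rewrite tE scalerA mulVf // scale1r.
exact: (subspZ gS.1).
Qed.

Lemma not_qpos0 : ~ qpos (0 : k).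
Proof. by move=> /(qpos_neq0 char0); rewrite eqxx. Qed.

Lemma Eig_w : Eig (C lam) w.
Proof.
apply: Csing; last exact: wgen_wt.
by move=> i; have [ew _ _] := ww; apply: ew.
Qed.

Section Projection.
Variables (V : lieMod g) (v : V) (p : W -> evmod x V).
Hypotheses (irrV : irreducible V) (v0 : v <> 0).
Hypotheses (hp : lie_hom p) (pw : p w = v).

Lemma p_g y (u : W) : p (lm_act (l := gmod W) y u) = lm_act (l := V) y (p u).
Proof. by rewrite gmodE hp.2 evmodE pt_eval1 scale1r. Qed.

(** The kernel of [p] on the eigenspace is stable under [g]. Were it nonzero, [Eig_bound] would
    place [w] in it, whereas [p w = v] is nonzero. *)
Lemma p_inj u : Eig (C lam) u -> p u = 0 -> u = 0.
Proof.
move=> Eu pu; apply: contrapT => u0.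
have [sE gE] := Eig_stable (C lam).
pose S t := Eig (C lam) t /\ p t = 0.
have gS : g_stable (M := gmod W) S.
  split; first split.
  - by split; [exact: sE.1|exact: (lin0 hp.1)].
  - move=> a t t' [Et pt] [Et' pt']; split; first exact: sE.2.
    by rewrite hp.1 pt pt' scaler0 addr0.
  move=> y t [Et pt]; split; first exact: gE.
  by rewrite p_g pt; exact (@act0r _ _ V y).
have [||[_ [_ pw0]]] := Eig_bound gS (conj Eu pu) u0 (d := C lam).
- by move=> t [].
- by rewrite subrr => /not_qpos0.
by apply: v0; rewrite -pw pw0.
Qed.

Lemma p_surj t : exists2 u, Eig (C lam) u & p u = t.
Proof.
have [sE gE] := Eig_stable (C lam).
suff : exists u, Eig (C lam) u /\ p u = t by move=> [u [Eu pu]]; exists u.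
apply: (irr_sub (S := fun t => exists u, Eig (C lam) u /\ p u = t) irrV _ _ v0).
  split; first split.
  - by exists 0; split; [exact: sE.1|exact: (lin0 hp.1)].
  - move=> a t1 t2 [u1 [E1 <-]] [u2 [E2 <-]]; exists (a *: u1 + u2).
    by split; [exact: sE.2|exact: hp.1].
  by move=> y t1 [u1 [E1 <-]]; exists (lm_act (l := gmod W) y u1); rewrite p_g; split=> //; exact: gE.
by exists w; split; [exact: Eig_w|].
Qed.

(** A submodule containing [u] meets the eigenspace in a nonzero subspace stable under [g], which
    contains [w] by [Eig_bound]. *)
Lemma Eig_generates u : Eig (C lam) u -> u <> 0 -> generates u.
Proof.
move=> Eu u0 S [sS lS] Su.
have [sE gE] := Eig_stable (C lam).
pose S' t := Eig (C lam) t /\ S t.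
have gS : g_stable (M := gmod W) S'.
  split; first split.
  - by split; [exact: sE.1|exact: sS.1].
  - by move=> a t t' [Et pt] [Et' pt']; split; [exact: sE.2|exact: sS.2].
  by move=> y t [Et pt]; split; [exact: gE|exact: lS].
have [||[_ [_ Sw]]] := Eig_bound gS (conj Eu Su) u0 (d := C lam).
- by move=> t [].
- by rewrite subrr => /not_qpos0.
by apply: gw.
Qed.
End Projection.
End PointModule.
End Twist.

(** * Twisting by an element of the group *)

Section GroupTwist.
Variables (k : closedFieldType) (char0 : [pchar k] =i pred0).
Variables (g : finLieAlgType k) (g_ss : semisimple g) (A : comAlgType k).
Variable td : triangular_decomposition g.
Variables (Gam : finGroupType) (ag : lieAction Gam g) (aA : algAction Gam A).
Local Notation L := (mapAlg g A).
Local Notation e := (td_ei td).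
Local Notation f := (td_fi td).
Local Notation hh := (td_hi td).
Local Notation h := (td_h td).
Local Notation al := (al (td := td)).
Local Notation dg := (diag_fun ag aA).

Lemma ag_K c y : ag c (ag c^-1%g y) = y.
Proof. by rewrite -la_M mulgV la_1. Qed.
Lemma ag_VK c y : ag c^-1%g (ag c y) = y.
Proof. by rewrite -la_M mulVg la_1. Qed.
Lemma dg_VK c X : dg c^-1%g (dg c X) = X.
Proof. by rewrite -diag_M mulVg diag_1. Qed.

Lemma pt_eval_act c x a : pt_eval (pt_act aA c x) a = pt_eval x (aA c^-1%g a).
Proof. by []. Qed.

Lemma pt_act_M c d x : pt_act aA (c * d)%g x = pt_act aA c (pt_act aA d x).
Proof. by apply: Xrat_ext => a; rewrite !pt_eval_act invMg aa_M. Qed.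
Lemma pt_act_1 x : pt_act aA 1%g x = x.
Proof. by apply: Xrat_ext => a; rewrite !pt_eval_act invg1 aa_1. Qed.
Lemma pt_act_VK c x : pt_act aA c^-1%g (pt_act aA c x) = x.
Proof. by rewrite -pt_act_M mulVg pt_act_1. Qed.

Definition tw (c : Gam) (M : lieMod L) : lieMod L :=
  lm_pull (diag_linear ag aA c^-1%g) (diag_lie ag aA c^-1%g) M.

Lemma twE c (M : lieMod L) X (u : M) :
  lm_act (l := tw c M) X u = lm_act (l := M) (dg c^-1%g X) u.
Proof. by []. Qed.

Lemma tw_generates c (M : lieMod L) (m : M) :
  generates m <-> generates (M := tw c M) m.
Proof.
split=> gm S [sS lS]; apply: gm; split=> // X u Su.
  by have := lS (dg c X) u Su; rewrite twE dg_VK.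
by rewrite twE; apply: lS.
Qed.

Lemma twist_irr c (V : lieMod g) : irreducible V -> irreducible (lm_twist ag c V).
Proof.
move=> [v irr]; split=> // S [S0 SD SA]; apply: irr; split=> // y u Su.
have := SA (ag c y) u Su.
have -> : lm_act (l := lm_twist ag c V) (ag c y) u = lm_act (l := V) y u.
  by rewrite -[LHS]/(lm_act (l := V) (ag c^-1%g (ag c y)) u) ag_VK.
by [].
Qed.

Lemma hw_singular (V : lieMod g) (lam : weight td) : has_highest_weight V lam ->
  exists v : V, [/\ v <> 0, forall i, lm_act (e i) v = 0 & is_wt lam v].
Proof.
move=> [v [v0 nv hv]]; exists v; split=> // i; apply: nv.
by have [_ ein _] := td_np_gen td.
Qed.

Lemma wt_actV c (lam mu : weight td) : wt_act ag c lam mu -> wt_act ag c^-1%g mu lam.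
Proof.
move=> [V [irr [v [v0 nv hv]] hmu]]; exists (lm_twist ag c V).
split=> //; first exact: twist_irr.
have E y (u : V) : lm_act (l := lm_twist ag c^-1%g (lm_twist ag c V)) y u =
    lm_act (l := V) y u.
  rewrite -[LHS]/(lm_act (l := V) (ag c^-1%g (ag (c^-1)^-1%g y)) u) invgK.
  by rewrite ag_VK.
exists v; split=> // y yh; rewrite E; [exact: nv|exact: hv].
Qed.

Lemma hom_surj (M N : lieMod L) (F : M -> N) m : lie_hom F -> generates (F m) ->
  forall u, exists v, F v = u.
Proof.
move=> [lF hF] gF; apply: (gF (fun u => exists v, F v = u)); last by exists m.
split; first split.
- by exists 0; apply: lin0.
- by move=> a u v [u' <-] [v' <-]; exists (a *: u' + v'); apply: lF.
by move=> X u [v <-]; exists (lm_act X v); apply: hF.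
Qed.

Section Point.
Variables (c : Gam) (lam mu : weight td) (x : Xrat A).
Hypotheses (dlam : dominant_integral lam) (dmu : dominant_integral mu).
Hypothesis cact : wt_act ag c lam mu.
Local Notation W := (local_weyl (dpt lam x)).
Local Notation w := (wgen (dpt lam x)).
Local Notation Wc := (tw c W).

Lemma dg_mtens y a : dg c^-1%g (mtens y a) = mtens (ag c^-1%g y) (aA c^-1%g a).
Proof. exact: diag_tens. Qed.

Lemma gmod_tw y (u : W) : lm_act (l := gmod Wc) y u =
  lm_act (l := gmod W) (ag c^-1%g y) u.
Proof. by rewrite gmodE twE dg_mtens rmorph1. Qed.

(** The twist replaces the dual list by its image under an automorphism, which is again a dual
    list. *)
Lemma casimir_tw s (u : W) : dual_list s ->
  casimir s (M := gmod Wc) u = casimir s (M := gmod W) u.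
Proof.
move=> ds.
have ds' := dual_aut (la_linear ag c^-1%g) (la_lie ag c^-1%g) (la_linear ag c)
  (ag_VK c) (ag_K c) ds.
rewrite -(casimir_eq (M := gmod W) u ds' ds) /casimir big_map.
by apply: eq_bigr => p _; rewrite !gmod_tw.
Qed.

Lemma twist_vector : exists m : W, generates m /\
  pt_weyl (M := Wc) mu (pt_act aA c x) m.
Proof.
have [V [irrV /hw_singular [v [v0 ev wv]] /hw_singular [v' [v'0 ev' wv']]]] := cact.
have irrV' := twist_irr c irrV.
have [C [Csing' Cdiff]] := casimir_theory char0 g_ss td.
have [s ds] := dual_list_exists char0 g_ss td.
have Csing M m nu := Csing' s M m nu ds.
have /pt_weylE wvV := irr_weyl char0 g_ss x irrV v0 ev wv.
have [p hp pw] := weyl_lift (dpt_fin lam x) wvV.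
have pin := p_inj char0 g_ss dlam ds Csing Cdiff v0 hp pw.
have [m Em pm] := p_surj ds Csing irrV v0 hp pw v'.
have [sE gE] := Eig_stable lam x ds (C lam).
have m0 : m <> 0 by move=> m0; apply: v'0; rewrite -pm m0; apply: (lin0 hp.1).
have gm : generates m := Eig_generates char0 g_ss dlam ds Csing Cdiff Em m0.
have pgc y u : p (lm_act (l := gmod Wc) y u) = lm_act (l := lm_twist ag c V) y (p u).
  by rewrite gmod_tw p_g.
have gEc y u : Eig s (C lam) u -> Eig s (C lam) (lm_act (l := gmod Wc) y u).
  by rewrite gmod_tw; apply: gE.
(* The vectors obtained from [m] under [g] stay in the eigenspace, where [p] is injective, so the
   relations with coefficient 1 can be checked in the twist of [V]. *)
have em i : lm_act (l := gmod Wc) (e i) m = 0.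
  by apply: pin; [apply: gEc|rewrite pgc pm ev'].
have wm : is_wt (M := gmod Wc) mu m.
  move=> y yh; apply/subr0_eq/pin.
    by apply: (subspB sE); [apply: gEc|apply: (subspZ sE)].
  by rewrite (linB hp.1) (linZ hp.1) pgc pm wv' // subrr.
have iterE i n : Eig s (C lam) (iter n (lm_act (l := gmod Wc) (f i)) m) /\
    p (iter n (lm_act (l := gmod Wc) (f i)) m) =
    iter n (lm_act (l := lm_twist ag c V) (f i)) v'.
  elim: n => [//|n [E1 E2]]; rewrite !iterS; split; first exact: gEc.
  by rewrite pgc E2.
have fm i n : wt_at mu (hh i) = n%:R ->
    iter n.+1 (lm_act (l := gmod Wc) (f i)) m = 0.
  move=> nE; have [E1 E2] := iterE i n.+1; apply: pin => //.
  by rewrite E2 (irr_f_nil char0 g_ss x irrV' v'0 ev' wv' nE).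
have gmc : generates (M := Wc) m := proj1 (tw_generates c (M := W) m) gm.
have fnil i (u : W) : exists n, iter n (lm_act (l := gmod Wc) (f i)) u = 0.
  have [n nE] := dmu i.
  exact (single_locnil char0 g_ss gmc (ex_intro _ n.+1 (fm i n nE)) u).
have enil (u : W) : locnil e (M := gmod Wc) u.
  exact: (e_locnil_gen char0 g_ss gmc em).
have Cmu : C mu = C lam.
  have := Csing (gmod Wc) m mu em wm; rewrite casimir_tw // Em => /eqP.
  rewrite eq_sym -subr_eq0 -scalerBl scaler_eq0 subr_eq0.
  by move=> /orP [/eqP|/eqP].
(* With a coefficient [a] the result need not be in the eigenspace a priori, so weights are used
   instead: if nonzero it could be raised to a singular vector of dominant weight strictly above
   [mu], whose Casimir value would exceed [C mu = C lam], against [Eig_bound]. *)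
have eam i a : lm_act (l := Wc) (mtens (e i) a) m = 0.
  set t := lm_act _ _; apply: contrapT => t0.
  pose S (u : W) := exists n, is_wt (M := gmod Wc) (mu + root_sum n) u /\
    exists j, (0 < n j)%N.
  have wt1 : S t.
    exists (fun j => (j == i : nat)); split; last by exists i; rewrite eqxx.
    have -> : root_sum (fun j => (j == i : nat)) = al i :> weight td.
      by have := root_sumS (fun=> 0%N) i; rewrite root_sum0 add0r => <-.
    move=> y yh; rewrite gmodE act_swap mtens_lie lie_he // mul1r mtensZl actZl.
    have -> : lm_act (l := Wc) (mtens y 1) m = wt_at mu y *: m := wm y yh.
    by rewrite actZr -scalerDl wt_atDl addrC.
  have [|u [[n [wu [j nj]]] u0 eu]] := locnil_last (enil t) wt1 t0.
    move=> j u [n [wu [j' nj']]]; exists (fun l => n l + (l == j))%N; split.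
      by rewrite root_sumS addrA addrC; apply: is_wt_act (is_wt_e j) wu.
    by exists j'; rewrite addn_gt0 nj'.
  have dn : dominant_integral (mu + root_sum n).
    by apply: (singular_dominant char0 u0 (conj wu eu)).
  have Eu : Eig s (C (mu + root_sum n)) u.
    by rewrite /Eig -casimir_tw //; exact (Csing (gmod Wc) u _ eu wu).
  have Q : qpos (C (mu + root_sum n) - C lam).
    have := Cdiff (mu + root_sum n) n dn; rewrite addrK Cmu; apply=> //.
    by exists j.
  have [||] := Eig_bound char0 g_ss dlam Csing Cdiff
    (Eig_stable lam x ds (C (mu + root_sum n))) Eu u0 (d := C (mu + root_sum n)).
  - by [].
  - move=> Q'; have := qposD Q Q'; rewrite addrA subrK subrr.
    exact: (not_qpos0 char0).
  by move=> [E _]; move: Q; rewrite E subrr; apply: (not_qpos0 char0).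
(* Now that the [e i (x) a] kill [m], the vector [t] is singular of weight [mu] and hence lies in
   the eigenspace; [p] sends it to zero because the coefficient, moved by [c^-1], vanishes at
   [x]. *)
have ham y a : y \in h -> pt_eval (pt_act aA c x) a = 0 ->
    lm_act (l := Wc) (mtens y a) m = 0.
  move=> yh a0; set t := lm_act _ _.
  have et i : lm_act (l := gmod Wc) (e i) t = 0.
    rewrite /t gmodE act_swap eam act0r addr0.
    by rewrite mtens_lie lieC lie_he // mtensNl mtensZl actNl actZl eam scaler0 oppr0.
  have wt_t : is_wt (M := gmod Wc) mu t.
    move=> y' yh'; rewrite /t gmodE act_swap mtens_lie (h_abelian yh' yh).
    rewrite mtens0l act0l add0r.
    have -> : lm_act (l := Wc) (mtens y' 1) m = wt_at mu y' *: m := wm y' yh'.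
    by rewrite actZr.
  apply: pin.
    by rewrite /Eig -casimir_tw // (Csing (gmod Wc) t mu et wt_t) Cmu.
  rewrite /t twE hp.2 dg_mtens evmodE -pt_eval_act a0.
  exact: scale0r.
exists m; split=> //; split=> //.
move=> y a yh; rewrite -[a in LHS](subrK (pt_eval (pt_act aA c x) a *: 1)).
rewrite mtensDr mtensZr actDl actZl ham //; last first.
  by rewrite pt_evalB pt_evalZ pt_eval1 mulr1 subrr.
have -> : lm_act (l := Wc) (mtens y 1) m = wt_at mu y *: m := wm y yh.
by rewrite add0r scalerA mulrC.
Qed.
End Point.

Lemma weyl_twist c (lam mu : weight td) x :
  dominant_integral lam -> dominant_integral mu -> wt_act ag c lam mu ->
  lm_iso (local_weyl (dpt mu (pt_act aA c x))) (tw c (local_weyl (dpt lam x))).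
Proof.
move=> dl dm cact.
have [m1 [g1 /pt_weylE w1]] := twist_vector x dl dm cact.
have [m2 [g2 /pt_weylE w2]] := twist_vector (pt_act aA c x) dm dl (wt_actV cact).
rewrite pt_act_VK in w2.
have [F [lF hF] Fw] := weyl_lift (dpt_fin _ _) w1.
have [G [lG hG] Gw] := weyl_lift (dpt_fin _ _) w2.
have sF : forall u, exists v, F v = u.
  by apply: (hom_surj (conj lF hF) (m := wgen _)); rewrite Fw; apply: (proj1 (tw_generates c m1) g1).
have sG : forall u, exists v, G v = u.
  by apply: (hom_surj (conj lG hG) (m := wgen _)); rewrite Gw; apply: (proj1 (tw_generates c^-1%g m2) g2).
pose Wm := local_weyl (dpt mu (pt_act aA c x)).
have hGF : lie_hom (M := Wm) (N := Wm) (G \o F).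
  split; first exact: comp_linear.
  move=> X u; rewrite /= hF twE hG twE.
  by rewrite invgK -diag_M mulgV diag_1.
set w := wgen (dpt mu (pt_act aA c x)).
have hw : hwv td (chi (dpt mu (pt_act aA c x))) w := (wgen_vec _).1.
have ww : is_wt (td := td) (M := gmod Wm) mu w := wgen_wt _ _.
have [t tE] : exists t, G (F w) = t *: w.
  apply: (hwv_line char0 g_ss hw (wgen_generates _) ww) => y yh.
  rewrite gmodE -(hGF.2 _ w).
  have -> : lm_act (l := Wm) (mtens y 1) w = wt_at mu y *: w := ww y yh.
  exact: (linZ hGF.1).
have GF u : G (F u) = t *: u.
  apply: (hom_ext (M := Wm) (N := Wm) hGF (G := fun u => t *: u) _ (wgen_generates _) tE).
  split=> [a u' v'|X u']; last by rewrite actZr.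
  by rewrite scalerDr !scalerA mulrC.
(* If the scalar is zero, surjectivity of [F] and [G] forces the module to be zero, and injectivity
   is trivial. *)
have iF u v : F u = F v -> u = v.
  move=> E; have E' : t *: u = t *: v by rewrite -!GF E.
  have [t0|t0] := eqVneq t 0; last by apply: (scalerI t0).
  have z0 z : z = 0 :> Wm.
    have [z1 <-] := sG z; have [z2 <-] := sF z1.
    by rewrite GF t0 scale0r.
  by rewrite (z0 u) (z0 v).
have /choice [H FH] := sF.
exists F; split=> //; exists H => u; last exact: FH.
by apply: iF; rewrite FH.
Qed.
End GroupTwist.

(** * Restriction to the fixed points *)

Section Isomorphisms.
Variables (k : fieldType) (L : lieAlgType k).
Implicit Types M N P : lieMod L.

Lemma lm_iso_refl M : lm_iso M M.
Proof. by exists id; split=> //; exists id. Qed.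

Lemma lm_iso_trans M N P : lm_iso M N -> lm_iso N P -> lm_iso M P.
Proof.
move=> [F [lF bF hF]] [G [lG bG hG]]; exists (G \o F); split.
- exact: comp_linear.
- exact: bij_comp.
by move=> x v /=; rewrite hF hG.
Qed.

Lemma lm_iso_sym M N : lm_iso M N -> lm_iso N M.
Proof.
move=> [F [lF [G FK GK] hF]]; exists G; split; last 1 first.
- by move=> x v; apply: (can_inj FK); rewrite hF !GK.
- by move=> a u v; apply: (can_inj FK); rewrite lF !GK.
by exists F.
Qed.

Lemma lm_iso_tensor M M' N N' : lm_iso M M' -> lm_iso N N' ->
  lm_iso (lm_tensor M N) (lm_tensor M' N').
Proof.
move=> [F [lF [F' FK F'K] hF]] [G [lG [G' GK G'K] hG]].
have lF' : linear F' by move=> a u v; apply: (can_inj FK); rewrite lF !F'K.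
have lG' : linear G' by move=> a u v; apply: (can_inj GK); rewrite lG !G'K.
have fbil (A B C D : lmodType k) (f : A -> C) (h : B -> D) : linear f -> linear h ->
    bilin (fun u v => tens (f u) (h v) : tensor C D).
  move=> lf lh; have [tl tr] := @tens_bilin k C D.
  by split=> [v a u u'|u a v v']; rewrite ?lf ?lh ?tl ?tr.
pose T := tlift (fun u v => tens (F u) (G v)) : tensor M N -> tensor M' N'.
pose T' := tlift (fun u v => tens (F' u) (G' v)) : tensor M' N' -> tensor M N.
have lT : linear T := tlift_linear (fbil _ _ _ _ _ _ lF lG).
have lT' : linear T' := tlift_linear (fbil _ _ _ _ _ _ lF' lG').
have TE u v : T (tens u v) = tens (F u) (G v) := tlift_tens (fbil _ _ _ _ _ _ lF lG) u v.
have T'E u v : T' (tens u v) = tens (F' u) (G' v) := tlift_tens (fbil _ _ _ _ _ _ lF' lG') u v.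
exists T; split=> //.
  exists T'.
    apply: (tensor_lin_ext (F := T' \o T) (G := id)) => //; first exact: comp_linear.
    by move=> u v; rewrite /= TE T'E FK GK.
  apply: (tensor_lin_ext (F := T \o T') (G := id)) => //; first exact: comp_linear.
  by move=> u v; rewrite /= T'E TE F'K G'K.
move=> x; apply: (tensor_lin_ext (F := fun t => T (tm_act x t)) (G := fun t => tm_act x (T t))).
- by move=> a u v; rewrite tm_act_linear lT.
- by move=> a u v; rewrite lT tm_act_linear.
by move=> u v; rewrite tm_act_tens (linD lT) !TE tm_act_tens hF hG.
Qed.
End Isomorphisms.

Section Restriction.
Variables (k : fieldType) (Gam : finGroupType) (L : lieAlgType k).
Variable r : lieAction Gam L.

Lemma lm_iso_restrict (M N : lieMod L) :
  lm_iso M N -> lm_iso (lm_restrict r M) (lm_restrict r N).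
Proof. by move=> [F [lF bF hF]]; exists F; split=> // x v; apply: hF. Qed.

Lemma restrict_tensor (M N : lieMod L) :
  lm_iso (lm_restrict r (lm_tensor M N))
         (lm_tensor (lm_restrict r M) (lm_restrict r N)).
Proof. by exists id; split=> //; exists id. Qed.
End Restriction.

(** * Independence of the transversal and the twisted tensor formula *)

Section TwistedWeyl.
Variables (k : closedFieldType) (char0 : [pchar k] =i pred0).
Variables (g : finLieAlgType k) (g_ss : semisimple g) (A : comAlgType k).
Variable td : triangular_decomposition g.
Variables (Gam : finGroupType) (ag : lieAction Gam g) (aA : algAction Gam A).
Local Notation Res := (lm_restrict (diag_action ag aA)).
Implicit Types (psi phi : Xrat A -> weight td).

Definition sim phi phi' := lm_iso (Res (local_weyl phi)) (Res (local_weyl phi')).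

Lemma in_E_restr (S : set (Xrat A)) psi : in_E psi -> in_E (restr_to S psi).
Proof.
move=> [fin dom]; split.
  apply: sub_finite_set fin => x; rewrite /Supp /restr_to /=.
  by case: ifP => //; rewrite eqxx.
move=> x i; rewrite /restr_to; case: ifP => _; first exact: dom.
by exists 0%N; rewrite wt_at0l.
Qed.

Lemma restr_disj (S T : set (Xrat A)) psi psi' : S `&` T = set0 ->
  Supp (restr_to S psi) `&` Supp (restr_to T psi') = set0.
Proof.
move=> ST; apply/seteqP; split=> // x [].
rewrite /Supp /restr_to /=; case: ifP => [/set_mem Sx _|_]; last by rewrite eqxx.
case: ifP => [/set_mem Tx _|_]; last by rewrite eqxx.
by have : (S `&` T) x by []; rewrite ST.
Qed.

Lemma restrict_weyl_tensor phi phi' : in_E phi -> in_E phi' ->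
  Supp phi `&` Supp phi' = set0 ->
  lm_iso (Res (local_weyl (phi \+ phi')))
         (lm_tensor (Res (local_weyl phi)) (Res (local_weyl phi'))).
Proof.
move=> Ep Ep' d; apply: lm_iso_trans (restrict_tensor _ _ _).
by apply: lm_iso_restrict; apply: weyl_tensor.
Qed.

Lemma sim_add phi phi' psi psi' : in_E phi -> in_E phi' -> in_E psi -> in_E psi' ->
  Supp phi `&` Supp phi' = set0 -> Supp psi `&` Supp psi' = set0 ->
  sim phi psi -> sim phi' psi' -> sim (phi \+ phi') (psi \+ psi').
Proof.
move=> E1 E2 E3 E4 d d' s s'.
apply: lm_iso_trans (restrict_weyl_tensor E1 E2 d) _.
apply: lm_iso_trans (lm_iso_tensor s s') _.
exact: lm_iso_sym (restrict_weyl_tensor E3 E4 d').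
Qed.

(** A fixed element equals its translate by [c^-1], so the twist is invisible to the fixed-point
    algebra and [weyl_twist] becomes an isomorphism of untwisted restrictions. *)
Lemma sim_pt psi c x : in_E_equiv ag aA psi ->
  sim (dpt (psi x) x) (dpt (psi (pt_act aA c x)) (pt_act aA c x)).
Proof.
move=> [[fin dom] eq]; apply: lm_iso_sym.
have [F [lF bF hF]] := weyl_twist char0 g_ss aA x (dom x) (dom _) (eq c x).
exists F; split=> // X v; rewrite [LHS]hF.
have := fixed_valP X c^-1%g.
by rewrite /lm_act /= /pull_act /= => ->.
Qed.

Lemma restr_set1 psi x : restr_to [set x] psi = dpt (psi x) x.
Proof.
by apply/funext => y; rewrite /restr_to /dpt /restr_to; case: ifP => // /set_mem ->.
Qed.

Lemma restr_cons psi x s : x \notin s ->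
  restr_to [set` x :: s] psi = restr_to [set x] psi \+ restr_to [set` s] psi.
Proof.
move=> xs; apply/funext => y; rewrite /restr_to /= !mem_setE inE.
have -> : (y \in [set x]) = (y == x).
  by apply/idP/eqP => [/set_mem //|->]; apply/mem_set.
by have [->|_] := eqVneq y x; rewrite /= ?(negPf xs) ?addr0 ?add0r.
Qed.

(** One point is moved at a time: [restr_cons] splits it off, and [sim_add] recombines through the
    tensor decomposition on both sides. *)
Lemma sim_list psi (sg : Xrat A -> Xrat A) s : in_E_equiv ag aA psi ->
  uniq s -> uniq (map sg s) -> (forall x, x \in s -> exists c, sg x = pt_act aA c x) ->
  sim (restr_to [set` s] psi) (restr_to [set` map sg s] psi).
Proof.
move=> Ep; elim: s => [|x s IH] /=; first by move=> _ _ _; apply: lm_iso_refl.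
move=> /andP [xs us] /andP [sx usg] orb.
rewrite (restr_cons _ xs) (restr_cons _ sx).
have dj y (l : seq (Xrat A)) : y \notin l -> [set y] `&` [set` l] = set0.
  by move=> yl; apply/seteqP; split=> // z [/= ->] yl'; rewrite yl' in yl.
apply: sim_add; try exact: (in_E_restr _ Ep.1).
- exact/restr_disj/dj.
- exact/restr_disj/dj.
- have [c cE] := orb x (mem_head _ _); rewrite cE !restr_set1.
  exact: sim_pt.
- by apply: IH => // y ys; apply: orb; rewrite inE ys orbT.
Qed.

Lemma transversal_sim psi (S T : set (Xrat A)) : in_E_equiv ag aA psi ->
  supp_transversal aA psi S -> supp_transversal aA psi T ->
  sim (restr_to S psi) (restr_to T psi).
Proof.
move=> Ep [Ssub Suniq] [Tsub Tuniq].
have /finite_seqP [s0 S0] : finite_set S := sub_finite_set Ssub Ep.1.1.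
pose s := undup s0.
have sE : S = [set` s] by rewrite S0; apply/seteqP; split=> x /=; rewrite mem_undup.
have sS x : x \in s -> S x by move=> xs; rewrite sE.
(* On the support [sg] picks the representative of the orbit in [T]; elsewhere its value is
   arbitrary. *)
have /choice [sg sgP] : forall x, exists y, Supp psi x ->
    T y /\ exists c, y = pt_act aA c x.
  move=> x; have [/Tuniq [y [yT _]]|nx] := pselect (Supp psi x); first by exists y.
  by exists x => px.
have orbS x y c : S x -> S y -> x = pt_act aA c y -> x = y.
  move=> Sx Sy E; have [z [_ zU]] := Suniq y (Ssub y Sy).
  have <- : z = x by apply: zU; split=> //; exists c.
  by apply: zU; split=> //; exists 1%g; rewrite pt_act_1.
have TE : T = [set` map sg s].
  apply/seteqP; split=> y /=; last first.
    by move=> /mapP [x /sS Sx ->]; apply: (sgP x (Ssub x Sx)).1.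
  move=> Ty; have [x [[Sx [c xE]] _]] := Suniq y (Tsub y Ty).
  have [Tx [d dE]] := sgP x (Ssub x Sx).
  have [z [_ zU]] := Tuniq y (Tsub y Ty).
  apply/mapP; exists x; first by have := Sx; rewrite {1}sE.
  have <- : z = y by apply: zU; split=> //; exists 1%g; rewrite pt_act_1.
  by apply: zU; split=> //; exists (d * c)%g; rewrite dE xE pt_act_M.
rewrite TE sE; apply: sim_list => //; first exact: undup_uniq.
  rewrite map_inj_in_uniq ?undup_uniq // => x y /sS Sx /sS Sy E.
  have [_ [c cE]] := sgP x (Ssub x Sx); have [_ [d dE]] := sgP y (Ssub y Sy).
  apply: (orbS x y (c^-1 * d)%g Sx Sy).
  by rewrite pt_act_M -dE -E cE pt_act_VK.
by move=> x /sS Sx; have [_ H] := sgP x (Ssub x Sx).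
Qed.

(** A highest weight vector of weight 0 in the twist is also killed by the [f i] ([irr_f_nil] with n
    = 0), hence by [g]. By irreducibility [g] acts by zero on the whole module, so lam = 0. This
    makes supports of equivariant functions stable under the group. *)
Lemma wt_act0 c (lam : weight td) (x : Xrat A) : wt_act ag c lam 0 -> lam = 0.
Proof.
move=> [V [irr /hw_singular [v [v0 ev wv]] /hw_singular [v' [v'0 ev' wv']]]].
have irr' := twist_irr ag c irr.
have gv' y : lm_act (l := lm_twist ag c V) y v' = 0.
  move: y; apply: (g_ind (td := td) (S := fun y => lm_act (l := lm_twist ag c V) y v' = 0)).
  - split=> [|a y z hy hz]; first by rewrite act0l.
    by rewrite actDl actZl hy hz scaler0 addr0.
  - by move=> y z hy hz; rewrite lm_lie hy hz !act0r subrr.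
  - exact: ev'.
  move=> i; apply: (irr_f_nil char0 g_ss x irr' v'0 ev' wv' (n := 0%N)).
  exact: wt_at0l.
have gu (u : lm_twist ag c V) : forall y, lm_act (l := lm_twist ag c V) y u = 0.
  apply: (irr_sub (S := fun u => forall y, lm_act (l := lm_twist ag c V) y u = 0)
    irr' _ gv' v'0).
  split; first split=> [y|a u1 u2 h1 h2 y]; first exact: act0r.
    by rewrite actDr actZr h1 h2 scaler0 addr0.
  by move=> z u1 h1 y; rewrite (h1 z) act0r.
apply: wt_ext => i; rewrite wt_at0l.
have := wv _ (hh_in i).
have -> : lm_act (td_hi td i) v = 0.
  have := gu v (ag c (td_hi td i)).
  by rewrite -[LHS]/(lm_act (l := V) (ag c^-1%g (ag c (td_hi td i))) v) ag_VK.
by move=> /esym/eqP; rewrite scaler_eq0 => /orP [/eqP|/eqP].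
Qed.

Lemma supp_act psi c x : in_E_equiv ag aA psi -> Supp psi x ->
  Supp psi (pt_act aA c x).
Proof.
move=> [_ eq] /= px; apply: contra px => /eqP E.
by have := eq c x; rewrite E => /(wt_act0 x) ->.
Qed.

Lemma transversal_restr psi phi (S : set (Xrat A)) : in_E_equiv ag aA psi ->
  supp_transversal aA phi S -> Supp psi `<=` Supp phi ->
  supp_transversal aA psi (S `&` Supp psi).
Proof.
move=> Ep [Ssub Suniq] sub; split=> [x []//|x px].
have [y [[Sy [c yE]] yU]] := Suniq x (sub x px).
exists y; split; first split; first split=> //.
- by rewrite yE; apply: supp_act.
- by exists c.
by move=> z [[Sz _] orb]; apply: yU.
Qed.

(** [S''] is cut along the two supports. The pieces are transversals for [psi] and [psi'], in
    general other than [S] and [S']; [transversal_sim] makes up the difference. *)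
Lemma twisted_weyl_tensor psi psi' (S S' S'' : set (Xrat A)) :
  in_E_equiv ag aA psi -> in_E_equiv ag aA psi' ->
  Supp psi `&` Supp psi' = set0 ->
  supp_transversal aA psi S -> supp_transversal aA psi' S' ->
  supp_transversal aA (psi \+ psi') S'' ->
  lm_iso (twisted_weyl ag aA (psi \+ psi') S'')
         (lm_tensor (twisted_weyl ag aA psi S) (twisted_weyl ag aA psi' S')).
Proof.
move=> Ep Ep' disj tS tS' tS''.
have sub : Supp psi `<=` Supp (psi \+ psi').
  by move=> x px; rewrite /Supp /= (disj_l disj px) addr0.
have sub' : Supp psi' `<=` Supp (psi \+ psi').
  by move=> x px; rewrite /Supp /= (disj_r disj px) add0r.
have tT := transversal_restr Ep tS'' sub; have tT' := transversal_restr Ep' tS'' sub'.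
rewrite /twisted_weyl.
have -> : restr_to S'' (psi \+ psi') =
    restr_to (S'' `&` Supp psi) psi \+ restr_to (S'' `&` Supp psi') psi'.
  have E phi y : restr_to (S'' `&` Supp phi) phi y = restr_to S'' phi y.
    rewrite /restr_to in_setI; case: (y \in S'') => //=.
    case: ifP => // /negbT; rewrite notin_setE /= => /negP.
    by rewrite negbK => /eqP ->.
  apply/funext => y; rewrite /= !E /restr_to; case: (y \in S'') => //.
  by rewrite addr0.
apply: lm_iso_trans (lm_iso_tensor (transversal_sim Ep tT tS) (transversal_sim Ep' tT' tS')).
have d : Supp (restr_to (S'' `&` Supp psi) psi) `&`
    Supp (restr_to (S'' `&` Supp psi') psi') = set0.
  apply: restr_disj; apply/seteqP; split=> // x [[_ px] [_ p'x]].
  by have : (Supp psi `&` Supp psi') x by []; rewrite disj.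
exact (restrict_weyl_tensor (in_E_restr _ Ep.1) (in_E_restr _ Ep'.1) d).
Qed.
End TwistedWeyl.

Theorem proposition3p9 (k : closedFieldType) (char0 : [pchar k] =i pred0)
    (A : comAlgType k) (A_fg : fin_gen_alg A)
    (g : finLieAlgType k) (g_ss : semisimple g)
    (Gam : finGroupType) (Gam_abelian : forall c d : Gam, (c * d = d * c)%g)
    (aA : algAction Gam A) (ag : lieAction Gam g) (aA_free : acts_freely aA)
    (td : triangular_decomposition g)
    (psi psi' : Xrat A -> weight td)
    (psiE : in_E_equiv ag aA psi) (psi'E : in_E_equiv ag aA psi')
    (disj : Supp psi `&` Supp psi' = set0)
    (S S' S'' : set (Xrat A))
    (S_tr : supp_transversal aA psi S)
    (S'_tr : supp_transversal aA psi' S')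
    (S''_tr : supp_transversal aA (psi \+ psi') S'') :
  lm_iso (twisted_weyl ag aA (psi \+ psi') S'')
         (lm_tensor (twisted_weyl ag aA psi S) (twisted_weyl ag aA psi' S')).
Proof.
exact (twisted_weyl_tensor char0 g_ss psiE psi'E disj S_tr S'_tr S''_tr).
Qed.
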